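(* Let $N\geq 1$ be an integer, $1\leq p<\infty$ and $0<s<1$ with $ps\neq 1$. Put $$\mathcal D_{N,p,s} := 2 \pi^{(N-1)/2}\, \frac{\Gamma((1+ps)/2)}{\Gamma((N+ps)/2)} \int_0^1 \left|1 - r^{(ps-1)/p} \right|^p \frac{dr}{(1-r)^{1+ps}} .$$ Then for all $u\in \mathcal W^s_p(\mathbb R^N_+)$, $$\iint_{\mathbb R^N_+\times\mathbb R^N_+} \frac{|u(x)-u(y)|^p}{|x-y|^{N+ps}} \,dx\,dy \;\geq\; \mathcal D_{N,p,s} \int_{\mathbb R^N_+} \frac{|u(x)|^p}{x_N^{ps}}\,dx .$$ The constant $\mathcal D_{N,p,s}$ is optimal, i.e. the inequality for all $u\in \mathcal W^s_p(\mathbb R^N_+)$ fails if $\mathcal D_{N,p,s}$ is replaced by any larger constant. If $p=1$ and $N=1$, equality holds for $u\in\mathcal W^s_p(\mathbb R^N_+)$ if and only if $u$ is proportional to a non-increasing function. If $p>1$, or if $p=1$ and $N\geq 2$, the inequality is strict for every $u\in \mathcal W^s_p(\mathbb R^N_+)$ with $u\not\equiv 0$.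
   Context: $\mathbb R^N_+ := \{(x',x_N): x'\in\mathbb R^{N-1},\ x_N>0\}$ is the open half-space (so $\mathbb R^1_+=(0,\infty)$), and $x_N$ denotes the last coordinate of $x$. For $1\le p<\infty$, $0<s<1$, $ps\ne 1$, $\mathcal W^s_p(\mathbb R^N_+)$ denotes the completion of $C_0^\infty(\mathbb R^N_+)$ (smooth functions with compact support in the open half-space) with respect to the norm $$\left(\iint_{\mathbb R^N_+\times\mathbb R^N_+} \frac{|u(x)-u(y)|^p}{|x-y|^{N+ps}}\,dx\,dy\right)^{1/p}.$$ By the (known, non-sharp) fractional Hardy inequality, which bounds the $p$-th power of this norm from below by a positive constant times $\int_{\mathbb R^N_+}|u|^p x_N^{-ps}\,dx$ for $u\in C_0^\infty(\mathbb R^N_+)$, this completion is a space of functions: its elements are identified with the (a.e. classes of) functions $u$ that are limits in $L^p(\mathbb R^N_+, x_N^{-ps}dx)$ of sequences in $C_0^\infty(\mathbb R^N_+)$ that are Cauchy for the norm $w\mapsto\left(\iint_{\mathbb R^N_+\times\mathbb R^N_+} \frac{|w(x)-w(y)|^p}{|x-y|^{N+ps}}\,dx\,dy\right)^{1/p}$. Monotonicity and equality of functions are understood up to modification on null sets. *)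

(* Defs.v *)
From HB Require Import structures.
From mathcomp Require Import all_boot all_order all_algebra.
From mathcomp Require Import all_classical all_reals all_analysis.

Set Implicit Arguments.
Unset Strict Implicit.
Unset Printing Implicit Defensive.

Import Order.TTheory GRing.Theory Num.Theory.
Import numFieldNormedType.Exports.

Local Open Scope classical_set_scope.
Local Open Scope ring_scope.

(* The product sigma-algebra on row vectors: it is generated by the coordinate
   functions, hence it is the Borel sigma-algebra when T is the real line. *)
Definition rV_display : measure_display -> measure_display.
Proof. exact. Qed.

Section rV_measurable.
Context {d : measure_display} {T : sigmaRingType d}.
Variable n : nat.

Let coord : 'I_n -> 'rV[T]_n -> T := fun i x => x ord0 i.

Let rV_set0 : g_sigma_preimage coord set0.
Proof. exact: sigma_algebra0. Qed.

Let rV_setC A : g_sigma_preimage coord A -> g_sigma_preimage coord (~` A).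
Proof. exact: sigma_algebraC. Qed.

Let rV_bigcup (F : (set 'rV[T]_n)^nat) :
  (forall i, g_sigma_preimage coord (F i)) ->
  g_sigma_preimage coord (\bigcup_i F i).
Proof. exact: sigma_algebra_bigcup. Qed.

HB.instance Definition _ := @isMeasurable.Build (rV_display d)
  'rV[T]_n (g_sigma_preimage coord) rV_set0 rV_setC rV_bigcup.

End rV_measurable.

Section rV_measurable_theory.
Context {d d' : measure_display} {T : measurableType d} {U : measurableType d'}.

Lemma measurable_rV_coord n (i : 'I_n) :
  measurable_fun [set: 'rV[T]_n] (fun x : 'rV[T]_n => x ord0 i).
Proof.
move=> _ Y mY; rewrite setTI; apply: sub_sigma_algebra => /=.
rewrite -bigcup_seq/=; exists i => /=; first by rewrite mem_index_enum.
by exists Y => //; rewrite setTI.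
Qed.

Lemma measurable_fun_rV n (f : U -> 'rV[T]_n) :
  (forall i, measurable_fun [set: U] (fun x => f x ord0 i)) ->
  measurable_fun [set: U] f.
Proof.
move=> mf _ A mA; rewrite setTI.
suff : g_sigma_preimage (fun (i : 'I_n) (x : 'rV[T]_n) => x ord0 i) `<=`
    [set B | measurable (f @^-1` B)] by exact.
apply: smallest_sub.
  split => //=; first by rewrite preimage_set0.
  - by move=> B mB; rewrite setTD preimage_setC; exact: measurableC.
  - by move=> F mF; rewrite preimage_bigcup; exact: bigcupT_measurable.
rewrite -bigcup_seq => B [i _ [C mC <-]] /=.
by rewrite setTI; have := mf i measurableT C mC; rewrite setTI.
Qed.

End rV_measurable_theory.

(* (x', t) |-> the vector of R^(n+1) with last coordinate t. *)
Definition rV_rcons {T : Type} {n : nat} (z : 'rV[T]_n * T) : 'rV[T]_n.+1 :=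
  \row_i (if unlift ord_max i is Some j then z.1 ord0 j else z.2).

Section rV_rcons_measure.
Context {R : realType} {n : nat}.
Variable mu : {sigma_finite_measure set 'rV[R]_n -> \bar R}.

Let rbelast (x : 'rV[R]_n.+1) : 'rV[R]_n * R :=
  (\row_j x ord0 (lift ord_max j), x ord0 ord_max).

Let rconsK : cancel (@rV_rcons R n) rbelast.
Proof.
case=> x t; rewrite /rbelast; congr pair; last by rewrite mxE unlift_none.
by apply/rowP => j; rewrite !mxE liftK.
Qed.

Let measurable_rcons :
  measurable_fun [set: 'rV[R]_n * R] (@rV_rcons R n).
Proof.
apply: measurable_fun_rV => i.
case: (unliftP ord_max i) => [j|] ->.
  rewrite (_ : (fun _ => _) =
      (fun x : 'rV[R]_n => x ord0 j) \o (@fst 'rV[R]_n R)).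
    by apply: measurableT_comp => //; exact: measurable_rV_coord.
  by apply/funext => z /=; rewrite mxE liftK.
rewrite (_ : (fun _ => _) = @snd 'rV[R]_n R) //.
by apply/funext => z /=; rewrite mxE unlift_none.
Qed.

Let measurable_rbelast : measurable_fun [set: 'rV[R]_n.+1] rbelast.
Proof.
apply: measurable_fun_pair; last exact: measurable_rV_coord.
apply: measurable_fun_rV => i.
rewrite (_ : (fun _ => _) = (fun x : 'rV[R]_n.+1 => x ord0 (lift ord_max i))).
  exact: measurable_rV_coord.
by apply/funext => z /=; rewrite mxE.
Qed.

(* The measure mu(dx') dt on R^(n+1). *)
Definition rV_rcons_measure : set 'rV[R]_n.+1 -> \bar R :=
  pushforward (mu \x @lebesgue_measure R)%E (@rV_rcons R n).

HB.instance Definition _ := Measure.copy rV_rcons_measure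
  (measure_function_pushforward__canonical__measure_function_Measure
     (mu \x @lebesgue_measure R)%E measurable_rcons).

Let rV_rcons_sigma_finite : sigma_finite setT rV_rcons_measure.
Proof.
have /sigma_finiteP[F [TF ndF Foo]] := sigma_finiteT mu.
have /sigma_finiteP[G [TG ndG Goo]] := sigma_finiteT (@lebesgue_measure R).
exists (fun k => rbelast @^-1` (F k `*` G k)) => [|k].
  apply/esym; rewrite -subTset => x _.
  have [i _ Fi] : (\bigcup_i F i) (rbelast x).1 by rewrite -TF.
  have [j _ Gj] : (\bigcup_j G j) (rbelast x).2 by rewrite -TG.
  exists (maxn i j) => //; split.
  - by move: Fi; exact/subsetPset/ndF/leq_maxl.
  - by move: Gj; exact/subsetPset/ndG/leq_maxr.
have [mFk Fk] := Foo k; have [mGk Gk] := Goo k; split.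
  rewrite -[X in measurable X]setTI; apply: measurable_rbelast => //.
  exact: measurableX.
rewrite /rV_rcons_measure /pushforward -comp_preimage.
rewrite (_ : rbelast \o _ = id); last first.
  by apply/funext => z /=; rewrite rconsK.
by rewrite product_measure1E// lte_mul_pinfty// ge0_fin_numE.
Qed.

HB.instance Definition _ := Measure_isSigmaFinite.Build _ _ _
  rV_rcons_measure rV_rcons_sigma_finite.

End rV_rcons_measure.

(* Lebesgue measure on R^n, as the n-fold product of the Lebesgue measure on
   the line (the unit mass at the only point of R^0 when n = 0). *)
Fixpoint rV_lebesgue (R : realType) (n : nat) :
    {sigma_finite_measure set 'rV[R]_n -> \bar R} :=
  match n with
  | 0 => @dirac _ 'rV[R]_0 0 R
  | m.+1 => rV_rcons_measure (rV_lebesgue R m)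
  end.

Section half_space.
Context {R : realType}.
Variable n : nat.
Implicit Types (x y : 'rV[R]_n.+1) (u v : 'rV[R]_n.+1 -> R) (p s : R).

Local Notation N := n.+1.
Local Notation mu := (rV_lebesgue R N).

Definition half_space : set 'rV[R]_N := [set x | 0 < x ord0 ord_max].

(* The norm `|x| of the library on row vectors is the sup norm. *)
Definition eucl_norm x : R := Num.sqrt (\sum_i x ord0 i ^+ 2).

(* The p-th power of the seminorm of W^s_p(R^N_+). On the diagonal, which is a
   null set, the integrand is 0. *)
Definition gagliardo p s u : \bar R :=
  (\int[mu \x mu]_(z in half_space `*` half_space)
     (`|u z.1 - u z.2| `^ p / eucl_norm (z.1 - z.2) `^ (N%:R + p * s))%:E)%E.

Definition gagliardo_norm p s u : \bar R := (gagliardo p s u `^ p^-1)%E.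

(* The p-th power of the norm of L^p(R^N_+, x_N^{-ps} dx). *)
Definition hardy_integral p s u : \bar R :=
  (\int[mu]_(x in half_space)
     (`|u x| `^ p / (x ord0 ord_max) `^ (p * s))%:E)%E.

Definition partial_derive (i : 'I_N) u : 'rV[R]_N -> R :=
  fun x => 'D_(delta_mx ord0 i) u x.

Definition smooth u : Prop :=
  forall l : seq 'I_N, let v := foldr partial_derive u l in
    continuous v /\ forall i x, derivable v x (delta_mx ord0 i).

Definition test_function u : Prop :=
  [/\ smooth u, compact (closure [set x | u x != 0])
    & closure [set x | u x != 0] `<=` half_space].

Definition gagliardo_cauchy p s (phi : nat -> 'rV[R]_N -> R) : Prop :=
  forall e : R, 0 < e -> exists k0 : nat, forall k l : nat,
    (k0 <= k)%N -> (k0 <= l)%N ->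
    (gagliardo_norm p s (fun x => phi k x - phi l x)%R < e%:E)%E.

(* Only the restriction of u to the half-space is relevant. Every a.e. class
   of Lebesgue measurable functions has a Borel measurable member. *)
Definition W_space p s u : Prop :=
  measurable_fun half_space u /\
  exists phi : nat -> 'rV[R]_N -> R,
    [/\ forall k, test_function (phi k), gagliardo_cauchy p s phi
      & hardy_integral p s (fun x => phi k x - u x) @[k --> \oo] --> 0%E].

End half_space.

Section constant.
Context {R : realType}.
Implicit Types (p s : R).

Definition Gamma (a : R) : R :=
  \int[@lebesgue_measure R]_(t in `]0, +oo[) (t `^ (a - 1) * expR (- t)).

Definition hardy_const (N : nat) p s : R :=
  2 * pi `^ ((N%:R - 1) / 2) * (Gamma ((1 + p * s) / 2) / Gamma ((N%:R + p * s) / 2))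
  * \int[@lebesgue_measure R]_(r in `]0, 1[)
      (`|1 - r `^ ((p * s - 1) / p)| `^ p / (1 - r) `^ (1 + p * s)).

End constant.

(* Main.v *)
(* Let omega(x) = x_N^(-alpha) with alpha = (1 - p s) / p.  On the side of the diagonal
   where t = omega(y) / omega(x) < 1, convexity of the p-th power gives
     |u(x) - u(y)|^p >= (1 - t)^(p-1) (|u(x)|^p - t^(1-p) |u(y)|^p).
   Integrating out the directions parallel to the boundary and substituting y_N = r x_N,
   the right-hand side integrates to half of D times the Hardy integral; the truncation
   |1 - r| >= 1/m makes the two terms separately integrable.  So the Gagliardo energy is
   exactly D times the Hardy integral plus twice the integral of the nonnegative deficit,
   as soon as the Hardy integral is finite, and equality means that the deficit vanishes.
   For p > 1 this forces u to be a multiple of omega, for p = 1 and N >= 2 it makes |u|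
   essentially bounded below on a strip, and in both cases u <> 0 has an infinite Hardy
   integral; for p = 1 and N = 1 it says that |u(x)| = |u(x) - u(y)| + |u(y)| when x < y.
   Optimality follows by testing with logarithmic cutoffs of omega, spread out parallel
   to the boundary: their Hardy integral grows like M r^(N-1), their excess energy is
   O(r^(N-1)) + o(r^(N-1)) as r goes to infinity and then M does. *)
Require Import Defs.
From HB Require Import structures.
From mathcomp Require Import all_boot all_order all_algebra.
From mathcomp Require Import all_classical all_reals all_analysis.
From mathcomp Require Import measurable_realfun ring lra.

Set Implicit Arguments.
Unset Strict Implicit.
Unset Printing Implicit Defensive.

Import Order.TTheory GRing.Theory Num.Theory.
Import numFieldNormedType.Exports.

Local Open Scope classical_set_scope.
Local Open Scope ring_scope.

(** Working on one side of the diagonal replaces the principal value that the Euler-Lagrange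
    equation of [omega] would call for: exchanging x and y covers the other side, and pairs of equal
    height form a null set. The value of D comes from one cancellation. The exchange turns the
    |u(y)|^p term of the deficit into a |u(x)|^p term with the extra factor r^(ps-1), where r = y_N
    / x_N. Since t = r^(-alpha) and alpha p = 1 - ps, one has t^(1-p) r^(ps-1) = t, so the two
    coefficients combine to (1-t)^(p-1) - (1-t)^(p-1) t = (1-t)^p. Against the kernel, each
    coefficient alone is integrable near r = 1 only if p(1-s) > 1, whereas (1-t)^p always is; hence
    the truncation. On W the Hardy integral is finite because u lies at finite Hardy distance from a
    test function, so the identity holds for every element of the completion itself, and strictness
    and equality are read off its deficit without a limit. In the optimality part the relative error
    of the logarithmic cutoff is of order M^(-p), which still tends to 0 when p = 1. *)

Section measurability.
Context {R : realType} {d : measure_display} {T : measurableType d}.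
Implicit Types (D : set T) (f g : T -> R) (b c : T -> bool).

(** * Measurability rules for eta-expanded functions, in the form a tactic can apply *)

Lemma measurable_fun_add D f g : measurable_fun D f -> measurable_fun D g ->
  measurable_fun D (fun x => f x + g x).
Proof. exact: measurable_funD. Qed.

Lemma measurable_fun_sub D f g : measurable_fun D f -> measurable_fun D g ->
  measurable_fun D (fun x => f x - g x).
Proof. exact: measurable_funB. Qed.

Lemma measurable_fun_mul D f g : measurable_fun D f -> measurable_fun D g ->
  measurable_fun D (fun x => f x * g x).
Proof. exact: measurable_funM. Qed.

Lemma measurable_fun_opp D f : measurable_fun D f ->
  measurable_fun D (fun x => - f x).
Proof. exact: measurable_funN. Qed.

Lemma measurable_fun_exprn D f n : measurable_fun D f ->
  measurable_fun D (fun x => f x ^+ n).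
Proof. exact: measurable_funX. Qed.

Lemma measurable_fun_norm D f : measurable_fun D f ->
  measurable_fun D (fun x => `|f x|).
Proof. exact: measurableT_comp. Qed.

Lemma measurable_fun_powR D f a : measurable_fun D f ->
  measurable_fun D (fun x => f x `^ a).
Proof. exact: (measurableT_comp (measurable_powR _)). Qed.

Lemma measurable_fun_expR D f : measurable_fun D f ->
  measurable_fun D (fun x => expR (f x)).
Proof. exact: measurableT_comp. Qed.

Lemma measurable_fun_ln D f : measurable_fun D f ->
  measurable_fun D (fun x => ln (f x)).
Proof. exact: (measurableT_comp (@measurable_ln _)). Qed.

Lemma measurable_fun_lt D f g : measurable_fun D f -> measurable_fun D g ->
  measurable_fun D (fun x => f x < g x).
Proof. exact: measurable_fun_ltr. Qed.

Lemma measurable_fun_le D f g : measurable_fun D f -> measurable_fun D g ->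
  measurable_fun D (fun x => f x <= g x).
Proof. exact: measurable_fun_ler. Qed.

Lemma measurable_fun_eq D f g : measurable_fun D f -> measurable_fun D g ->
  measurable_fun D (fun x => f x == g x).
Proof. exact: measurable_fun_eqr. Qed.

Lemma measurable_fun_and D b c : measurable_fun D b -> measurable_fun D c ->
  measurable_fun D (fun x => b x && c x).
Proof. exact: measurable_and. Qed.

Lemma measurable_fun_or D b c : measurable_fun D b -> measurable_fun D c ->
  measurable_fun D (fun x => b x || c x).
Proof. exact: measurable_or. Qed.

Lemma measurable_fun_neg D b : measurable_fun D b ->
  measurable_fun D (fun x => ~~ b x).
Proof. exact: measurable_neg. Qed.

Lemma measurable_fun_ifb (d' : measure_display) (T' : measurableType d')
    b (f g : T -> T') :
  measurable_fun setT b -> measurable_fun setT f -> measurable_fun setT g ->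
  measurable_fun setT (fun x => if b x then f x else g x).
Proof. by move=> mb mf mg; exact: measurable_fun_ifT. Qed.

Lemma measurable_fun_boolr b : measurable_fun setT b ->
  measurable_fun setT (fun x => (b x)%:R : R).
Proof.
move=> mb; rewrite (_ : (fun x => _) = (fun x => if b x then 1 else 0)).
  by apply: measurable_fun_ifb => //; exact: measurable_cst.
by apply/funext => x; case: (b x).
Qed.

(** Splitting by the sign of [f] reduces inversion to the measurable power with exponent -1; at 0
    both conventions give 0. *)
Lemma measurable_fun_inv f : measurable_fun setT f ->
  measurable_fun setT (fun x => (f x)^-1).
Proof.
move=> mf; have -> : (fun x => (f x)^-1) =
    (fun x => if 0 <= f x then f x `^ (-1) else - ((- f x) `^ (-1))).
  apply/funext => x; case: leP => fx; first by rewrite powR_inv1.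
  by rewrite powR_inv1 ?invrN ?opprK// oppr_ge0 ltW.
apply: measurable_fun_ifb.
- by apply: measurable_fun_le => //; exact: measurable_cst.
- exact: measurable_fun_powR.
- by apply: measurable_fun_opp; apply: measurable_fun_powR; exact: measurable_fun_opp.
Qed.

Lemma measurable_fun_sum_fin D (I : Type) (s : seq I) (F : I -> T -> R) :
  (forall i, measurable_fun D (F i)) ->
  measurable_fun D (fun x => \sum_(i <- s) F i x).
Proof.
move=> mF; elim: s => [|i s ih].
  under eq_fun do rewrite big_nil; exact: measurable_cst.
under eq_fun do rewrite big_cons; exact: measurable_fun_add.
Qed.

Lemma measurable_fun_prod_fin D (I : Type) (s : seq I) (F : I -> T -> R) :
  (forall i, measurable_fun D (F i)) ->
  measurable_fun D (fun x => \prod_(i <- s) F i x).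
Proof.
move=> mF; elim: s => [|i s ih].
  under eq_fun do rewrite big_nil; exact: measurable_cst.
under eq_fun do rewrite big_cons; exact: measurable_fun_mul.
Qed.

Lemma measurable_fun_EFin D f : measurable_fun D f ->
  measurable_fun D (fun x => (f x)%:E).
Proof. by move=> /measurable_EFinP. Qed.

Lemma measurable_fun_mule D (f g : T -> \bar R) :
  measurable_fun D f -> measurable_fun D g ->
  measurable_fun D (fun x => f x * g x)%E.
Proof. exact: emeasurable_funM. Qed.

Lemma measurable_fun_adde D (f g : T -> \bar R) :
  measurable_fun D f -> measurable_fun D g ->
  measurable_fun D (fun x => f x + g x)%E.
Proof. exact: emeasurable_funD. Qed.

End measurability.

Lemma measurable_fun_comp {d1 d2 d3 : measure_display} {T1 : measurableType d1}
    {T2 : measurableType d2} {T3 : measurableType d3}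
    (f : T2 -> T3) (g : T1 -> T2) : measurable_fun setT f ->
  measurable_fun setT g -> measurable_fun setT (fun x => f (g x)).
Proof. exact: measurableT_comp. Qed.

Lemma measurable_fun_fst {d1 d2 d3 : measure_display} {T1 : measurableType d1}
    {T2 : measurableType d2} {T3 : measurableType d3} (f : T1 -> T2 * T3) :
  measurable_fun setT f -> measurable_fun setT (fun x => (f x).1).
Proof. exact: (measurable_fun_comp measurable_fst). Qed.

Lemma measurable_fun_snd {d1 d2 d3 : measure_display} {T1 : measurableType d1}
    {T2 : measurableType d2} {T3 : measurableType d3} (f : T1 -> T2 * T3) :
  measurable_fun setT f -> measurable_fun setT (fun x => (f x).2).
Proof. exact: (measurable_fun_comp measurable_snd). Qed.

Lemma measurable_fun_mkpair {d1 d2 d3 : measure_display} {T1 : measurableType d1}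
    {T2 : measurableType d2} {T3 : measurableType d3} (f : T1 -> T2) (g : T1 -> T3) :
  measurable_fun setT f -> measurable_fun setT g ->
  measurable_fun setT (fun x => (f x, g x)).
Proof. exact: measurable_fun_pair. Qed.

Lemma measurable_fun_coord {d1 d2 : measure_display} {T1 : measurableType d1}
    {T2 : measurableType d2} n (i : 'I_n) (f : T1 -> 'rV[T2]_n) :
  measurable_fun setT f -> measurable_fun setT (fun x => f x ord0 i).
Proof. exact: (measurable_fun_comp (measurable_rV_coord i)). Qed.

(* Hypotheses are compared syntactically: testing convertibility would unfold
   the integrands.  [apply] leaves eta-reduced partial applications such as [Order.le 1] behind. *)
Ltac eta_measurable :=
  lazymatch goal with
  | |- measurable_fun _ (fun _ => _) => idtac
  | |- measurable_fun ?D ?f => change (measurable_fun D (fun x => f x))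
  end.
Ltac msr1 :=
  match goal with
  | H : measurable_fun _ ?f |- measurable_fun _ ?g => constr_eq f g; exact: H
  | H : measurable_fun _ ?f |- measurable_fun _ (fun x => ?g x) => constr_eq f g; exact: H
  | |- measurable_fun _ (fun x => x) => exact: measurable_id
  | |- measurable_fun _ (fun _ => ?c) => exact: measurable_cst
  | |- measurable_fun _ (fun x => (_ + _)%E) => apply: measurable_fun_adde
  | |- measurable_fun _ (fun x => (_ * _)%E) => apply: measurable_fun_mule
  | |- measurable_fun _ (fun x => (_)%:E) => apply: measurable_fun_EFin
  | |- measurable_fun _ (fun x => _ - _) => apply: measurable_fun_sub
  | |- measurable_fun _ (fun x => _ + _) => apply: measurable_fun_add
  | |- measurable_fun _ (fun x => _ * _) => apply: measurable_fun_mul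
  | |- measurable_fun _ (fun x => - _) => apply: measurable_fun_opp
  | |- measurable_fun _ (fun x => `|_|) => apply: measurable_fun_norm
  | |- measurable_fun _ (fun x => _ `^ _) => apply: measurable_fun_powR
  | |- measurable_fun _ (fun x => _ ^-1) => apply: measurable_fun_inv
  | |- measurable_fun _ (fun x => _ ^+ _) => apply: measurable_fun_exprn
  | |- measurable_fun _ (fun x => expR _) => apply: measurable_fun_expR
  | |- measurable_fun _ (fun x => ln _) => apply: measurable_fun_ln
  | |- measurable_fun _ (fun x => (nat_of_bool _)%:R) => apply: measurable_fun_boolr
  | |- measurable_fun _ (fun x => _ && _) => apply: measurable_fun_and
  | |- measurable_fun _ (fun x => _ || _) => apply: measurable_fun_or
  | |- measurable_fun _ (fun x => ~~ _) => apply: measurable_fun_neg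
  | |- measurable_fun _ (fun x => _ < _) => apply: measurable_fun_lt
  | |- measurable_fun _ (fun x => _ <= _) => apply: measurable_fun_le
  | |- measurable_fun _ (fun x => _ == _) => apply: measurable_fun_eq
  | |- measurable_fun _ (fun x => if _ then _ else _) => apply: measurable_fun_ifb
  | |- measurable_fun _ (fun x => (_, _)) => apply: measurable_fun_mkpair
  | |- measurable_fun _ (fun x => (_).1) => apply: measurable_fun_fst
  | |- measurable_fun _ (fun x => (_).2) => apply: measurable_fun_snd
  | |- measurable_fun _ (fun x => fun_of_matrix _ _ _) => apply: measurable_fun_coord
  | |- measurable_fun _ (fun x => \sum_(i <- _) _) => apply: measurable_fun_sum_fin => ?
  | |- measurable_fun _ (fun x => \prod_(i <- _) _) => apply: measurable_fun_prod_fin => ?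
  | H : measurable_fun setT ?f |- measurable_fun _ (fun x => ?g _) =>
      constr_eq f g; apply: (measurable_fun_comp H)
  | H : forall i, measurable_fun setT (?f i) |- measurable_fun _ (fun x => ?g _ _) =>
      constr_eq f g; apply: (measurable_fun_comp (H _))
  end.
Ltac msr := repeat (eta_measurable; msr1).

Ltac pos1 :=
  match goal with
  | |- is_true (_ <= (_)%:E)%E => rewrite lee_fin
  | |- is_true (0 <= _ * _) => apply: mulr_ge0
  | |- is_true (0 <= _ + _) => apply: addr_ge0
  | |- is_true (0 <= _ `^ _) => apply: powR_ge0
  | |- is_true (0 <= `|_|) => apply: normr_ge0
  | |- is_true (0 <= _ ^-1) => rewrite invr_ge0
  | |- is_true (0 <= _ ^+ 2) => apply: sqr_ge0
  | |- is_true (0 <= expR _) => apply: expR_ge0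
  | |- is_true (0 <= _%:R) => apply: ler0n
  | |- is_true (0 <= 1) => exact: ler01
  | |- is_true (0 <= pi) => exact: pi_ge0
  | H : is_true (0 <= ?x) |- is_true (0 <= ?y) => constr_eq x y; exact: H
  | H : is_true (0 < ?x) |- is_true (0 <= ?y) => constr_eq x y; exact: (ltW H)
  | H : forall x, is_true (0 <= ?f x) |- is_true (0 <= ?g _) => constr_eq f g; exact: H
  | H : forall x y, is_true (0 <= ?f x y) |- is_true (0 <= ?g _ _) =>
      constr_eq f g; exact: H
  | |- is_true (0 <= \sum_(_ <- _ | _) _) => apply: sumr_ge0 => ? _
  | |- is_true (0 <= \prod_(_ <- _ | _) _) => apply: prodr_ge0 => ? _
  end.
Ltac pos := repeat pos1.

Ltac mpos := solve [msr | let x := fresh in move=> x; pos].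

(** * Translation, dilation and reflection on the line *)

Section lebesgue_change_of_variable.
Context {R : realType}.
Local Notation leb := (@lebesgue_measure R).
Implicit Types (f : R -> \bar R).
Local Open Scope ereal_scope.

(** Lebesgue measure is determined by its values on half-open intervals, so the comparison is made
    there; dilations are treated in the same way. *)
Lemma lebesgue_measure_shift (a : R) (A : set R) : measurable A ->
  pushforward leb (fun t : measurableTypeR R => (t + a)%R : measurableTypeR R) A
  = leb A.
Proof.
have ms : measurable_fun setT (fun t : measurableTypeR R => (t + a)%R : measurableTypeR R).
  by msr.
pose ms_mixin := isMeasurableFun.Build _ _ _ _ _ ms.
(* Packing the translation as a measurable function equips its pushforward with the measure
   structure that uniqueness asks for. *)
pose g : {mfun _ >-> _} := HB.pack (fun t : measurableTypeR R => (t + a)%R : measurableTypeR R) ms_mixin.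
move=> mA; apply/esym.
apply: (@lebesgue_measure_unique R (pushforward leb g)) => //= _ [[b c]] _ <-.
rewrite /pushforward.
rewrite (_ : _ @^-1` _ = `]b - a, c - a]%classic)%R; last first.
  by apply/seteqP; split => x /=; rewrite !in_itv/= => /andP[? ?]; apply/andP; lra.
rewrite !lebesgue_measure_itv/= !lte_fin ltrD2r; case: ifPn => // _.
by rewrite -!EFinB; congr EFin; lra.
Qed.

Lemma ge0_integral_shift f (a : R) : measurable_fun setT f ->
  (forall t, 0 <= f t) -> \int[leb]_t f (t + a)%R = \int[leb]_t f t.
Proof.
move=> mf f0.
have ms : measurable_fun setT (fun t : measurableTypeR R => (t + a)%R : measurableTypeR R).
  by msr.
rewrite -[RHS](@eq_measure_integral _ _ _ _ _ (pushforward leb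
  (fun t : measurableTypeR R => (t + a)%R : measurableTypeR R))); last first.
  by move=> A mA _; exact: lebesgue_measure_shift.
by rewrite ge0_integral_pushforward.
Qed.

Lemma lebesgue_measure_scale (c : R) (A : set R) (c0 : (0 < c)%R) : measurable A ->
  leb A = c%:E * pushforward leb (fun t : measurableTypeR R => (c * t)%R : measurableTypeR R) A.
Proof.
have ms : measurable_fun setT (fun t : measurableTypeR R => (c * t)%R : measurableTypeR R).
  by msr.
pose ms_mixin := isMeasurableFun.Build _ _ _ _ _ ms.
pose g : {mfun _ >-> _} := HB.pack (fun t : measurableTypeR R => (c * t)%R : measurableTypeR R) ms_mixin.
move=> mA.
pose k : {nonneg R} := NngNum (ltW c0).
rewrite (@lebesgue_measure_unique R (mscale k (pushforward leb g)))//= => _ [[a b]] _ <-.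
rewrite /mscale/= [pushforward _ _ _](_ : _ = leb `]a / c, b / c]%classic)%R; last first.
  congr leb; apply/seteqP; split => x /=; rewrite !in_itv/=;
    by rewrite ltr_pdivrMr// ler_pdivlMr// ![(x * c)%R]mulrC.
rewrite !lebesgue_measure_itv/= !lte_fin ltr_pM2r ?invr_gt0//; case: ifPn => // _.
  by rewrite -!EFinB -EFinM; congr EFin; field; rewrite gt_eqF.
by rewrite mule0.
Qed.

Lemma ge0_integral_scale f (c : R) : (0 < c)%R -> measurable_fun setT f ->
  (forall t, 0 <= f t) -> \int[leb]_t f t = c%:E * \int[leb]_t f (c * t)%R.
Proof.
move=> c0 mf f0.
have ms : measurable_fun setT (fun t : measurableTypeR R => (c * t)%R : measurableTypeR R).
  by msr.
pose ms_mixin := isMeasurableFun.Build _ _ _ _ _ ms.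
pose g : {mfun _ >-> _} := HB.pack (fun t : measurableTypeR R => (c * t)%R : measurableTypeR R) ms_mixin.
pose k : {nonneg R} := NngNum (ltW c0).
rewrite (@eq_measure_integral _ _ _ _ (mscale k (pushforward leb g))); last first.
  by move=> A mA _; exact: (lebesgue_measure_scale c0 mA).
by rewrite ge0_integral_mscale//= ge0_integral_pushforward.
Qed.

Lemma ge0_integral_opp f : measurable_fun setT f ->
  (forall t, 0 <= f t) -> \int[leb]_t f (- t)%R = \int[leb]_t f t.
Proof.
move=> mf f0.
rewrite -[RHS](@eq_measure_integral _ _ _ _ _ (pushforward leb
  (-%R : measurableTypeR R -> measurableTypeR R))); last first.
  by move=> A mA _; exact: lebesgue_measureN.
rewrite ge0_integral_pushforward//.
Qed.

End lebesgue_change_of_variable.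

(** * Integrals of nonnegative real-valued functions, and Tonelli *)

Section real_valued_integrals.
Local Open Scope ereal_scope.
Context {R : realType} {d : measure_display} {T : measurableType d}.
Variable mu : {measure set T -> \bar R}.
Implicit Types f g : T -> R.

Lemma integralZl_real (k : R) f : (0 <= k)%R -> measurable_fun setT f ->
  (forall x, 0 <= f x)%R ->
  \int[mu]_x (k * f x)%:E = k%:E * \int[mu]_x (f x)%:E.
Proof.
move=> k0 mf f0; under eq_integral do rewrite EFinM.
by rewrite ge0_integralZl_EFin//; [move=> ? _; rewrite lee_fin|exact: measurable_fun_EFin].
Qed.

Lemma integralD_real f g : measurable_fun setT f -> measurable_fun setT g ->
  (forall x, 0 <= f x)%R -> (forall x, 0 <= g x)%R ->
  \int[mu]_x (f x + g x)%:E = \int[mu]_x (f x)%:E + \int[mu]_x (g x)%:E.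
Proof.
move=> mf mg f0 g0; under eq_integral do rewrite EFinD.
rewrite ge0_integralD//; do ?[by move=> ? _; rewrite lee_fin]; exact: measurable_fun_EFin.
Qed.

Lemma le_integral_real f g : measurable_fun setT f -> measurable_fun setT g ->
  (forall x, 0 <= f x)%R -> (forall x, f x <= g x)%R ->
  \int[mu]_x (f x)%:E <= \int[mu]_x (g x)%:E.
Proof.
move=> mf mg f0 fg; apply: ge0_le_integral => //;
  do ?[by move=> ? _; rewrite lee_fin]; exact: measurable_fun_EFin.
Qed.

Lemma ge0_integralZr_setT (f : T -> \bar R) (k : \bar R) : measurable_fun setT f ->
  (forall x, 0 <= f x) -> 0 <= k ->
  \int[mu]_x (f x * k) = (\int[mu]_x f x) * k.
Proof. by move=> mf f0 k0; rewrite ge0_integralZr. Qed.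

Lemma integral_ge0_real f : (forall x, 0 <= f x)%R -> 0 <= \int[mu]_x (f x)%:E.
Proof. by move=> f0; apply: integral_ge0 => x _; rewrite lee_fin. Qed.

(** Domains of integration become 0/1 factors from here on: all integrands are then total functions,
    and measurability and sign are proved by structure. *)
Lemma integral_boolr (b : T -> bool) f :
  \int[mu]_(x in [set x | b x]) (f x)%:E = \int[mu]_x ((b x)%:R * f x)%:E.
Proof.
rewrite integral_mkcond; apply: eq_integral => x _; rewrite patchE mem_setE.
by rewrite unfold_in; case: (b x); rewrite ?mul1r ?mul0r.
Qed.

End real_valued_integrals.

Section iterated_integrals.
Local Open Scope ereal_scope.
Context {R : realType} {d1 d2 : measure_display} {T1 : measurableType d1}
  {T2 : measurableType d2}.
Variables (m1 : {sigma_finite_measure set T1 -> \bar R})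
  (m2 : {sigma_finite_measure set T2 -> \bar R}).

Lemma exchange_integral_real (f : T1 -> T2 -> R) :
  measurable_fun setT (fun z => f z.1 z.2) -> (forall x y, 0 <= f x y)%R ->
  \int[m1]_x \int[m2]_y (f x y)%:E = \int[m2]_y \int[m1]_x (f x y)%:E.
Proof.
move=> mf f0.
apply: (@fubini_tonelli _ _ _ _ _ m1 m2 (fun z => (f z.1 z.2)%:E)).
  exact: measurable_fun_EFin.
by move=> z; rewrite lee_fin.
Qed.

Lemma integral_prod_real (f : T1 * T2 -> R) :
  measurable_fun setT f -> (forall z, 0 <= f z)%R ->
  \int[m1 \x m2]_z (f z)%:E = \int[m1]_x \int[m2]_y (f (x, y))%:E.
Proof.
move=> mf f0.
rewrite (@fubini_tonelli1 _ _ _ _ _ m1 m2 (fun z => (f z)%:E))//.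
exact: measurable_fun_EFin.
Qed.

Lemma measurable_integral_real (f : T1 -> T2 -> R) :
  measurable_fun setT (fun z => f z.1 z.2) -> (forall x y, 0 <= f x y)%R ->
  measurable_fun setT (fun x => \int[m2]_y (f x y)%:E).
Proof.
move=> mf f0.
apply: (@measurable_fun_fubini_tonelli_F _ _ _ _ _ m2 (fun z => (f z.1 z.2)%:E)).
  exact: measurable_fun_EFin.
by move=> z; rewrite lee_fin.
Qed.

End iterated_integrals.

Lemma mule_EFin_inj {R : realType} (k : R) (a b : \bar R) : k != 0 ->
  (k%:E * a = k%:E * b -> a = b)%E.
Proof.
move=> k0 /(congr1 (mule (k^-1)%:E)).
by rewrite !muleA -EFinM mulVf// !mul1e.
Qed.

(** * The substitution t -> 1/t *)

Section inversion.
Local Open Scope ereal_scope.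
Context {R : realType}.
Local Notation leb := (@lebesgue_measure R).

Lemma integral_boolr_itv (a b : R) : (a <= b)%R ->
  \int[leb]_x ((a <= x) && (x <= b))%R%:R%:E = (b - a)%:E.
Proof.
move=> ab; transitivity (\int[leb]_(x in [set x : R | (a <= x) && (x <= b)]%R) 1%:E).
  rewrite (integral_boolr leb (fun x : R => (a <= x) && (x <= b))%R (fun=> 1%R)).
  by apply: eq_integral => x _; rewrite mulr1.
rewrite integral_cst//=; last first.
  exact: (measurable_itv `[a, b]).
rewrite mul1e (_ : [set x | _] = `[a, b]%classic); last first.
  by apply/seteqP; split => x /=; rewrite in_itv.
rewrite lebesgue_measure_itv/= lte_fin; case: ltP => // ba.
by rewrite (_ : (b - a)%R = 0%R)//; apply/eqP; rewrite subr_eq0 eq_le ba ab.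
Qed.

(* The Haar measure [dt/t] of the multiplicative group is invariant under inversion:
   both sides are [int phi(x) F(y/x) dx/x dy/y], up to the factor [int phi(x) dx/x]. *)
Lemma integral_inversion (F : R -> R) : measurable_fun setT F ->
  (forall t, 0 <= F t)%R ->
  \int[leb]_t ((0 < t)%R%:R * F t)%:E =
  \int[leb]_t ((0 < t)%R%:R * (F t^-1 * (t ^+ 2)^-1))%:E.
Proof.
move=> mF F0.
(* Any weight with 0 < [K] < +oo would serve; on [1, 2] the factor 1/x stays between 1/2 and 1. *)
pose phi (x : R) : R := ((1 <= x) && (x <= 2))%R%:R.
have mphi : measurable_fun setT phi by rewrite /phi; msr.
have phi0 x : (0 <= phi x)%R by rewrite /phi.
pose K := \int[leb]_x ((0 < x)%R%:R * (phi x * x^-1))%:E.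
pose G (x y : R) : R := ((0 < x)%R%:R * (0 < y)%R%:R * (phi x * F (y / x) * (x ^+ 2)^-1))%R.
have mG : measurable_fun setT (fun z : R * R => G z.1 z.2) by rewrite /G; msr.
have G0 x y : (0 <= G x y)%R.
  by rewrite /G !mulr_ge0// invr_ge0 sqr_ge0.
(* With x fixed, y = x t separates the variables and leaves [F] at t. *)
have e1 : \int[leb]_x \int[leb]_y (G x y)%:E =
    K * \int[leb]_t ((0 < t)%R%:R * F t)%:E.
  rewrite -ge0_integralZr_setT; last 3 first.
  - by msr.
  - by move=> x; rewrite lee_fin; case: (ltP 0%R x) => x0; rewrite ?mul0r// mul1r mulr_ge0// invr_ge0 ltW.
  - by apply: integral_ge0_real => x; rewrite mulr_ge0.
  apply: eq_integral => x _.
  have [x0|x0] := ltP 0%R x; last first.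
    rewrite mul0r mul0e; apply: integral0_eq => y _.
    by rewrite /G [(0 < x)%R]ltNge x0/= !mul0r.
  rewrite (@ge0_integral_scale _ _ x)//; last 2 first.
  - by rewrite /G; msr.
  - by move=> t; rewrite lee_fin.
  rewrite mul1r -!integralZl_real ?(ltW x0)//; last 4 first.
  - by rewrite mulr_ge0// invr_ge0 ltW.
  - by msr.
  - by move=> t; rewrite mulr_ge0.
  - by rewrite /G; msr.
  apply: eq_integral => t _; congr EFin.
  rewrite /G x0 pmulr_rgt0// -[in F _]mulrC mulKf ?gt_eqF// mul1r.
  by field; rewrite gt_eqF.
(* With y fixed, x = y t leaves [F] at 1/t; after the exchange, a dilation by t turns the integral
   in y back into [K]. *)
have e2 : \int[leb]_y \int[leb]_x (G x y)%:E =
    K * \int[leb]_t ((0 < t)%R%:R * (F t^-1 * (t ^+ 2)^-1))%:E.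
  transitivity (\int[leb]_y \int[leb]_t ((0 < y)%R%:R * (0 < t)%R%:R * (phi (y * t) * F t^-1 * (t ^+ 2)^-1 * y^-1))%:E).
    apply: eq_integral => y _.
    have [y0|y0] := ltP 0%R y; last first.
      transitivity (0 : \bar R); [|symmetry]; apply: integral0_eq => x _.
        by rewrite /G [(0 < y)%R]ltNge y0/= mulr0 !mul0r.
      by rewrite !mul0r.
    rewrite (@ge0_integral_scale _ _ y)//; last 2 first.
    - by rewrite /G; msr.
    - by move=> t; rewrite lee_fin.
    rewrite -!integralZl_real ?(ltW y0)//; last by rewrite /G; msr.
    apply: eq_integral => t _; congr EFin.
    rewrite /G y0 pmulr_rgt0// mul1r mulr1.
    have [t0|t0] := ltP 0%R t; last by rewrite !mul0r mulr0.
    have -> : (y / (y * t) = t^-1)%R by field; rewrite !gt_eqF.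
    by field; rewrite !gt_eqF.
  rewrite exchange_integral_real; last 2 first.
  - by msr.
  - move=> x y; case: (ltP 0%R x) => x0; last by rewrite !mul0r.
    by rewrite !mulr_ge0// ?invr_ge0 ?sqr_ge0// ltW.
  rewrite muleC -ge0_integralZr_setT; last 3 first.
  - by msr.
  - by move=> x; rewrite lee_fin !mulr_ge0// invr_ge0 sqr_ge0.
  - apply: integral_ge0_real => x; case: (ltP 0%R x) => x0; rewrite ?mul0r//.
    by rewrite !mulr_ge0// invr_ge0 ltW.
  apply: eq_integral => t _.
  have [t0|t0] := ltP 0%R t; last first.
    rewrite mul0r mul0e; apply: integral0_eq => y _.
    by rewrite mulr0 !mul0r.
  rewrite /K (@ge0_integral_scale _ _ t)//; last 2 first.
  - by msr.
  - move=> x; rewrite lee_fin; case: (ltP 0%R x) => x0; rewrite ?mul0r//.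
    by rewrite !mulr_ge0// invr_ge0 ltW.
  rewrite muleA -EFinM -integralZl_real; last 3 first.
  - by rewrite !mulr_ge0// ?invr_ge0 ?sqr_ge0// ltW.
  - by msr.
  - move=> x; rewrite pmulr_rgt0//; case: (ltP 0%R x) => x0; rewrite ?mul0r//.
    by rewrite !mulr_ge0// invr_ge0 mulr_ge0 ?ltW.
  apply: eq_integral => y _; congr EFin.
  rewrite pmulr_rgt0//; have [y0|y0] := ltP 0%R y; last by rewrite !mul0r mulr0.
  by rewrite [(t * y)%R]mulrC; field; rewrite !gt_eqF.
have E12 : \int[leb]_x (phi x)%:E = 1%:E.
  by rewrite integral_boolr_itv ?ler1n//; congr EFin; ring.
have phiE x : ((0 < x)%R%:R * (phi x / x) = phi x / x)%R.
  case: (ltP 0%R x) => x0; rewrite ?mul1r// mul0r /phi.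
  by rewrite leNgt (le_lt_trans x0)//= mul0r.
have phiV x : (phi x * 2^-1 <= phi x / x <= phi x)%R.
  rewrite /phi; case: (boolP ((1 <= x) && (x <= 2))%R) => [/andP[x1 x2]|_]; last by rewrite !mul0r lexx.
  have x0 : (0 < x)%R by lra.
  by rewrite !mul1r lef_pV2 ?posrE// invf_le1// x2 x1.
(* The common factor [K] can be cancelled only if it is nonzero and finite. *)
have K0 : 0 < K.
  apply: (@lt_le_trans _ _ (2^-1)%:E); first by rewrite lte_fin invr_gt0.
  rewrite -[leLHS]mule1 -E12 -integralZl_real//; apply: le_integral_real; try mpos.
  by move=> x; rewrite phiE mulrC; have /andP[] := phiV x.
have Koo : K < +oo.
  apply: (@le_lt_trans _ _ 1%:E); last exact: ltry.
  rewrite -E12; apply: le_integral_real => //.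
  - by msr.
  - by move=> x; rewrite phiE (le_trans _ (andP (phiV x)).1)// mulr_ge0.
  - by move=> x; rewrite phiE; have /andP[] := phiV x.
have Kfin : K \is a fin_num by rewrite ge0_fin_numE// ltW.
have := exchange_integral_real leb leb mG G0.
rewrite e1 e2 -(fineK Kfin); apply: mule_EFin_inj.
by rewrite gt_eqF// fine_gt0// K0.
Qed.

End inversion.

(** * Integrals of powers near infinity and near 0 *)

Section power_integrals.
Context {R : realType}.
Local Notation leb := (@lebesgue_measure R).

Lemma derivable_powR_gt0 (a x : R) : 0 < x -> derivable (fun t : R => t `^ a) x 1.
Proof. by move=> x0; apply: derivable_powR; rewrite in_itv/= x0. Qed.

Lemma is_derive_powR (a x : R) : 0 < x ->
  is_derive x 1 (fun t : R => t `^ a) (a * x `^ (a - 1)).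
Proof.
move=> x0; apply: DeriveDef; first exact: derivable_powR_gt0.
by rewrite -derive1E powR_derive1// in_itv/= x0.
Qed.

Lemma continuous_powR_gt0 (a x : R) : 0 < x -> {for x, continuous (fun t : R => t `^ a)}.
Proof.
by move=> x0; apply/differentiable_continuous/derivable1_diffP/derivable_powR_gt0.
Qed.

Lemma powRN_cvg_pinfty (q : R) : 0 < q -> (x `^ (- q) @[x --> +oo]) --> (0 : R).
Proof.
move=> q0; apply/cvgrPdist_lt => /= e e0; near=> x.
have x0 : 0 < x by near: x; exact: nbhs_pinfty_gt.
rewrite sub0r normrN ger0_norm ?powR_ge0//.
have ex : e `^ (- q^-1) < x by near: x; exact: nbhs_pinfty_gt.
have : (e `^ (- q^-1)) `^ q < x `^ q.
  by apply: gt0_ltr_powR; rewrite ?nnegrE ?powR_ge0// ltW.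
rewrite -powRrM mulNr mulVf ?gt_eqF// powR_inv1 ?ltW// powRN => h.
by rewrite -(invrK e) ltf_pV2 ?posrE// ?invr_gt0// powR_gt0.
Unshelve. all: by end_near. Qed.

Lemma integral_powR_pinfty (q : R) : 0 < q ->
  (\int[leb]_t ((1 <= t)%R%:R * t `^ (- q - 1))%:E = (q^-1)%:E)%E.
Proof.
move=> q0.
rewrite -(integral_boolr leb (fun t : R => 1 <= t) (fun t : R => t `^ (- q - 1))).
rewrite (_ : [set x : R | 1 <= x] = `[1, +oo[%classic); last first.
  by apply/seteqP; split => x /=; rewrite in_itv/= andbT.
have gt1 (x : R) : 1 <= x -> 0 < x by exact: lt_le_trans.
rewrite (@ge0_continuous_FTC2y _ _ (fun t => - q^-1 * t `^ (- q)) 1 0).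
- by rewrite powR1 -EFinB; congr EFin; ring.
- by move=> x x1; exact: powR_ge0.
- apply: continuous_in_subspaceT => x; rewrite inE/= in_itv/= andbT => x1.
  exact/continuous_powR_gt0/gt1.
- rewrite -[X in _ --> X](mulr0 (- q^-1)).
  by apply: cvgM; [exact: cvg_cst|exact: powRN_cvg_pinfty].
- move=> x x1; apply: derivableM => //; apply: derivable_powR_gt0.
  exact: lt_trans x1.
- apply: cvg_at_right_filter; apply: cvgM; first exact: cvg_cst.
  exact: continuous_powR_gt0.
- move=> x; rewrite in_itv/= andbT => x1; rewrite derive1E.
  have x0 := gt1 _ (ltW x1).
  have := is_derive_powR (- q) x0 => ?.
  rewrite deriveZ//= derive_val; rewrite /GRing.scale/=; field.
  by rewrite gt_eqF.
Qed.

(** The integrand may be unbounded at 0; inversion moves the singular end to infinity, where the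
    previous integral applies. *)
Lemma integral_powR_unit (q : R) : 0 < q ->
  (\int[leb]_t (((0 < t) && (t <= 1))%R%:R * t `^ (q - 1))%:E = (q^-1)%:E)%E.
Proof.
move=> q0; rewrite -(integral_powR_pinfty q0).
transitivity (\int[leb]_t ((0 < t)%R%:R * ((t <= 1)%R%:R * t `^ (q - 1)))%:E)%E.
  by apply: eq_integral => t _; rewrite mulrA -natrM mulnb.
rewrite integral_inversion; last 2 first.
- by msr.
- by move=> t; rewrite mulr_ge0// powR_ge0.
apply: eq_integral => t _; congr EFin.
have [t0|t0] := ltP 0 t; last by rewrite mul0r leNgt (le_lt_trans t0)// mul0r.
rewrite mul1r invf_cp1//; case: leP => // _; rewrite ?mul0r// !mul1r.
rewrite -powR_inv1 ?ltW// -powRrM -powR_mulrn ?ltW// -powRN -powRD//.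
  by congr (_ `^ _); ring.
by rewrite (gt_eqF t0) implybT.
Qed.

End power_integrals.

(** * The Gamma function and the kernel on the line *)

Section gamma_function.
Context {R : realType}.
Local Notation leb := (@lebesgue_measure R).

(** This is x <= e^x at x = t / m, raised to the power m and inverted. *)
Lemma expRN_le_powR (m t : R) : 0 < m -> 0 < t ->
  expR (- t) <= m `^ m * t `^ (- m).
Proof.
move=> m0 t0.
have h : t / m <= expR (t / m).
  by apply: le_trans (expR_ge1Dx _); rewrite lerDr.
have : (t / m) `^ m <= expR (t / m) `^ m.
  by apply: ge0_ler_powR; rewrite ?nnegrE ?expR_ge0// ?divr_ge0// ltW.
rewrite -expRM divfK ?gt_eqF// powRM ?invr_ge0 ?(ltW t0) ?(ltW m0)// => h2.
rewrite expRN powRN.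
rewrite -[leRHS]invrK lef_pV2 ?posrE ?expR_gt0 ?invr_gt0 ?divr_gt0 ?powR_gt0//.
apply: le_trans h2; rewrite -(powR_inv1 (ltW m0)) -powRrM mulN1r powRN invfM invrK.
by rewrite mulrC.
Qed.

Let gamma_integrand (a t : R) := (0 < t)%R%:R * (t `^ (a - 1) * expR (- t)).

Lemma integral_gamma_lty (a : R) : 0 < a ->
  (\int[leb]_t (gamma_integrand a t)%:E < +oo)%E.
Proof.
move=> a0; have a1 : 0 < a + 1 by rewrite addr_gt0.
(* Bounding the exponential with exponent a + 1 leaves t^(-2) after multiplication by t^(a-1). *)
pose C : R := (a + 1) `^ (a + 1).
apply: (@le_lt_trans _ _ (\int[leb]_t (((0 < t) && (t <= 1))%R%:R * t `^ (a - 1)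
   + C * ((1 <= t)%R%:R * t `^ (- 1 - 1)))%:E)%E).
  apply: le_integral_real; try mpos.
  - by rewrite /gamma_integrand; msr.
  - by move=> t; rewrite /gamma_integrand !mulr_ge0// ?powR_ge0 ?expR_ge0.
  - move=> t; rewrite /gamma_integrand.
    have C0 : 0 <= C by exact: powR_ge0.
    case: (ltP 0 t) => t0; last by rewrite !mul0r add0r !mulr_ge0// powR_ge0.
    have := powR_ge0 t (-1 - 1); have := powR_ge0 t (a - 1).
    have [t1|t1] := leP t 1 => h1 h2.
      rewrite /= !mul1r; apply: ler_wpDr; first by rewrite !mulr_ge0.
      by rewrite ler_piMr// expR_le1 oppr_le0 ltW.
    rewrite /= (ltW t1) mul0r add0r !mul1r.
    apply: (@le_trans _ _ (t `^ (a - 1) * (C * t `^ (- (a + 1))))).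
      by rewrite ler_wpM2l// expRN_le_powR.
    rewrite mulrCA -powRD; last by rewrite (gt_eqF t0) implybT.
    by rewrite (_ : a - 1 + - (a + 1) = -1 - 1)//; ring.
rewrite integralD_real; last 4 first.
- by msr.
- by msr.
- by move=> t; rewrite mulr_ge0// powR_ge0.
- by move=> t; rewrite !mulr_ge0// powR_ge0.
rewrite integral_powR_unit// integralZl_real; last 3 first.
- exact: powR_ge0.
- by msr.
- by move=> t; rewrite mulr_ge0// powR_ge0.
by rewrite integral_powR_pinfty// -EFinM -EFinD ltry.
Qed.

Lemma EFin_Gamma (a : R) : 0 < a ->
  ((Gamma a)%:E = \int[leb]_t (gamma_integrand a t)%:E)%E.
Proof.
move=> a0; rewrite /Gamma /Rintegral.
rewrite (_ : `]0, +oo[%classic = [set x : R | 0 < x]); last first.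
  by apply/seteqP; split => x /=; rewrite in_itv/= andbT.
rewrite (integral_boolr leb (fun x : R => 0 < x) (fun t => t `^ (a - 1) * expR (- t))).
rewrite fineK// ge0_fin_numE; first exact: integral_gamma_lty.
by apply: integral_ge0_real => t; rewrite !mulr_ge0// ?powR_ge0 ?expR_ge0.
Qed.

Lemma Gamma_gt0 (a : R) : 0 < a -> 0 < Gamma a.
Proof.
move=> a0; rewrite -lte_fin EFin_Gamma//.
(* On [1, 2] the power is monotone, in a direction given by the sign of a - 1, so its smaller end
   value is a lower bound. *)
pose c : R := Num.min (1 `^ (a - 1)) (2 `^ (a - 1)) * expR (- 2).
have c0 : 0 < c by rewrite mulr_gt0 ?expR_gt0// lt_min !powR_gt0.
apply: (@lt_le_trans _ _ (c * (2 - 1))%:E).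
  by rewrite lte_fin mulr_gt0// subr_gt0 ltr1n.
rewrite EFinM -integral_boolr_itv ?ler1n// -integralZl_real ?(ltW c0)//; last by msr.
apply: le_integral_real; try mpos.
- by rewrite /gamma_integrand; msr.
- move=> t; rewrite /gamma_integrand.
  case: (boolP ((1 <= t) && (t <= 2))) => [/andP[t1 t2]|_]; last first.
    by rewrite mulr0 !mulr_ge0// ?powR_ge0 ?expR_ge0.
  have t0 : 0 < t by rewrite (lt_le_trans _ t1).
  rewrite t0 mulr1 mul1r /c; apply: ler_pM.
  + by rewrite le_min !powR_ge0.
  + exact: expR_ge0.
  + have [a1|a1] := leP 0 (a - 1).
      rewrite ge_min ge0_ler_powR// nnegrE// ltW//.
    rewrite ge_min -(opprK (a - 1)) ![_ `^ (- - _)]powRN !lef_pV2 ?posrE ?powR_gt0//.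
    by rewrite orbC ge0_ler_powR ?nnegrE ?oppr_ge0 ?(ltW a1) ?(ltW t0).
  + by rewrite ler_expR lerN2.
Qed.

Lemma integral_gauss_scale (c : R) : 0 < c ->
  (\int[leb]_t (expR (- (c * t ^+ 2)))%:E = (Num.sqrt pi * c `^ (- 2^-1))%:E)%E.
Proof.
move=> c0; pose k := Num.sqrt c.
have k0 : 0 < k by rewrite sqrtr_gt0.
have := @integralT_gauss R.
rewrite (@ge0_integral_scale _ _ k)//; last 2 first.
- by rewrite /gauss_fun; msr.
- by move=> t; rewrite lee_fin expR_ge0.
move=> h; apply: (@mule_EFin_inj _ k); first by rewrite gt_eqF.
have -> : c `^ (- 2^-1) = k^-1 by rewrite powRN powR12_sqrt// ltW.
rewrite -EFinM mulrCA divff ?gt_eqF// mulr1; rewrite -h; congr (_ * _)%E.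
apply: eq_integral => t _; congr EFin; rewrite /gauss_fun exprMn sqr_sqrtr ?ltW//.
Qed.

(** Read from right to left, it writes the power A^(-b) as a superposition of exponentials, which
    turns powers of a squared distance into Gaussians. *)
Lemma integral_gamma_scale (b A : R) : 0 < b -> 0 < A ->
  (\int[leb]_t ((0 < t)%R%:R * (t `^ (b - 1) * expR (- (A * t))))%:E
   = (Gamma b * A `^ (- b))%:E)%E.
Proof.
move=> b0 A0; apply: (@mule_EFin_inj _ (A `^ b)); first by rewrite gt_eqF// powR_gt0.
rewrite -[RHS]EFinM powRN mulrCA divff ?mulr1 ?gt_eqF ?powR_gt0//.
rewrite EFin_Gamma//.
rewrite (@ge0_integral_scale _ (fun t => (gamma_integrand b t)%:E) A A0); last 2 first.
- by rewrite /gamma_integrand; msr.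
- by move=> t; rewrite lee_fin !mulr_ge0// ?powR_ge0 ?expR_ge0.
rewrite -(integralZl_real leb (powR_ge0 A b)); last 2 first.
- by msr.
- by move=> t; rewrite !mulr_ge0// ?powR_ge0 ?expR_ge0.
rewrite -(integralZl_real leb (ltW A0)); last 2 first.
- by rewrite /gamma_integrand; msr.
- by move=> t; rewrite !mulr_ge0// ?powR_ge0 ?expR_ge0.
apply: eq_integral => t _; congr EFin; rewrite /gamma_integrand pmulr_rgt0//.
have [t0|t0] := ltP 0 t; last by rewrite !mul0r !mulr0.
rewrite !mul1r powRM ?ltW// !mulrA; congr (_ * _ * _).
by rewrite mulr_powRB1// ltW.
Qed.

(** With the power written as a Gamma integral over s, Tonelli makes the integral in t Gaussian; its
    value, of order s^(-1/2), lowers the exponent b to b - 1/2. *)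
Lemma integral_line_kernel (a A b : R) : 2^-1 < b -> 0 < A ->
  (\int[leb]_t (((t - a) ^+ 2 + A) `^ (- b))%:E =
  (Num.sqrt pi * (Gamma (b - 2^-1) / Gamma b) * A `^ (2^-1 - b))%:E)%E.
Proof.
move=> b2 A0; have b0 : 0 < b by rewrite (lt_trans _ b2).
have b20 : 0 < b - 2^-1 by rewrite subr_gt0.
have Gb := Gamma_gt0 b0.
rewrite (@ge0_integral_shift R (fun t => ((t ^+ 2 + A) `^ (- b))%:E) (- a)); last 2 first.
- by msr.
- by move=> t; rewrite lee_fin powR_ge0.
apply: (@mule_EFin_inj _ (Gamma b)); first by rewrite gt_eqF.
rewrite -integralZl_real ?(ltW Gb)//; last 2 first.
- by msr.
- by move=> t; exact: powR_ge0.
pose F (t s : R) := (0 < s)%R%:R * (s `^ (b - 1) * expR (- ((t ^+ 2 + A) * s))).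
have mF : measurable_fun setT (fun z : R * R => F z.1 z.2) by rewrite /F; msr.
have F0 t s : 0 <= F t s by rewrite !mulr_ge0// ?powR_ge0 ?expR_ge0.
transitivity (\int[leb]_t \int[leb]_s (F t s)%:E)%E.
  apply: eq_integral => t _; rewrite integral_gamma_scale//.
  by rewrite ltr_wpDl// sqr_ge0.
rewrite exchange_integral_real//.
transitivity (\int[leb]_s (Num.sqrt pi * ((0 < s)%R%:R * (s `^ ((b - 2^-1) - 1) * expR (- (A * s)))))%:E)%E.
  apply: eq_integral => s _.
  have [s0|s0] := ltP 0 s; last first.
    by rewrite mul0r mulr0; apply: integral0_eq => t _; rewrite /F ltNge s0 mul0r.
  transitivity (\int[leb]_t ((s `^ (b - 1) * expR (- (A * s))) * expR (- (s * t ^+ 2)))%:E)%E.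
    apply: eq_integral => t _; congr EFin; rewrite /F s0 mul1r -mulrA -expRD.
    by congr (_ * expR _); ring.
  rewrite integralZl_real; last 3 first.
  - by rewrite mulr_ge0 ?powR_ge0 ?expR_ge0.
  - by msr.
  - by move=> t; exact: expR_ge0.
  rewrite integral_gauss_scale// -EFinM; congr EFin.
  rewrite (_ : b - 2^-1 - 1 = (b - 1) + (- 2^-1)); last by ring.
  rewrite (@powRD _ _ (b - 1)); last by rewrite (gt_eqF s0) implybT.
  by rewrite mul1r; ring.
rewrite integralZl_real ?sqrtr_ge0//; last 2 first.
- by msr.
- by move=> s; rewrite !mulr_ge0// ?powR_ge0 ?expR_ge0.
rewrite integral_gamma_scale// -!EFinM; congr EFin.
rewrite opprB; move: Gb => /lt0r_neq0.
by move: (Gamma b) (Gamma _) (A `^ _) (Num.sqrt pi) => g h y z g0; field.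
Qed.

End gamma_function.

(** * Integration on row vectors through the last coordinate *)

Section rV_integrals.
Context {R : realType}.
Local Notation leb := (@lebesgue_measure R).
Local Notation rvl := (rV_lebesgue R).

Lemma rV_rcons_max n (z : 'rV[R]_n * R) : rV_rcons z ord0 ord_max = z.2.
Proof. by rewrite mxE unlift_none. Qed.

Lemma rV_rcons_widen n (z : 'rV[R]_n * R) (j : 'I_n) :
  rV_rcons z ord0 (widen_ord (leqnSn n) j) = z.1 ord0 j.
Proof.
rewrite (_ : widen_ord _ _ = lift ord_max j); first by rewrite mxE liftK.
by apply/val_inj; rewrite /= /bump leqNgt ltn_ord.
Qed.

Lemma measurable_fun_rcons n (d : measure_display) (T : measurableType d)
    (f : T -> 'rV[R]_n) (g : T -> R) :
  measurable_fun setT f -> measurable_fun setT g ->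
  measurable_fun setT (fun x => rV_rcons (f x, g x)).
Proof.
move=> mf mg; apply: measurable_fun_rV => i.
case: (unliftP ord_max i) => [j|] ->.
  rewrite (_ : (fun _ => _) = (fun x => f x ord0 j)); first by msr.
  by apply/funext => z /=; rewrite mxE liftK.
by under eq_fun do rewrite rV_rcons_max.
Qed.

Lemma integral_rV0 (f : 'rV[R]_0 -> \bar R) : measurable_fun setT f ->
  (\int[rvl 0]_x f x = f 0%R)%E.
Proof. by move=> mf; rewrite integral_dirac// diracT mul1e. Qed.

Lemma integral_rcons n (f : 'rV[R]_n.+1 -> \bar R) : measurable_fun setT f ->
  (forall x, 0 <= f x)%E ->
  (\int[rvl n.+1]_x f x = \int[rvl n]_x \int[leb]_t f (rV_rcons (x, t)))%E.
Proof.
move=> mf f0.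
have mr : measurable_fun setT
    (fun z : 'rV[R]_n * measurableTypeR R => rV_rcons z : 'rV[R]_n.+1).
  apply: (eq_measurable_fun (fun z : 'rV[R]_n * measurableTypeR R => rV_rcons (z.1, z.2))).
    by case.
  by apply: measurable_fun_rcons; msr.
transitivity (\int[rvl n \x leb]_z f (rV_rcons z))%E.
  exact: (ge0_integral_pushforward mr (rvl n \x leb)%E measurableT mf (fun y _ => f0 y)).
rewrite (@fubini_tonelli1 _ _ _ _ _ (rvl n) leb (fun z => f (rV_rcons z)))//.
exact: (measurable_fun_comp mf mr).
Qed.

Lemma integral_rcons_swap n (f : 'rV[R]_n.+1 -> R) : measurable_fun setT f ->
  (forall x, 0 <= f x) ->
  (\int[rvl n.+1]_x (f x)%:E = \int[leb]_t \int[rvl n]_x (f (rV_rcons (x, t)))%:E)%E.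
Proof.
move=> mf f0; rewrite (integral_rcons (f := fun x => (f x)%:E)); last 2 first.
- exact: measurable_fun_EFin.
- by move=> x; rewrite lee_fin.
apply: (exchange_integral_real (rvl n) leb (f := fun x t => f (rV_rcons (x, t)))).
  apply: (measurable_fun_comp mf); apply: measurable_fun_rcons; msr.
by move=> x t; exact: f0.
Qed.

End rV_integrals.

Ltac msr2 := repeat (first [progress msr
  | match goal with |- measurable_fun _ (fun x => rV_rcons (_, _)) =>
      apply: measurable_fun_rcons end]).

(** * Integrals of the kernel over hyperplanes *)

Section kernel_integrals.
Context {R : realType}.
Local Notation leb := (@lebesgue_measure R).
Local Notation rvl := (rV_lebesgue R).

(** Being additive over coordinates, the squared distance allows powers of it to be integrated one
    coordinate at a time, without the square root of [eucl_norm]. *)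
Definition sqdist n (x y : 'rV[R]_n) : R := \sum_i (x ord0 i - y ord0 i) ^+ 2.

Lemma sqdist_ge0 n (x y : 'rV[R]_n) : 0 <= sqdist x y.
Proof. by apply: sumr_ge0 => i _; exact: sqr_ge0. Qed.

Lemma sqdistC n (x y : 'rV[R]_n) : sqdist x y = sqdist y x.
Proof. by apply: eq_bigr => i _; rewrite -sqrrN opprB. Qed.

Lemma sqdist_rcons n (x : 'rV[R]_n) (t : R) (y : 'rV[R]_n.+1) :
  sqdist (rV_rcons (x, t)) y =
  sqdist x (\row_j y ord0 (widen_ord (leqnSn n) j)) + (t - y ord0 ord_max) ^+ 2.
Proof.
rewrite /sqdist big_ord_recr/= rV_rcons_max; congr (_ + _).
by apply: eq_bigr => i _; rewrite rV_rcons_widen mxE.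
Qed.

(* For b > n/2, the constant in
   [int_(R^n) (|x|^2 + A)^(-b) dx = space_kernel_const n b * A^(n/2 - b)]. *)
Definition space_kernel_const (n : nat) (b : R) : R :=
  pi `^ (n%:R / 2) * (Gamma (b - n%:R / 2) / Gamma b).

Lemma space_kernel_const_gt0 n b : n%:R / 2 < b -> 0 < space_kernel_const n b.
Proof.
move=> nb; have b0 : 0 < b by rewrite (le_lt_trans _ nb)// divr_ge0.
by rewrite mulr_gt0// ?powR_gt0 ?pi_gt0// divr_gt0// Gamma_gt0// subr_gt0.
Qed.

(** The factors Gamma(b - 1/2) cancel, so iterating the line integral telescopes to a closed
    form. *)
Lemma space_kernel_constS n (b : R) : n.+1%:R / 2 < b ->
  space_kernel_const n.+1 b =
  Num.sqrt pi * (Gamma (b - 2^-1) / Gamma b) * space_kernel_const n (b - 2^-1).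
Proof.
move=> nb; rewrite /space_kernel_const -powR12_sqrt ?pi_ge0//.
rewrite (_ : b - 2^-1 - n%:R / 2 = b - n.+1%:R / 2); last first.
  by rewrite -[n.+1%:R]natr1; field.
rewrite (_ : n.+1%:R / 2 = 2^-1 + n%:R / 2 :> R); last first.
  by rewrite -[n.+1%:R]natr1; field.
rewrite powRD; last by rewrite (gt_eqF (pi_gt0 _)) implybT.
have : Gamma (b - 2^-1) != 0.
  rewrite gt_eqF// Gamma_gt0// subr_gt0 (le_lt_trans _ nb)//.
  by rewrite -[n.+1%:R]natr1 mulrDl mul1r lerDr divr_ge0.
have : Gamma b != 0.
  by rewrite gt_eqF// Gamma_gt0// (le_lt_trans _ nb)// divr_ge0.
move: (Gamma b) (Gamma _) (Gamma _) (pi `^ _) (pi `^ _) => g h k u v g0 h0; field.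
by rewrite g0 h0.
Qed.

(** Induction on the dimension: while the last coordinate is integrated, the squared distance in the
    others plus [A] takes the place of [A] in the line integral. *)
Lemma integral_space_kernel n (y : 'rV[R]_n) (A b : R) : n%:R / 2 < b -> 0 < A ->
  (\int[rvl n]_x ((sqdist x y + A) `^ (- b))%:E =
   (space_kernel_const n b * A `^ (n%:R / 2 - b))%:E)%E.
Proof.
elim: n y A b => [|n ih] y A b nb A0.
  have b0 : 0 < b by rewrite (le_lt_trans _ nb)// divr_ge0.
  rewrite (@integral_rV0 _ (fun x => ((sqdist x y + A) `^ (- b))%:E)); last first.
    by rewrite /sqdist; msr.
  rewrite /sqdist big_ord0 add0r /space_kernel_const mul0r subr0 powRr0 mul1r.
  by rewrite divff ?gt_eqF ?Gamma_gt0// mul1r sub0r.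
have n2 : (n.+1%:R / 2 = n%:R / 2 + 2^-1 :> R) by rewrite -[n.+1%:R]natr1; field.
have b12 : 2^-1 < b by rewrite (le_lt_trans _ nb)// n2 lerDr divr_ge0.
have b0 : 0 < b by rewrite (lt_trans _ b12).
have b120 : 0 < b - 2^-1 by rewrite subr_gt0.
pose y' := \row_j y ord0 (widen_ord (leqnSn n) j).
pose C := Num.sqrt pi * (Gamma (b - 2^-1) / Gamma b).
have C0 : 0 <= C by rewrite mulr_ge0 ?sqrtr_ge0// ltW// divr_gt0// Gamma_gt0.
rewrite (@integral_rcons _ _ (fun x => ((sqdist x y + A) `^ (- b))%:E)); last 2 first.
- by rewrite /sqdist; msr.
- by move=> x; rewrite lee_fin powR_ge0.
transitivity (\int[rvl n]_x (C * (sqdist x y' + A) `^ (- (b - 2^-1)))%:E)%E.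
  apply: eq_integral => x _.
  have sA : 0 < sqdist x y' + A by rewrite ltr_wpDl// sqdist_ge0.
  rewrite opprB -(integral_line_kernel (y ord0 ord_max) b12 sA).
  by apply: eq_integral => t _; congr (_ `^ _)%:E; rewrite sqdist_rcons; ring.
rewrite integralZl_real//; last 2 first.
- by rewrite /sqdist; msr.
- by move=> x; exact: powR_ge0.
rewrite ih//; last by rewrite ltrBrDr -n2.
rewrite -EFinM space_kernel_constS// -/C mulrA; congr (_ * _ `^ _)%:E.
by rewrite n2; ring.
Qed.

(* When [phi] vanishes at the last coordinate of [y], no null set has to be
   removed: both sides vanish there with the convention [0 `^ (- b) = 0]. *)
Lemma integral_last_coord n (phi : R -> R) (y : 'rV[R]_n.+1) (b : R) :
  n%:R / 2 < b -> measurable_fun setT phi -> (forall t, 0 <= phi t) ->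
  phi (y ord0 ord_max) = 0 ->
  (\int[rvl n.+1]_x (phi (x ord0 ord_max) * sqdist x y `^ (- b))%:E =
   (space_kernel_const n b)%:E *
   \int[leb]_t (phi t * `|t - y ord0 ord_max| `^ (n%:R - 2 * b))%:E)%E.
Proof.
move=> nb mphi phi0 phiy; have C0 := space_kernel_const_gt0 nb.
rewrite integral_rcons_swap; last 2 first.
- by rewrite /sqdist; msr.
- by move=> x; rewrite mulr_ge0 ?powR_ge0.
rewrite -integralZl_real ?(ltW C0)//; last 2 first.
- by msr.
- by move=> x; rewrite mulr_ge0 ?powR_ge0.
apply: eq_integral => t _.
have [->|ty] := eqVneq t (y ord0 ord_max).
  rewrite phiy mul0r mulr0; apply: integral0_eq => x _.
  by rewrite rV_rcons_max phiy mul0r.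
have ty0 : 0 < (t - y ord0 ord_max) ^+ 2 by rewrite exprn_even_gt0//= subr_eq0.
under eq_integral do rewrite rV_rcons_max sqdist_rcons/=.
rewrite integralZl_real//; last 2 first.
- by rewrite /sqdist; msr.
- by move=> x; exact: powR_ge0.
rewrite integral_space_kernel// -EFinM; congr EFin; rewrite mulrCA; congr (_ * (_ * _)).
rewrite -real_normK ?num_real// -powR_mulrn// -powRrM; congr (_ `^ _); by field.
Qed.

(** Serves the cutoffs parallel to the boundary, where only the power of |t| matters and the
    constant may stay anonymous. Coordinates after i are integrated out until i is the last one. *)
Lemma integral_any_coord n (i : 'I_n.+1) (b : R) : n.+1%:R / 2 < b ->
  exists2 C : R, 0 <= C & forall (G : R -> R) (y : 'rV[R]_n.+1),
    measurable_fun setT G -> (forall t, 0 <= G t) -> G 0 = 0 ->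
    (\int[rvl n.+1]_x (G (x ord0 i - y ord0 i) * sqdist x y `^ (- b))%:E =
     C%:E * \int[leb]_t (G t * `|t| `^ (n%:R - 2 * b))%:E)%E.
Proof.
have last m c : m.+1%:R / 2 < c -> exists2 C : R, 0 <= C &
    forall (G : R -> R) (y : 'rV[R]_m.+1),
    measurable_fun setT G -> (forall t, 0 <= G t) -> G 0 = 0 ->
    (\int[rvl m.+1]_x (G (x ord0 ord_max - y ord0 ord_max) * sqdist x y `^ (- c))%:E =
     C%:E * \int[leb]_t (G t * `|t| `^ (m%:R - 2 * c))%:E)%E.
  move=> mc; have mc' : m%:R / 2 < c by rewrite (le_lt_trans _ mc)// ler_pM2r// ler_nat.
  exists (space_kernel_const m c); first by rewrite ltW// space_kernel_const_gt0.
  move=> G y mG G0 G00.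
  rewrite (@integral_last_coord _ (fun t => G (t - y ord0 ord_max)) y c mc'); last 3 first.
  - by msr.
  - by move=> t; exact: G0.
  - by rewrite subrr.
  apply: (congr1 (mule _)).
  apply: (@ge0_integral_shift _ (fun t => (G t * `|t| `^ (m%:R - 2 * c))%:E)
    (- y ord0 ord_max)).
  - by msr.
  - by move=> t; rewrite lee_fin mulr_ge0// powR_ge0.
elim: n i b => [|n ih] i b nb; case: (unliftP ord_max i) => [j|] ->; last exact: last.
- by case: j.
- exact: last.
have n2 : (n.+2%:R / 2 = n.+1%:R / 2 + 2^-1 :> R) by rewrite -[n.+2%:R]natr1; field.
have b12 : 2^-1 < b by rewrite (le_lt_trans _ nb)// n2 lerDr divr_ge0.
have nb' : n.+1%:R / 2 < b - 2^-1 by rewrite ltrBrDr -n2.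
have [C C0 hC] := ih j _ nb'.
pose D := Num.sqrt pi * (Gamma (b - 2^-1) / Gamma b).
have D0 : 0 <= D.
  rewrite mulr_ge0 ?sqrtr_ge0// ltW// divr_gt0// Gamma_gt0// ?subr_gt0//.
  exact: lt_trans b12.
exists (D * C); first exact: mulr_ge0.
move=> G y mG G0 G00.
have lj : lift ord_max j = widen_ord (leqnSn n.+1) j.
  by apply/val_inj; rewrite /= /bump leqNgt ltn_ord.
rewrite lj.
pose y' : 'rV[R]_n.+1 := \row_j y ord0 (widen_ord (leqnSn n.+1) j).
rewrite (@integral_rcons _ _ (fun x => (G (x ord0 (widen_ord (leqnSn n.+1) j) -
  y ord0 (widen_ord (leqnSn n.+1) j)) * sqdist x y `^ (- b))%:E)); last 2 first.
- by rewrite /sqdist; msr.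
- by move=> x; rewrite lee_fin mulr_ge0 ?powR_ge0.
transitivity (\int[rvl n.+1]_x (D * (G (x ord0 j - y' ord0 j) * sqdist x y' `^ (- (b - 2^-1))))%:E)%E.
  apply: eq_integral => x _.
  have yj : y' ord0 j = y ord0 (widen_ord (leqnSn n.+1) j) by rewrite mxE.
  under eq_integral do rewrite rV_rcons_widen/= sqdist_rcons -/y' -yj.
  rewrite integralZl_real//; last 2 first.
  - by msr.
  - by move=> t; exact: powR_ge0.
  (* If the remaining squared distance is 0 the line integral does not apply, but then the
     coordinates at j agree and [G] 0 = 0 annihilates the integrand. *)
  have := sqdist_ge0 x y'; rewrite le_eqVlt => /orP[/eqP h|h].
    have -> : x ord0 j - y' ord0 j = 0.
      move/eqP: (esym h); rewrite psumr_eq0; last by move=> k _; exact: sqr_ge0.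
      by move=> /allP/(_ j); rewrite mem_index_enum => /(_ isT)/=; rewrite sqrf_eq0 => /eqP.
    by rewrite G00 !mul0r mul0e mulr0.
  under eq_integral do rewrite addrC.
  rewrite integral_line_kernel// -/D opprB -EFinM; congr EFin; rewrite mulrCA//.
rewrite integralZl_real//; last 2 first.
- by rewrite /sqdist; msr.
- by move=> x; rewrite mulr_ge0// powR_ge0.
rewrite hC// muleA -EFinM; congr (_ * _)%E.
apply: eq_integral => t _; congr (_ * _ `^ _)%:E.
by rewrite -[n.+1%:R]natr1; field.
Qed.

Lemma integral_prod_coord n (phi : R -> R) (I : R) : measurable_fun setT phi ->
  (forall t, 0 <= phi t) -> (\int[leb]_t (phi t)%:E = I%:E)%E ->
  (\int[rvl n]_x (\prod_i phi (x ord0 i))%:E = (I ^+ n)%:E)%E.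
Proof.
move=> mphi phi0 hI.
have I0 : 0 <= I by rewrite -lee_fin -hI; exact: integral_ge0_real.
elim: n => [|n ih].
  rewrite (@integral_rV0 _ (fun x => (\prod_i phi (x ord0 i))%:E)); last by msr.
  by rewrite big_ord0.
rewrite (@integral_rcons _ _ (fun x => (\prod_i phi (x ord0 i))%:E)); last 2 first.
- by msr.
- by move=> x; rewrite lee_fin prodr_ge0.
transitivity (\int[rvl n]_x (I * \prod_i phi (x ord0 i))%:E)%E.
  apply: eq_integral => x _.
  have e t : \prod_(i < n.+1) phi (rV_rcons (x, t) ord0 i) = \prod_i phi (x ord0 i) * phi t.
    rewrite big_ord_recr/= rV_rcons_max; congr (_ * _).
    by apply: eq_bigr => i _; rewrite rV_rcons_widen.
  under eq_integral do rewrite e.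
  rewrite integralZl_real//; last by rewrite prodr_ge0.
  by rewrite hI -EFinM mulrC.
rewrite integralZl_real//; last 2 first.
- by msr.
- by move=> x; rewrite prodr_ge0.
by rewrite ih -EFinM exprS.
Qed.

End kernel_integrals.

(** * Limits of truncated integrals *)

Section monotone_indicators.
Context {R : realType} {d : measure_display} {T : measurableType d}.
Variable mu : {measure set T -> \bar R}.

(** Monotone convergence; at each point the integrands are eventually constant. *)
Lemma cvg_integral_boolr (b : nat -> T -> bool) (c : T -> bool) (f : T -> R) :
  (forall m, measurable_fun setT (b m)) -> measurable_fun setT f ->
  (forall x, 0 <= f x) ->
  (forall x m k, (m <= k)%N -> b m x -> b k x) ->
  (forall x, c x <-> exists m, b m x) ->
  (\int[mu]_x ((b m x)%:R * f x)%:E @[m --> \oo] --> \int[mu]_x ((c x)%:R * f x)%:E)%E.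
Proof.
move=> mb mf f0 homb cb.
have := @cvg_monotone_convergence _ _ _ mu setT measurableT
  (fun m x => ((b m x)%:R * f x)%:E) _ _ _.
rewrite (_ : (\int[mu]_x _)%E = (\int[mu]_x ((c x)%:R * f x)%:E)%E); first apply.
- by move=> m; have := mb m => mbm; msr.
- by move=> m x _; rewrite lee_fin mulr_ge0.
- move=> x _ m k mk; rewrite lee_fin ler_wpM2r// ler_nat.
  by case: (b m x) (homb x m k mk) => // ->.
- apply: eq_integral => x _; apply/cvg_lim => //.
  have [cx|cx] := boolP (c x).
    have [m bm] := (cb x).1 cx.
    apply: cvg_near_cst; near=> k.
    rewrite (homb x m k)//; near: k; exact: nbhs_infty_ge.
  apply: cvg_near_cst; near=> k; congr (_%:R * _)%:E; congr nat_of_bool.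
  apply/negbTE/negP => bk; move/negP: cx; apply; apply/(cb x); by exists k.
Unshelve. all: by end_near. Qed.

End monotone_indicators.

Lemma adde_fin_inj {R : realType} (a b : \bar R) (c : \bar R) : c \is a fin_num ->
  (a + c = b + c -> a = b)%E.
Proof. by move=> cf /(congr1 (fun x => x - c)%E); rewrite !addeK. Qed.

(** * Kernel integrals over the half-space, reduced to the ratio of heights *)

Section half_space_integrals.
Context {R : realType} (n : nat).
Local Notation leb := (@lebesgue_measure R).
Local Notation mu := (rV_lebesgue R n.+1).
Local Notation V := ('rV[R]_n.+1).
Implicit Types (x y : V) (sg : R).

Definition lastc x : R := x ord0 ord_max.
Definition hs x : R := (0 < lastc x)%R%:R.
(** The Gagliardo kernel |x - y|^(-N-sg); for sg > 0 it vanishes on the diagonal, by the convention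
    on powers of 0. *)
Definition kern sg x y : R := sqdist x y `^ (- ((n.+1%:R + sg) / 2)).
Definition kconst sg : R := space_kernel_const n ((n.+1%:R + sg) / 2).

Arguments lastc : simpl never.
Arguments hs : simpl never.
Arguments kern : simpl never.

Lemma measurable_lastc : measurable_fun setT lastc.
Proof. by rewrite /lastc; msr. Qed.

Lemma measurable_hs : measurable_fun setT hs.
Proof. by rewrite /hs /lastc; msr. Qed.

Lemma hs_ge0 x : 0 <= hs x. Proof. by rewrite /hs. Qed.

Lemma hs1 x : 0 < lastc x -> hs x = 1. Proof. by rewrite /hs => ->. Qed.

Lemma hs0 x : lastc x <= 0 -> hs x = 0. Proof. by rewrite /hs ltNge => ->. Qed.

Lemma kern_ge0 sg x y : 0 <= kern sg x y. Proof. exact: powR_ge0. Qed.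

Lemma kernC sg x y : kern sg x y = kern sg y x.
Proof. by rewrite /kern sqdistC. Qed.

Lemma measurable_kern sg : measurable_fun setT (fun z : V * V => kern sg z.1 z.2).
Proof. by rewrite /kern /sqdist; msr. Qed.

Lemma measurable_half_space : measurable (@half_space R n).
Proof.
have := measurable_fun_lt (measurable_cst (0 : R)) measurable_lastc.
move=> /(_ measurableT [set true] I); rewrite setTI; congr measurable.
Qed.

Lemma kern_eucl_norm sg x y :
  kern sg x y = (eucl_norm (x - y) `^ (n.+1%:R + sg))^-1.
Proof.
rewrite /kern /eucl_norm -powR12_sqrt; last by apply: sumr_ge0 => i _; exact: sqr_ge0.
rewrite -powRrM -powRN; congr (_ `^ _); last by rewrite mulrC.
by apply: eq_bigr => i _; rewrite !mxE.
Qed.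

Lemma hardy_integralE p s (u : V -> R) : hardy_integral p s u =
  (\int[mu]_x (hs x * (`|u x| `^ p * lastc x `^ (- (p * s))))%:E)%E.
Proof.
rewrite /hardy_integral.
have -> : @half_space R n = [set x : V | 0 < lastc x] by [].
rewrite (integral_boolr mu (fun x : V => 0 < lastc x)).
by apply: eq_integral => x _; rewrite powRN.
Qed.

Lemma gagliardoE p s (u : V -> R) : gagliardo p s u =
  (\int[mu \x mu]_z (hs z.1 * hs z.2 *
    (`|u z.1 - u z.2| `^ p * kern (p * s) z.1 z.2))%:E)%E.
Proof.
rewrite /gagliardo.
have -> : @half_space R n `*` @half_space R n =
    [set z : V * V | (0 < lastc z.1) && (0 < lastc z.2)].
  by apply/seteqP; split => [z [? ?]|z /andP[]]//; apply/andP.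
rewrite (integral_boolr (mu \x mu)%E (fun z : V * V => (0 < lastc z.1) && (0 < lastc z.2))).
by apply: eq_integral => z _; rewrite -kern_eucl_norm -mulnb natrM.
Qed.

Lemma kconst_gt0 sg : 0 < sg -> 0 < kconst sg.
Proof. by move=> sg0; apply: space_kernel_const_gt0; rewrite -[n.+1%:R]natr1; lra. Qed.

(* Integrating out the directions parallel to the boundary, then substituting
   [y_N = x_N r]. *)
Lemma integral_kern_section sg (B : R -> R) x : 0 < sg -> 0 < lastc x ->
  measurable_fun setT B -> (forall t, 0 <= B t) -> B (lastc x) = 0 ->
  (\int[mu]_y (hs y * (B (lastc y) * kern sg x y))%:E =
  (kconst sg * lastc x `^ (- sg))%:E *
    \int[leb]_r ((0 < r)%R%:R * (B (lastc x * r)%R * `|1 - r| `^ (- 1 - sg)))%:E)%E.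
Proof.
move=> sg0 x0 mB B0 Bx; set a := lastc x in x0 Bx *.
transitivity (\int[mu]_y (((0 < lastc y)%R%:R * B (lastc y)) *
    sqdist y x `^ (- ((n.+1%:R + sg) / 2)))%:E)%E.
  by apply: eq_integral => y _; rewrite mulrA kernC.
rewrite (@integral_last_coord _ _ (fun t => (0 < t)%R%:R * B t)); last 4 first.
- by rewrite -[n.+1%:R]natr1; lra.
- by msr.
- by move=> t; rewrite mulr_ge0.
- by rewrite -/(lastc x) -/a Bx mulr0.
rewrite -/(kconst sg) -/(lastc x) -/a [(kconst sg * _)%:E]EFinM -muleA.
apply: (congr1 (mule _)).
rewrite (@ge0_integral_scale _ (fun t => ((0 < t)%R%:R * B t *
  `|t - a| `^ (n%:R - 2 * ((n.+1%:R + sg) / 2)))%:E) a x0); last 2 first.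
- by msr.
- by move=> t; rewrite lee_fin !mulr_ge0// powR_ge0.
rewrite -(integralZl_real leb (ltW x0)); last 2 first.
- by msr.
- by move=> t; rewrite !mulr_ge0// powR_ge0.
rewrite -(integralZl_real leb (powR_ge0 a _)); last 2 first.
- by msr.
- by move=> t; rewrite !mulr_ge0// powR_ge0.
apply: eq_integral => r _; congr EFin; rewrite pmulr_rgt0//.
rewrite (_ : n%:R - 2 * ((n.+1%:R + sg) / 2) = -1 - sg); last first.
  by rewrite -[n.+1%:R]natr1; field.
have -> : `|a * r - a| = a * `|1 - r|.
  by rewrite -{2}(mulr1 a) -mulrBr normrM gtr0_norm// distrC.
rewrite powRM ?(ltW x0)//.
have -> : a `^ (- sg) = a * a `^ (-1 - sg).
  rewrite -{2}(powRr1 (ltW x0)) -powRD; last by rewrite (gt_eqF x0) implybT.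
  by congr (_ `^ _); ring.
by ring.
Qed.

(** Each section contributes x_N^(-sg) times the same integral over the ratio r, so the weight [A]
    and the function [g] of the ratio decouple. *)
Lemma integral_kern_quotient sg (A : V -> R) (g : R -> R) : 0 < sg ->
  measurable_fun setT A -> (forall x, 0 <= A x) ->
  measurable_fun setT g -> (forall t, 0 <= g t) -> g 1 = 0 ->
  (\int[mu \x mu]_z (hs z.1 * hs z.2 *
     (A z.1 * g (lastc z.2 / lastc z.1) * kern sg z.1 z.2))%:E =
  (kconst sg)%:E * \int[mu]_x (hs x * (A x * lastc x `^ (- sg)))%:E *
    \int[leb]_r ((0 < r)%R%:R * (g r * `|1 - r| `^ (- 1 - sg)))%:E)%E.
Proof.
move=> sg0 mA A0 mg g0 g1.
have mh := measurable_hs; have ml := measurable_lastc; have mk := measurable_kern sg.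
have mks x : measurable_fun setT (kern sg x) by rewrite /kern /sqdist; msr.
have c0 := kconst_gt0 sg0.
rewrite integral_prod_real; last 2 first.
- by msr.
- by move=> z; rewrite !mulr_ge0// ?hs_ge0 ?kern_ge0.
rewrite -integralZl_real ?(ltW c0)//; last 2 first.
- by msr.
- by move=> x; rewrite !mulr_ge0 ?powR_ge0// hs_ge0.
rewrite -ge0_integralZr_setT; last 3 first.
- by msr.
- by move=> x; pos; exact: hs_ge0.
- by apply: integral_ge0_real => r; rewrite !mulr_ge0// powR_ge0.
apply: eq_integral => x _.
have [x0|x0] := ltP 0 (lastc x); last first.
  by rewrite /= !(hs0 x0) mul0r mulr0 mul0e; apply: integral0_eq => y _; rewrite !mul0r.
transitivity (\int[mu]_y (A x * (hs y * (g (lastc y / lastc x) * kern sg x y)))%:E)%E.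
  by apply: eq_integral => y _; rewrite /= (hs1 x0) mul1r; congr EFin; ring.
rewrite integralZl_real//; last 2 first.
- by msr.
- by move=> y; rewrite !mulr_ge0// ?hs_ge0 ?kern_ge0.
rewrite (@integral_kern_section sg (fun t => g (t / lastc x)) x sg0 x0); last 3 first.
- by msr.
- by move=> t; exact: g0.
- by rewrite divff// gt_eqF.
rewrite muleA -EFinM (hs1 x0) mul1r mulrCA.
apply: (congr1 (mule _)); apply: eq_integral => r _.
by rewrite [lastc x * r]mulrC mulfK// gt_eqF.
Qed.

Lemma integral_prod_swap (f : V * V -> R) : measurable_fun setT f -> (forall z, 0 <= f z) ->
  (\int[mu \x mu]_z (f z)%:E = \int[mu \x mu]_z (f (z.2, z.1))%:E)%E.
Proof.
move=> mf f0; have mf' : measurable_fun setT (fun z : V * V => f (z.2, z.1)) by msr.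
rewrite (integral_prod_real mu mu mf f0).
rewrite (integral_prod_real mu mu mf' (fun z => f0 (z.2, z.1)))/=.
apply: (exchange_integral_real mu mu (f := fun x y => f (x, y))) => //.
by apply: (measurable_fun_comp mf); msr.
Qed.

(** Exchanging x and y inverts the ratio. Under r -> 1/r the kernel gains r^(1+sg) and the measure
    r^(-2), whence the extra factor r^(sg-1). *)
Lemma integral_kern_quotient_swap sg (A : V -> R) (g : R -> R) : 0 < sg ->
  measurable_fun setT A -> (forall x, 0 <= A x) ->
  measurable_fun setT g -> (forall t, 0 <= g t) -> g 1 = 0 ->
  (\int[mu \x mu]_z (hs z.1 * hs z.2 *
     (A z.2 * g (lastc z.2 / lastc z.1) * kern sg z.1 z.2))%:E =
  (kconst sg)%:E * \int[mu]_x (hs x * (A x * lastc x `^ (- sg)))%:E *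
    \int[leb]_r ((0 < r)%R%:R * (g r * r `^ (sg - 1) * `|1 - r| `^ (- 1 - sg)))%:E)%E.
Proof.
move=> sg0 mA A0 mg g0 g1.
have mh := measurable_hs; have ml := measurable_lastc; have mk := measurable_kern sg.
rewrite integral_prod_swap/=; last 2 first.
- by msr.
- by move=> z; rewrite !mulr_ge0// ?hs_ge0 ?kern_ge0.
transitivity (\int[mu \x mu]_z (hs z.1 * hs z.2 *
     (A z.1 * g ((lastc z.2 / lastc z.1)^-1) * kern sg z.1 z.2))%:E)%E.
  by apply: eq_integral => z _; rewrite invf_div kernC [hs z.2 * _]mulrC.
rewrite (@integral_kern_quotient sg A (fun t => g t^-1)) //; last 2 first.
- by msr.
- by rewrite invr1.
apply: (congr1 (mule _)).
rewrite (@integral_inversion _ (fun r => g r^-1 * `|1 - r| `^ (-1 - sg))); last 2 first.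
- by msr.
- by move=> t; rewrite mulr_ge0// powR_ge0.
apply: eq_integral => r _; congr EFin.
have [r0|r0] := ltP 0 r; last by rewrite !mul0r.
rewrite !mul1r invrK -!mulrA; congr (_ * _).
have -> : 1 - r^-1 = - ((1 - r) / r) by field; rewrite gt_eqF.
rewrite normrN normrM [`|r^-1|]gtr0_norm ?invr_gt0// powRM ?invr_ge0 ?(ltW r0)//.
rewrite mulrC mulrCA mulrA [RHS]mulrC -mulrA; congr (_ * _).
rewrite -(powR_inv1 (ltW r0)) -powRrM -powR_mulrn ?(ltW r0)// -powRN -powRD//.
  by congr (_ `^ _); ring.
by rewrite (gt_eqF r0) implybT.
Qed.

End half_space_integrals.

Arguments lastc : simpl never.
Arguments hs : simpl never.
Arguments kern : simpl never.

(** * Convexity of the p-th power, with its equality cases *)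

Section convexity_of_powers.
Context {R : realType}.
Implicit Types (a b m t x z p A B : R).

Lemma ln_tangent_le x : 0 < x -> 1 + ln x <= x.
Proof. by move=> x0; rewrite -{2}(lnK (x := x)) ?posrE// expR_ge1Dx. Qed.

Lemma ln_tangent_lt x : 0 < x -> x != 1 -> 1 + ln x < x.
Proof.
move=> x0 x1; rewrite -{2}(lnK (x := x)) ?posrE//; apply: expR_gt1Dx.
by rewrite ln_eq0.
Qed.

(* Weighted AM-GM for [z ^ p] and [1], written through [1 + ln x <= x]. *)
Lemma bernoulli_powR p z : 1 <= p -> 0 <= z ->
  1 + p * (z - 1) <= z `^ p ?= iff (p == 1) || (z == 1).
Proof.
move=> p1; have p0 : 0 < p by rewrite (lt_le_trans _ p1).
rewrite le_eqVlt => /orP[/eqP <-|z0].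
  rewrite (powR0 (lt0r_neq0 p0)) [0 == 1]eq_sym oner_eq0 orbF; split; first lra.
  by rewrite sub0r mulrN1 subr_eq0 eq_sym.
have w0 : 0 < z `^ p / z by rewrite divr_gt0// powR_gt0.
have v0 : 0 < z^-1 by rewrite invr_gt0.
have h1 := ln_tangent_le w0; have h2 := ln_tangent_le v0.
rewrite ln_div ?posrE ?powR_gt0// ln_powR in h1; rewrite lnV ?posrE// in h2.
(* [e] is slack in the tangent inequality at 1/z: [e] = 0 gives the bound, the full slack gives
   strictness when p > 1 and z differs from 1. *)
have key e : 1 - ln z + e <= z^-1 -> 1 + p * (z - 1) + (p - 1) * e * z <= z `^ p.
  move=> he.
  have : (1 + (p * ln z - ln z)) * z + (p - 1) * ((1 - ln z + e) * z) <= z `^ p + (p - 1).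
    apply: lerD; first by rewrite -ler_pdivlMr.
    by rewrite ler_piMr ?subr_ge0// -ler_pdivlMr// mul1r.
  lra.
have le1 : 1 + p * (z - 1) <= z `^ p.
  by have := key 0; rewrite mulr0 mul0r !addr0; apply.
split => //; apply/idP/idP; last first.
  case/orP => /eqP ->; first by rewrite powRr1 ?ltW//; apply/eqP; ring.
  by rewrite powR1 subrr mulr0 addr0.
rewrite -[p == 1]negbK -[z == 1]negbK -negb_and; apply: contraTN => /andP[pN1 zN1].
rewrite lt_eqF//; have zV1 : z^-1 != 1 by rewrite invr_eq1.
have h3 := ln_tangent_lt v0 zV1; rewrite lnV ?posrE// in h3.
have pp : 1 < p by rewrite lt_neqAle eq_sym pN1.
apply: lt_le_trans (key (z^-1 - (1 - ln z)) _); last by lra.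
by rewrite ltrDl !mulr_gt0// subr_gt0.
Qed.

(** Bernoulli at x / m, multiplied by m^p. *)
Lemma tangent_powR p m x : 1 <= p -> 0 < m -> 0 <= x ->
  m `^ p + p * m `^ (p - 1) * (x - m) <= x `^ p ?= iff (p == 1) || (x == m).
Proof.
move=> p1 m0 x0; have z0 : 0 <= x / m by rewrite divr_ge0// ltW.
have [h1 h2] := bernoulli_powR p1 z0.
have mp0 : 0 < m `^ p by rewrite powR_gt0.
have -> : x `^ p = m `^ p * (x / m) `^ p.
  by rewrite -powRM ?(ltW m0)// mulrC divfK// gt_eqF.
have -> : m `^ p + p * m `^ (p - 1) * (x - m) = m `^ p * (1 + p * (x / m - 1)).
  have mq := mulr_powRB1 (ltW m0) (lt_le_trans ltr01 p1).
  by rewrite -mq; field; rewrite gt_eqF.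
split; first by rewrite ler_pM2l.
rewrite (can_eq (mulKf (lt0r_neq0 mp0))) h2; congr (_ || _).
apply/eqP/eqP => [h|->]; last by rewrite divff// gt_eqF.
by rewrite -(divfK (lt0r_neq0 m0) x) h mul1r.
Qed.

(** Jensen for a + b as the mean of a/(1-t) and b/t with weights 1-t and t: in the weighted sum of
    the tangent inequalities at a + b the linear terms cancel. *)
Lemma powR_split_le p t a b : 1 <= p -> 0 < t -> t < 1 -> 0 <= a -> 0 <= b ->
  (a + b) `^ p <= (1 - t) `^ (1 - p) * a `^ p + t `^ (1 - p) * b `^ p.
Proof.
move=> p1 t0 t1 a0 b0; have t10 : 0 < 1 - t by rewrite subr_gt0.
have p0 : 0 < p by rewrite (lt_le_trans _ p1).
have scale (c x : R) : 0 < c -> 0 <= x -> c `^ (1 - p) * x `^ p = c * (x / c) `^ p.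
  move=> c0 x0; rewrite powRM ?invr_ge0 ?(ltW c0)// -(powR_inv1 (ltW c0)) -powRrM mulN1r.
  rewrite powRD; last by rewrite (gt_eqF c0) implybT.
  by rewrite powRr1 ?(ltW c0)//; ring.
rewrite !scale//.
have := addr_ge0 a0 b0; rewrite le_eqVlt => /orP[/eqP <-|m0].
  by rewrite powR0 ?gt_eqF// addr_ge0// mulr_ge0 ?powR_ge0 ?ltW.
have [h1 _] := tangent_powR p1 m0 (divr_ge0 a0 (ltW t10)).
have [h2 _] := tangent_powR p1 m0 (divr_ge0 b0 (ltW t0)).
apply: le_trans (lerD (ler_wpM2l (ltW t10) h1) (ler_wpM2l (ltW t0) h2)).
rewrite le_eqVlt; apply/orP; left; apply/eqP; field.
by rewrite !gt_eqF.
Qed.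

(** Strict convexity: equality in Jensen puts both points at their mean a + b. *)
Lemma powR_split_eq p t a b : 1 < p -> 0 < t -> t < 1 -> 0 <= a -> 0 <= b ->
  (1 - t) `^ (1 - p) * a `^ p + t `^ (1 - p) * b `^ p <= (a + b) `^ p ->
  a = (1 - t) * (a + b) /\ b = t * (a + b).
Proof.
move=> p1 t0 t1 a0 b0; have t10 : 0 < 1 - t by rewrite subr_gt0.
have scale (c x : R) : 0 < c -> 0 <= x -> c `^ (1 - p) * x `^ p = c * (x / c) `^ p.
  move=> c0 x0; rewrite powRM ?invr_ge0 ?(ltW c0)// -(powR_inv1 (ltW c0)) -powRrM mulN1r.
  rewrite powRD; last by rewrite (gt_eqF c0) implybT.
  by rewrite powRr1 ?(ltW c0)//; ring.
rewrite !scale//.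
have := addr_ge0 a0 b0; rewrite le_eqVlt => /orP[/eqP m0 _|m0 hle].
  have -> : a = 0 by lra.
  have -> : b = 0 by lra.
  by rewrite addr0 !mulr0.
have [h1 e1] := tangent_powR (ltW p1) m0 (divr_ge0 a0 (ltW t10)).
have [h2 _] := tangent_powR (ltW p1) m0 (divr_ge0 b0 (ltW t0)).
rewrite (gt_eqF p1)/= in e1.
(* Two tangent inequalities whose weighted sum is an equality are equalities; the equality clause at
   a/(1-t) then applies, as p differs from 1. *)
have ea : a / (1 - t) == a + b.
  rewrite -e1 eq_le h1/=.
  set X := (a / (1 - t)) `^ p in h1 hle *; set Y := (b / t) `^ p in h2 hle *.
  set M := (a + b) `^ p in h1 h2 hle *; set Q := (a + b) `^ (p - 1) in h1 h2 *.
  rewrite -(ler_pM2l t10); apply: le_trans (_ : M - t * Y <= _); first by lra.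
  have := ler_wpM2l (ltW t0) h2.
  have -> : t * (M + p * Q * (b / t - (a + b))) = t * M + p * Q * (b - t * (a + b)).
    by field; rewrite gt_eqF.
  have -> : (1 - t) * (M + p * Q * (a / (1 - t) - (a + b))) =
     (1 - t) * M + p * Q * (a - (1 - t) * (a + b)) by field; rewrite gt_eqF.
  have -> : a - (1 - t) * (a + b) = - (b - t * (a + b)) by ring.
  by rewrite mulrN; move: (p * Q * _) => W; lra.
have {}ea : a = (1 - t) * (a + b) by move/eqP: ea => <-; field; rewrite gt_eqF.
by split => //; lra.
Qed.

(* The deficit in the ground state inequality, for [u(x) = A], [u(y) = B] and
   [t = omega(y) / omega(x)]. *)
Definition deficit p t A B : R :=
  `|A - B| `^ p + (1 - t) `^ (p - 1) * t `^ (1 - p) * `|B| `^ p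
  - (1 - t) `^ (p - 1) * `|A| `^ p.

(** The splitting inequality for |A - B| and |B|, whose sum is at least |A|, multiplied by
    (1-t)^(p-1). *)
Lemma deficit_ge0 p t A B : 1 <= p -> 0 < t -> t < 1 -> 0 <= deficit p t A B.
Proof.
move=> p1 t0 t1; have t10 : 0 < 1 - t by rewrite subr_gt0.
have p0 : 0 <= p by rewrite (le_trans _ p1).
rewrite /deficit subr_ge0.
have hle := powR_split_le p1 t0 t1 (normr_ge0 (A - B)) (normr_ge0 B).
have cc : (1 - t) `^ (p - 1) * (1 - t) `^ (1 - p) = 1.
  rewrite -powRD; last by rewrite (gt_eqF t10) implybT.
  by rewrite (_ : p - 1 + (1 - p) = 0) ?powRr0//; ring.
rewrite -(ler_pM2l (powR_gt0 (p - 1) t10)) mulrDr !mulrA cc mul1r in hle.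
apply: le_trans hle; rewrite ler_wpM2l ?powR_ge0//.
apply: ge0_ler_powR; rewrite ?nnegrE ?addr_ge0//.
by rewrite -{1}(subrK B A) ler_normD.
Qed.

(** A zero deficit forces equality both in the splitting and in the triangle inequality; the first
    fixes the moduli, the second the sign. *)
Lemma deficit_eq0 p t A B : 1 < p -> 0 < t -> t < 1 -> deficit p t A B = 0 ->
  B = t * A.
Proof.
move=> p1 t0 t1 h; have t10 : 0 < 1 - t by rewrite subr_gt0.
have p0 : 0 < p by rewrite (lt_trans _ p1).
have tri : `|A| <= `|A - B| + `|B| by rewrite -{1}(subrK B A) ler_normD.
have hmul : (1 - t) `^ (p - 1) * ((1 - t) `^ (1 - p) * `|A - B| `^ p + t `^ (1 - p) * `|B| `^ p)
  = (1 - t) `^ (p - 1) * `|A| `^ p.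
  have cc : (1 - t) `^ (p - 1) * (1 - t) `^ (1 - p) = 1.
    rewrite -powRD; last by rewrite (gt_eqF t10) implybT.
    by rewrite (_ : p - 1 + (1 - p) = 0) ?powRr0//; ring.
  rewrite mulrDr !mulrA cc mul1r.
  by move/eqP: h; rewrite /deficit subr_eq0 => /eqP.
have {}hmul := mulfI (lt0r_neq0 (powR_gt0 (p - 1) t10)) hmul.
have mono : `|A| `^ p <= (`|A - B| + `|B|) `^ p.
  by apply: (ge0_ler_powR (ltW p0)); rewrite ?nnegrE ?addr_ge0.
have [ha hb] := powR_split_eq p1 t0 t1 (normr_ge0 (A - B)) (normr_ge0 B)
  (eq_ind_r (fun x => x <= _) mono hmul).
have hle := powR_split_le (ltW p1) t0 t1 (normr_ge0 (A - B)) (normr_ge0 B).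
have eA : `|A| = `|A - B| + `|B|.
  apply: (powR_injective p0); rewrite ?nnegrE ?addr_ge0//.
  by apply/eqP; rewrite eq_le mono -hmul.
move: ha hb; rewrite -eA => ha hb.
(* Here |A - B| = (1-t)|A| and |B| = t|A|; opposite signs are compatible with this only when both
   numbers are 0. *)
have [A0|A0] := leP 0 A; have [B0|B0] := leP 0 B;
  rewrite ?(ger0_norm A0) ?(ltr0_norm A0) ?(ger0_norm B0) ?(ltr0_norm B0) in ha hb eA *;
  move: ha; case: (lerP 0 (A - B)) => AB ha; rewrite ?(ger0_norm AB) ?(ltr0_norm AB) in ha *; nra.
Qed.

End convexity_of_powers.
Lemma powR1r {R : realType} (a : R) : 1 `^ a = 1.
Proof. by rewrite powR1. Qed.

(** * The ground state identity away from the diagonal *)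

Section ground_state.
Context {R : realType} (n : nat) (p s : R).
Hypotheses (p1 : 1 <= p) (s0 : 0 < s) (s1 : s < 1) (ps1 : p * s != 1).
Local Notation leb := (@lebesgue_measure R).
Local Notation mu := (rV_lebesgue R n.+1).
Local Notation V := ('rV[R]_n.+1).
Local Notation sg := (p * s).

(* The ground state is [omega(x) = x_N ^ (- alpha)]; [ratio r] is [omega(y) / omega(x)]
   at [r = y_N / x_N], and [side r] says that [omega(y) < omega(x)]. *)
Definition alpha : R := (1 - p * s) / p.
Definition ratio (r : R) : R := r `^ (- alpha).
Definition side (r : R) : bool :=
  if 0 < alpha then 1 < r else (0 < r) && (r < 1).

Lemma p_gt0 : 0 < p. Proof. exact: lt_le_trans p1. Qed.
Let p0 := p_gt0.

Lemma ps_gt0 : 0 < sg. Proof. exact: mulr_gt0. Qed.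
Let sg0 := ps_gt0.

Lemma alphap : alpha * p = 1 - sg.
Proof. by rewrite /alpha divfK// gt_eqF. Qed.

Lemma alpha_neq0 : alpha != 0.
Proof. rewrite mulf_neq0 ?invr_neq0 ?(gt_eqF p0)//.
by rewrite subr_eq0 eq_sym. Qed.

Lemma alpha_lt1 : alpha < 1.
Proof. by rewrite ltr_pdivrMr// mul1r; have := sg0; have := p1; lra. Qed.

Lemma alpha_gtN1 : -1 < alpha.
Proof.
rewrite ltr_pdivlMr// mulN1r.
by have : p * s < p; [rewrite gtr_pMr|lra].
Qed.

Lemma side_gt0 r : side r -> 0 < r.
Proof. by rewrite /side; case: ifP => _; [exact: lt_trans|case/andP]. Qed.

Lemma side_neq1 r : side r -> r != 1.
Proof. by rewrite /side; case: ifP => _; [move/gt_eqF->|case/andP => _ /lt_eqF->]. Qed.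

Lemma side1F : side 1 = false.
Proof. by apply/negP => /side_neq1/eqP. Qed.

(** Exactly one of (x, y) and (y, x) lies on the chosen side, unless the heights are equal. *)
Lemma sideV r : 0 < r -> r != 1 -> side r^-1 = ~~ side r.
Proof.
move=> r0 r1; rewrite /side invr_gt0 r0; case: ifP => _ /=.
  by rewrite invf_gt1// -leNgt le_eqVlt (negbTE r1).
by rewrite invf_lt1// -leNgt le_eqVlt eq_sym (negbTE r1).
Qed.

Lemma measurable_side : measurable_fun setT side.
Proof. by rewrite /side; case: (0 < alpha); msr. Qed.

Lemma ratio_gt0 r : 0 < r -> 0 < ratio r.
Proof. by move=> r0; rewrite powR_gt0. Qed.

Lemma side_ratio_lt1 r : side r -> ratio r < 1.
Proof.
rewrite /side /ratio; case: ifPn => a0 => [r1|/andP[r0 r1]].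
  rewrite powRN invf_lt1 ?powR_gt0 ?(lt_trans _ r1)//.
  by rewrite -[ltLHS](powR1r alpha) gt0_ltr_powR// nnegrE// ltW// (lt_trans _ r1).
rewrite -[ltRHS](powR1r (- alpha)) gt0_ltr_powR// ?nnegrE ?(ltW r0)//.
by rewrite oppr_gt0 lt_neqAle alpha_neq0 leNgt.
Qed.

Lemma measurable_ratio : measurable_fun setT ratio.
Proof. by rewrite /ratio; msr. Qed.

Definition gs_deficit (u : V -> R) (z : V * V) : R :=
  deficit p (ratio (lastc z.2 / lastc z.1)) (u z.1) (u z.2).

Lemma gs_deficit_ge0 u z : side (lastc z.2 / lastc z.1) -> 0 <= gs_deficit u z.
Proof.
move=> h; apply: deficit_ge0 => //; first exact/ratio_gt0/side_gt0.
exact: side_ratio_lt1.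
Qed.

Lemma measurable_gs_deficit u : measurable_fun setT u ->
  measurable_fun setT (gs_deficit u).
Proof.
move=> mu_; have ml := @measurable_lastc R n; have mr := measurable_ratio.
by rewrite /gs_deficit /deficit; msr.
Qed.

Definition hardy_mass (u : V -> R) : \bar R :=
  (\int[mu]_x (hs x * (`|u x| `^ p * lastc x `^ (- sg)))%:E)%E.

(* Away from the diagonal the three terms of the deficit can be integrated
   separately; the two one-sided ones combine thanks to [r -> 1 / r]. *)
Lemma ground_state_off_diagonal (u : V -> R) (b : R -> bool) :
  measurable_fun setT u -> measurable_fun setT b -> (forall r, b r -> side r) ->
  (\int[leb]_r ((b r)%:R * `|1 - r| `^ (- 1 - sg))%:E < +oo)%E ->
  (hardy_mass u < +oo)%E ->
  (\int[mu \x mu]_z (hs z.1 * hs z.2 * ((b (lastc z.2 / lastc z.1))%:R *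
      `|u z.1 - u z.2| `^ p * kern sg z.1 z.2))%:E =
   \int[mu \x mu]_z (hs z.1 * hs z.2 * ((b (lastc z.2 / lastc z.1))%:R *
      gs_deficit u z * kern sg z.1 z.2))%:E +
   (kconst n sg)%:E * hardy_mass u *
     \int[leb]_r ((b r)%:R * (`|1 - ratio r| `^ p * `|1 - r| `^ (- 1 - sg)))%:E)%E.
Proof.
move=> mu_ mb bside bfin hfin.
have mh := @measurable_hs R n; have ml := @measurable_lastc R n.
have mk := @measurable_kern R n sg; have mr := measurable_ratio.
have mg := measurable_gs_deficit mu_.
have k0 := @kern_ge0 R n sg.
have b1 : b 1 = false by apply/negP => /bside/side_neq1/eqP.
pose q (z : V * V) := lastc z.2 / lastc z.1.
have q_def z : lastc z.2 / lastc z.1 = q z by [].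
have mq : measurable_fun setT q by rewrite /q; msr.
pose ga r := (b r)%:R * (1 - ratio r) `^ (p - 1).
pose gb r := (b r)%:R * ((1 - ratio r) `^ (p - 1) * ratio r `^ (1 - p)).
have mga : measurable_fun setT ga by rewrite /ga; msr.
have mgb : measurable_fun setT gb by rewrite /gb; msr.
have ga0 r : 0 <= ga r by rewrite /ga; pos.
have gb0 r : 0 <= gb r by rewrite /gb; pos.
have mup : measurable_fun setT (fun x => `|u x| `^ p) by msr.
have d0 z : 0 <= (b (q z))%:R * gs_deficit u z.
  by have [/bside bz|] := boolP (b (q z)); rewrite ?mul0r// mul1r gs_deficit_ge0.
(* The definition of the deficit is rearranged as [f1] + [f2] = [f3] + [f4] with nonnegative terms,
   so that no difference of integrals is formed. *)
pose f1 z := hs z.1 * hs z.2 * ((b (q z))%:R * `|u z.1 - u z.2| `^ p * kern sg z.1 z.2).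
pose f2 z := hs z.1 * hs z.2 * (`|u z.2| `^ p * gb (q z) * kern sg z.1 z.2).
pose f3 z := hs z.1 * hs z.2 * ((b (q z))%:R * gs_deficit u z * kern sg z.1 z.2).
pose f4 z := hs z.1 * hs z.2 * (`|u z.1| `^ p * ga (q z) * kern sg z.1 z.2).
have eq1 : (\int[mu \x mu]_z (f1 z)%:E + \int[mu \x mu]_z (f2 z)%:E =
    \int[mu \x mu]_z (f3 z)%:E + \int[mu \x mu]_z (f4 z)%:E)%E.
  have mf1 : measurable_fun setT f1 by rewrite /f1; msr.
  have mf2 : measurable_fun setT f2 by rewrite /f2; msr.
  have mf3 : measurable_fun setT f3 by rewrite /f3; msr.
  have mf4 : measurable_fun setT f4 by rewrite /f4; msr.
  have f10 z : 0 <= f1 z by rewrite /f1; pos.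
  have f20 z : 0 <= f2 z by rewrite /f2; pos.
  have f30 z : 0 <= f3 z by apply: (mulr_ge0 _ (mulr_ge0 (d0 z) (k0 _ _))); pos.
  have f40 z : 0 <= f4 z by rewrite /f4; pos.
  rewrite -(integralD_real (mu \x mu)%E mf1 mf2 f10 f20).
  rewrite -(integralD_real (mu \x mu)%E mf3 mf4 f30 f40).
  apply: eq_integral => z _; congr EFin; rewrite /f1 /f2 /f3 /f4.
  by rewrite /ga /gb /gs_deficit /deficit -/(q z); ring.
move: eq1; rewrite /f1 /f2 /f3 /f4 /q.
rewrite (@integral_kern_quotient_swap R n sg (fun x => `|u x| `^ p) gb sg0 mup); last 4 first.
- by move=> x; pos.
- exact: mgb.
- exact: gb0.
- by rewrite /gb b1 mul0r.
rewrite (@integral_kern_quotient R n sg (fun x => `|u x| `^ p) ga sg0 mup); last 4 first.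
- by move=> x; pos.
- exact: mga.
- exact: ga0.
- by rewrite /ga b1 mul0r.
rewrite -/(hardy_mass u).
clear q q_def mq f1 f2 f3 f4 mg d0.
set E := (\int[mu \x mu]_z _)%E; set P := (\int[mu \x mu]_z _)%E => {}eq1.
set d := (\int[leb]_r _)%E.
(* The |u(y)|^p term contributes [c] and the |u(x)|^p term [d] + [c]; once [c] is cancelled, [d] is
   the truncated constant. *)
pose c := (\int[leb]_r ((b r)%:R * ((1 - ratio r) `^ (p - 1) * ratio r * `|1 - r| `^ (-1 - sg)))%:E)%E.
have dge0 : (0 <= d)%E by apply: integral_ge0_real => r; pos.
have cge0 : (0 <= c)%E by apply: integral_ge0_real => r; pos; exact: powR_ge0.
(* With t = r^(-alpha), t^(1-p) r^(sg-1) = t because alpha p = 1 - sg. *)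
have eb : (\int[leb]_r ((0 < r)%R%:R * (gb r * r `^ (sg - 1) * `|1 - r| `^ (-1 - sg)))%:E = c)%E.
  apply: eq_integral => r _; congr EFin; rewrite /gb.
  have [br|] := boolP (b r); last by rewrite !mul0r mulr0.
  have r0 := side_gt0 (bside _ br); rewrite r0 !mul1r -!mulrA; congr (_ * _).
  rewrite mulrA; congr (_ * _); rewrite /ratio -powRrM -powRD.
    by congr (_ `^ _); rewrite mulrBr mulr1 mulNr opprK alphap; ring.
  by rewrite (gt_eqF r0) implybT.
(* Here (1-t)^(p-1) = (1-t)^p + (1-t)^(p-1) t. *)
have ea : (\int[leb]_r ((0 < r)%R%:R * (ga r * `|1 - r| `^ (-1 - sg)))%:E = d + c)%E.
  rewrite /d /c -integralD_real; last 4 first.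
  - by msr.
  - by msr.
  - by move=> r; pos.
  - by move=> r; pos; exact: powR_ge0.
  apply: eq_integral => r _; congr EFin; rewrite /ga.
  have [br|] := boolP (b r); last by rewrite !mul0r mulr0 addr0.
  have r0 := side_gt0 (bside _ br); rewrite r0 !mul1r -mulrDl; congr (_ * _).
  have t1 : 0 < 1 - ratio r by rewrite subr_gt0; exact: (side_ratio_lt1 (bside _ br)).
  by rewrite (gtr0_norm t1) -(mulr_powRB1 (ltW t1) p0); ring.
rewrite eb ea in eq1.
(* The truncation enters here: where [b] holds, (1-t)^(p-1) t is at most 1, so the truncated kernel
   integral bounds [c]. *)
have cfin : c \is a fin_num.
  rewrite (ge0_fin_numE cge0).
  apply: le_lt_trans bfin; apply: le_integral_real; try mpos.
  by move=> r; pos; exact: powR_ge0.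
  move=> r; have [br|] := boolP (b r); last by rewrite !mul0r.
  rewrite !mul1r ler_piMl ?powR_ge0//.
  have r0 := side_gt0 (bside _ br).
  have t1 := side_ratio_lt1 (bside _ br); have t0 := ratio_gt0 r0.
  rewrite mulr_ile1 ?powR_ge0 ?(ltW t0) ?(ltW t1)//.
  rewrite -[leRHS](powR1r (p - 1)) ge0_ler_powR ?nnegrE ?subr_ge0 ?(ltW t1)//.
  by rewrite gerBl ltW.
have Hfin : hardy_mass u \is a fin_num.
  by rewrite ge0_fin_numE//; apply: integral_ge0_real => x; pos; exact: hs_ge0.
apply: (@adde_fin_inj _ _ _ ((kconst n sg)%:E * hardy_mass u * c)%E).
  by rewrite !fin_numM.
rewrite eq1 (ge0_muleDr _ dge0 cge0) addeA.
reflexivity.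
Qed.

End ground_state.

(** * Finiteness of beta integrals *)

Section beta_integral.
Context {R : realType}.
Local Notation leb := (@lebesgue_measure R).

Lemma ler_powR_le0 (e a b : R) : e <= 0 -> 0 < a -> a <= b -> b `^ e <= a `^ e.
Proof.
move=> e0 a0 ab; have b0 : 0 < b by rewrite (lt_le_trans a0).
rewrite -(opprK e) ![_ `^ - - e]powRN lef_pV2 ?posrE ?powR_gt0//.
by apply: ge0_ler_powR; rewrite ?nnegrE ?oppr_ge0// ltW.
Qed.

Lemma powR_near1_le (e y : R) : 2^-1 <= y -> y <= 1 -> y `^ e <= 1 + 2^-1 `^ e.
Proof.
move=> y2 y1; have h2 := powR_ge0 (2^-1) e.
have y0 : 0 <= y by rewrite (le_trans _ y2)// invr_ge0.
have [e0|e0] := leP 0 e.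
  have : y `^ e <= 1 `^ e by rewrite ge0_ler_powR ?nnegrE.
  by rewrite powR1r; lra.
have : y `^ e <= 2^-1 `^ e by apply: ler_powR_le0 => //; rewrite ?ltW// invr_gt0.
lra.
Qed.

(** On each half of the interval only one factor can be singular and the other is at most [C],
    whatever the sign of its exponent. *)
Lemma integral_beta_lty (a b : R) : 0 < a -> 0 < b ->
  (\int[leb]_r (((0 < r) && (r < 1))%R%:R * (r `^ (a - 1) * `|1 - r| `^ (b - 1)))%:E < +oo)%E.
Proof.
move=> a0 b0; pose C : R := 1 + 2^-1 `^ (a - 1) + 2^-1 `^ (b - 1).
have C0 : 0 <= C by rewrite /C; pos.
pose F (c t : R) := ((0 < t) && (t <= 1))%R%:R * t `^ (c - 1).
have mF c : measurable_fun setT (F c) by rewrite /F; msr.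
have F0 c t : 0 <= F c t by rewrite /F; pos.
have mFa := mF a.
apply: (@le_lt_trans _ _ (\int[leb]_r (C * F a r + C * F b (1 - r))%:E)%E).
  apply: le_integral_real; try mpos.
  move=> r; case: (boolP ((0 < r) && (r < 1))) => [/andP[r0 r1]|_]; last first.
    by rewrite mul0r; pos.
  rewrite mul1r /F r0 (ltW r1) subr_gt0 r1/= lerBlDr lerDl (ltW r0) !mul1r.
  have r10 : 0 < 1 - r by rewrite subr_gt0.
  rewrite gtr0_norm//.
  have h1 := powR_ge0 r (a - 1); have h2 := powR_ge0 (1 - r) (b - 1).
  have k1 := powR_ge0 (2^-1) (a - 1); have k2 := powR_ge0 (2^-1) (b - 1).
  have [r2|r2] := leP r 2^-1.
    have : (1 - r) `^ (b - 1) <= C by rewrite (le_trans (powR_near1_le _ _ _)) /C//; lra.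
    move=> h; rewrite -[leLHS]addr0 mulrC; apply: lerD; last by pos.
    exact: ler_wpM2r.
  have : r `^ (a - 1) <= C by rewrite (le_trans (powR_near1_le _ _ _)) /C//; lra.
  move=> h; rewrite -[leLHS]add0r; apply: lerD; first by pos.
  exact: ler_wpM2r.
rewrite integralD_real; try mpos.
rewrite (integralZl_real leb C0 mFa (F0 a)) (integralZl_real leb C0); try mpos.
have -> : (\int[leb]_r (F b (1 - r))%:E = \int[leb]_r (F b r)%:E)%E.
  rewrite -(@ge0_integral_shift _ (fun t => (F b t)%:E) 1); try mpos.
  rewrite -(@ge0_integral_opp _ (fun t => (F b (t + 1))%:E)); try mpos.
  by apply: eq_integral => r _; rewrite addrC.
by rewrite /F (integral_powR_unit a0) (integral_powR_unit b0) -!EFinM -EFinD ltry.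
Qed.

End beta_integral.

Lemma cvge_unique {R : realType} (f g : nat -> \bar R) (a b : \bar R) :
  (forall m, f m = g m) -> (f m @[m --> \oo] --> a)%E -> (g m @[m --> \oo] --> b)%E -> a = b.
Proof.
move=> fg; rewrite (_ : f = g); last exact/funext.
by move=> /(cvg_lim (@ereal_hausdorff R)) <- /(cvg_lim (@ereal_hausdorff R)).
Qed.

(** * Removing the truncation near the diagonal *)

Section ground_state_representation.
Context {R : realType} (n : nat) (p s : R).
Hypotheses (p1 : 1 <= p) (s0 : 0 < s) (s1 : s < 1) (ps1 : p * s != 1).
Local Notation leb := (@lebesgue_measure R).
Local Notation mu := (rV_lebesgue R n.+1).
Local Notation V := ('rV[R]_n.+1).
Local Notation sg := (p * s).
Local Notation side := (side p s).
Local Notation ratio := (ratio p s).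
Let sg0 : 0 < sg := ps_gt0 p1 s0.

Let trunc_side (m : nat) (r : R) : bool := side r && (m.+1%:R^-1 <= `|1 - r|).

Let measurable_trunc_side m : measurable_fun setT (trunc_side m).
Proof. by have ms := @measurable_side R p s; rewrite /trunc_side; msr. Qed.

Let trunc_side_lty m :
  (\int[leb]_r ((trunc_side m r)%:R * `|1 - r| `^ (- 1 - sg))%:E < +oo)%E.
Proof.
pose e : R := m.+1%:R^-1; have e0 : 0 < e by rewrite invr_gt0.
(* For r >= 1 + e one has r - 1 >= r e/(1+e), which gives the decay r^(-1-sg); the second summand
   bounds the kernel where r < 1. *)
pose C : R := (e / (1 + e)) `^ (- 1 - sg) + e `^ (- 1 - sg).
have C0 : 0 <= C by rewrite /C; pos.
apply: (@le_lt_trans _ _ (\int[leb]_r (C * ((1 <= r)%R%:R * r `^ (- sg - 1)) +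
   C * ((0 <= r) && (r <= 1))%R%:R)%:E)%E).
  apply: le_integral_real; try mpos.
  move=> r; case: (boolP (trunc_side m r)); last by rewrite mul0r => _; pos.
  rewrite /trunc_side -/e mul1r => /andP[/[dup]/side_gt0 r0]; rewrite /side.
  have exp0 : -1 - sg <= 0 by have := sg0; lra.
  case: ifP => _ => [r1|/andP[_ r1]] er.
    rewrite (ltW r1) mul1r; apply: ler_wpDr; first by pos.
    have r10 : 0 < r - 1 by rewrite subr_gt0.
    rewrite distrC gtr0_norm// in er *.
    have h : e / (1 + e) * r <= r - 1.
      by rewrite mulrAC ler_pdivrMr ?addr_gt0//; nra.
    have e10 : 0 < e / (1 + e) by rewrite divr_gt0// addr_gt0.
    apply: (le_trans (ler_powR_le0 exp0 (mulr_gt0 e10 r0) h)).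
    rewrite powRM ?(ltW e10) ?(ltW r0)// [- sg - 1]addrC.
    by rewrite ler_wpM2r ?powR_ge0// /C lerDl powR_ge0.
  rewrite (ltW r0) (ltW r1) /= mulr1; apply: ler_wpDl; first by pos.
  apply: (le_trans (ler_powR_le0 exp0 e0 er)).
  by rewrite /C lerDr powR_ge0.
rewrite integralD_real; try mpos.
rewrite (integralZl_real leb C0); try mpos.
rewrite (integralZl_real leb C0); try mpos.
by rewrite (integral_powR_pinfty sg0) (integral_boolr_itv ler01) -!EFinM -EFinD ltry.
Qed.

Let trunc_side_homo r m k : (m <= k)%N -> trunc_side m r -> trunc_side k r.
Proof.
move=> mk /andP[h1 h2]; apply/andP; split => //; apply: le_trans h2.
by rewrite lef_pV2 ?posrE// ler_nat ltnS.
Qed.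

Let trunc_side_cover r : side r <-> exists m, trunc_side m r.
Proof.
split => [h|[m /andP[]]//].
have d0 : 0 < `|1 - r| by rewrite normr_gt0 subr_eq0 eq_sym; exact: side_neq1 h.
have := truncnS_gt (`|1 - r|^-1); set m := Num.truncn _ => mh.
exists m; rewrite /trunc_side h/= -[leRHS]invrK lef_pV2 ?posrE ?invr_gt0//.
exact: ltW.
Qed.

Definition one_sided_const : \bar R :=
  (\int[leb]_r ((side r)%:R * (`|1 - ratio r| `^ p * `|1 - r| `^ (- 1 - sg)))%:E)%E.

Definition one_sided_deficit (u : V -> R) : \bar R :=
  (\int[mu \x mu]_z (hs z.1 * hs z.2 * ((side (lastc z.2 / lastc z.1))%:R *
      gs_deficit p s u z * kern sg z.1 z.2))%:E)%E.

(** In the truncated identity all three integrands increase with m, the deficit being nonnegative on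
    the side, so each term has its monotone limit. *)
Lemma ground_state_one_sided (u : V -> R) : measurable_fun setT u ->
  (hardy_mass p s u < +oo)%E ->
  (\int[mu \x mu]_z (hs z.1 * hs z.2 * ((side (lastc z.2 / lastc z.1))%:R *
      `|u z.1 - u z.2| `^ p * kern sg z.1 z.2))%:E =
   one_sided_deficit u + (kconst n sg)%:E * hardy_mass p s u * one_sided_const)%E.
Proof.
move=> mu_ hfin.
have mh := @measurable_hs R n; have ml := @measurable_lastc R n.
have mk := @measurable_kern R n sg; have mr := @measurable_ratio R p s.
have mg := @measurable_gs_deficit R n p s u mu_.
have ms := @measurable_side R p s.
have k0 := @kern_ge0 R n sg.
have mt := measurable_trunc_side.
have c0 := kconst_gt0 n sg0.
pose F1 (z : V * V) := hs z.1 * hs z.2 * (`|u z.1 - u z.2| `^ p * kern sg z.1 z.2).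
pose F2 (z : V * V) := hs z.1 * hs z.2 * ((side (lastc z.2 / lastc z.1))%:R *
      gs_deficit p s u z * kern sg z.1 z.2).
pose F3 (r : R) := `|1 - ratio r| `^ p * `|1 - r| `^ (- 1 - sg).
have mF1 : measurable_fun setT F1 by rewrite /F1; msr.
have mF2 : measurable_fun setT F2 by rewrite /F2; msr.
have mF3 : measurable_fun setT F3 by rewrite /F3; msr.
have F10 z : 0 <= F1 z by rewrite /F1; pos.
have F20 z : 0 <= F2 z.
  rewrite /F2; apply: (mulr_ge0 _ (mulr_ge0 _ (k0 _ _))); first by pos.
  have [h|h] := boolP (side (lastc z.2 / lastc z.1)); last by rewrite mul0r.
  by rewrite mul1r gs_deficit_ge0.
have F30 r : 0 <= F3 r by rewrite /F3; pos.
have mb m : measurable_fun setT (fun z : V * V => trunc_side m (lastc z.2 / lastc z.1)).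
  by have := mt m => ?; msr.
have C1 := @cvg_integral_boolr _ _ _ (mu \x mu)%E _
  (fun z : V * V => side (lastc z.2 / lastc z.1)) F1 mb mF1 F10
  (fun z m k mk => @trunc_side_homo _ m k mk) (fun z => @trunc_side_cover _).
have C2 := @cvg_integral_boolr _ _ _ (mu \x mu)%E _
  (fun z : V * V => side (lastc z.2 / lastc z.1)) F2 mb mF2 F20
  (fun z m k mk => @trunc_side_homo _ m k mk) (fun z => @trunc_side_cover _).
have C3 := @cvg_integral_boolr _ _ _ leb _
  (fun r => side r) F3 mt mF3 F30 (fun z m k mk => @trunc_side_homo _ m k mk)
  (fun z => @trunc_side_cover _).
have eq_m m : (\int[mu \x mu]_z ((trunc_side m (lastc z.2 / lastc z.1))%:R * F1 z)%:E =
   \int[mu \x mu]_z ((trunc_side m (lastc z.2 / lastc z.1))%:R * F2 z)%:E +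
   (kconst n sg)%:E * hardy_mass p s u * \int[leb]_r ((trunc_side m r)%:R * F3 r)%:E)%E.
  transitivity (\int[mu \x mu]_z (hs z.1 * hs z.2 * ((trunc_side m (lastc z.2 / lastc z.1))%:R *
      `|u z.1 - u z.2| `^ p * kern sg z.1 z.2))%:E)%E.
    by apply: eq_integral => z _; congr EFin; rewrite /F1; ring.
  rewrite (@ground_state_off_diagonal R n p s p1 s0 ps1 u (trunc_side m) mu_ (mt m)
    (fun r h => (andP h).1) (@trunc_side_lty m) hfin); congr (_ + _)%E.
  apply: eq_integral => z _; congr EFin; rewrite /F2.
  have [h|_] := boolP (trunc_side m (lastc z.2 / lastc z.1)).
    by rewrite (andP h).1 !mul1r.
  by rewrite !mul0r mulr0.
have Hfin : hardy_mass p s u \is a fin_num.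
  by rewrite ge0_fin_numE//; apply: integral_ge0_real => x; pos.
have cHfin : ((kconst n sg)%:E * hardy_mass p s u)%E \is a fin_num.
  by rewrite fin_numM.
have I3 : (0 <= \int[leb]_r ((side r)%:R * F3 r)%:E)%E.
  by apply: integral_ge0_real => r; pos.
have I2 : (0 <= \int[mu \x mu]_z ((side (lastc z.2 / lastc z.1))%:R * F2 z)%:E)%E.
  by apply: integral_ge0_real => r; pos.
have C3' := cvgeZl cHfin C3.
have cH0 : (0 <= (kconst n sg)%:E * hardy_mass p s u)%E.
  by apply: mule_ge0; [pos|apply: integral_ge0_real => x; pos].
have dd : (\int[mu \x mu]_z ((side (lastc z.2 / lastc z.1))%:R * F2 z)%:E +?
  (kconst n sg)%:E * hardy_mass p s u * \int[leb]_r ((side r)%:R * F3 r)%:E)%E.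
  by apply: ge0_adde_def; rewrite inE//; exact: mule_ge0.
have C23 := cvgeD dd C2 C3'.
have := cvge_unique eq_m C1 (C23 _).
rewrite /one_sided_deficit /one_sided_const => e.
transitivity (\int[mu \x mu]_z ((side (lastc z.2 / lastc z.1))%:R * F1 z)%:E)%E.
  by apply: eq_integral => z _; congr EFin; rewrite /F1; ring.
rewrite e; congr (_ + _)%E; apply: eq_integral => z _; congr EFin; rewrite /F2.
by case: (side _); rewrite ?mul1r// !mul0r mulr0.
Qed.

End ground_state_representation.

(** * The sharp constant and the full representation *)

Section hardy_constant.
Context {R : realType} (n : nat) (p s : R).
Hypotheses (p1 : 1 <= p) (s0 : 0 < s) (s1 : s < 1) (ps1 : p * s != 1).
Local Notation leb := (@lebesgue_measure R).
Local Notation mu := (rV_lebesgue R n.+1).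
Local Notation V := ('rV[R]_n.+1).
Local Notation sg := (p * s).
Let p0 : 0 < p := p_gt0 p1.
Let sg0 : 0 < sg := ps_gt0 p1 s0.

Definition profile (r : R) : R := `|1 - ratio p s r| `^ p * `|1 - r| `^ (- 1 - sg).

Lemma measurable_profile : measurable_fun setT profile.
Proof. by have mr := @measurable_ratio R p s; rewrite /profile; msr. Qed.

Lemma profile_ge0 r : 0 <= profile r.
Proof. by rewrite /profile; pos. Qed.

(** The powers of r cancel since alpha p = 1 - sg; this makes the constant the same whichever side
    the sign of alpha selects. *)
Lemma profile_inv r : 0 < r -> profile r^-1 * (r ^+ 2)^-1 = profile r.
Proof.
move=> r0; rewrite /profile.
have -> : 1 - r^-1 = - ((1 - r) / r) by field; rewrite gt_eqF.
have -> : 1 - ratio p s r^-1 = - ((1 - ratio p s r) * r `^ alpha p s).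
  rewrite /ratio -(powR_inv1 (ltW r0)) -powRrM mulN1r opprK mulrBl mul1r powRN mulVf ?opprB//.
  by rewrite gt_eqF// powR_gt0.
rewrite !normrN !normrM (gtr0_norm (powR_gt0 _ r0)) [`|r^-1|]gtr0_norm ?invr_gt0//.
rewrite !powRM ?powR_ge0 ?invr_ge0 ?(ltW r0)// -(powR_inv1 (ltW r0)) -!powRrM.
rewrite -powR_mulrn ?(ltW r0)// -powRN alphap//.
rewrite -!mulrA; congr (_ * _); rewrite mulrCA -[RHS]mulr1; congr (_ * _).
rewrite -!powRD ?(gt_eqF r0) ?implybT//.
by rewrite (_ : _ + _ = 0) ?powRr0//; ring.
Qed.

(** Since |alpha| < 1, |1 - r^(-alpha)| is at most r^(-alpha) (1-r) when alpha >= 0 and at most 1-r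
    otherwise. The p-th power leaves (1-r)^(p(1-s)-1), integrable because s < 1. *)
Lemma profile_unit_le r : 0 < r -> r < 1 ->
  profile r <= r `^ (sg - 1) * `|1 - r| `^ (p * (1 - s) - 1) +
               r `^ (1 - 1) * `|1 - r| `^ (p * (1 - s) - 1).
Proof.
move=> r0 r1; have r10 : 0 < 1 - r by rewrite subr_gt0.
have eqr : `|1 - r| `^ (p * (1 - s) - 1) = `|1 - r| `^ p * `|1 - r| `^ (- 1 - sg).
  rewrite -powRD; last by rewrite normr_eq0 (gt_eqF r10) implybT.
  by congr (_ `^ _); ring.
have er (a : R) : 0 <= a -> a <= 1 -> r <= r `^ a.
  by move=> a0 a1; rewrite ger1_powR// r0 ltW.
have al1 := alpha_lt1 p1 s0.
have alN1 := alpha_gtN1 p1 s1.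
rewrite eqr subrr powRr0 mul1r mulrA -mulrDl /profile ler_wpM2r ?powR_ge0//.
rewrite (gtr0_norm r10) in eqr *.
have [al0|al0] := leP 0 (alpha p s).
  apply: ler_wpDr; first by pos.
  have -> : r `^ (sg - 1) * (1 - r) `^ p = (r `^ (- alpha p s) * (1 - r)) `^ p.
    rewrite powRM ?powR_ge0 ?(ltW r10)// -powRrM mulNr (alphap _ p1).
    by congr (_ `^ _ * _); ring.
  apply: (ge0_ler_powR (ltW p0)); rewrite ?nnegrE; [exact: normr_ge0|exact: (mulr_ge0 (powR_ge0 _ _) (ltW r10))|].
  have hr : r `^ (- alpha p s) * r `^ (alpha p s) = 1.
    by rewrite powRN mulVf// gt_eqF// powR_gt0.
  have hX : r `^ alpha p s <= 1.
    by rewrite -[leRHS](powR1r (alpha p s)) ge0_ler_powR ?nnegrE ?(ltW r0) ?(ltW r1).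
  have h1 := er _ al0 (ltW al1).
  rewrite /ratio ler0_norm; last by nra.
  by nra.
apply: ler_wpDl; first by pos.
apply: (ge0_ler_powR (ltW p0)); rewrite ?nnegrE; [exact: normr_ge0|exact: ltW|].
have h1 : r <= r `^ (- alpha p s) by apply: er; lra.
have h2 : ratio p s r <= 1.
  rewrite /ratio -(powR1r (- alpha p s)) ge0_ler_powR ?nnegrE ?(ltW r0) ?(ltW r1)//; lra.
rewrite ger0_norm; last by rewrite subr_ge0.
by rewrite lerD2l lerN2.
Qed.

Lemma integral_profile_unit_lty :
  (\int[leb]_r (((0 < r) && (r < 1))%R%:R * profile r)%:E < +oo)%E.
Proof.
have mp := measurable_profile.
have q0 : 0 < p * (1 - s) by rewrite mulr_gt0// subr_gt0.
pose beta (a b r : R) := ((0 < r) && (r < 1))%R%:R * (r `^ (a - 1) * `|1 - r| `^ (b - 1)).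
apply: (@le_lt_trans _ _ (\int[leb]_r (beta sg (p * (1 - s)) r + beta 1 (p * (1 - s)) r)%:E)%E).
  apply: le_integral_real; try mpos.
  - by rewrite /beta; msr.
  - by move=> r; rewrite mulr_ge0// profile_ge0.
  - move=> r; rewrite /beta; case: (boolP ((0 < r) && (r < 1))) => [/andP[r0 r1]|_].
      by rewrite !mul1r profile_unit_le.
    by rewrite !mul0r addr0.
rewrite integralD_real; last 4 first.
- by rewrite /beta; msr.
- by rewrite /beta; msr.
- by move=> r; rewrite /beta; pos.
- by move=> r; rewrite /beta; pos.
rewrite lte_add_pinfty//; exact: integral_beta_lty.
Qed.

Lemma integral_profile_out :
  (\int[leb]_r ((1 < r)%R%:R * profile r)%:E =
   \int[leb]_r (((0 < r) && (r < 1))%R%:R * profile r)%:E)%E.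
Proof.
have mp := measurable_profile; have pp0 := profile_ge0.
transitivity (\int[leb]_r ((0 < r)%R%:R * ((1 < r)%R%:R * profile r))%:E)%E.
  apply: eq_integral => r _; congr EFin; rewrite mulrA -natrM mulnb.
  by case: (ltP 1 r) => h; rewrite ?andbF// (lt_trans _ h).
rewrite (integral_inversion (F := fun r => (1 < r)%R%:R * profile r)); try mpos.
apply: eq_integral => r _; congr EFin; case: (ltP 0 r) => r0; last by rewrite !mul0r.
by rewrite mul1r -mulrA profile_inv// invf_gt1.
Qed.


Lemma one_sided_constE : one_sided_const p s =
  (\int[leb]_r (((0 < r) && (r < 1))%R%:R * profile r)%:E)%E.
Proof.
rewrite /one_sided_const /side; case: (0 < alpha p s) => //.
exact: integral_profile_out.
Qed.

(** The factor 2 counts the sides of the diagonal and [kconst] holds the Gamma quotient, with n = N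
    - 1; finiteness of the profile integral justifies the real-valued integral in [hardy_const]. *)
Lemma hardy_constE : ((hardy_const n.+1 p s)%:E =
  2%:E * ((kconst n sg)%:E * one_sided_const p s))%E.
Proof.
have d0 : (0 <= \int[leb]_r (((0 < r) && (r < 1))%R%:R * profile r)%:E)%E.
  by apply: integral_ge0_real => r; rewrite mulr_ge0// profile_ge0.
have dfin := integral_profile_unit_lty.
rewrite one_sided_constE /hardy_const /Rintegral.
rewrite (_ : (\int[leb]_(r in `]0%R, 1%R[) _)%E =
    (\int[leb]_r (((0 < r) && (r < 1))%R%:R * profile r)%:E)%E); last first.
  rewrite (_ : `]0, 1[%classic = [set r : R | (0 < r) && (r < 1)]); last first.
    by apply/seteqP; split => x /=; rewrite in_itv.
  rewrite (integral_boolr leb (fun r : R => (0 < r) && (r < 1))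
    (fun r => `|1 - r `^ ((sg - 1) / p)| `^ p / (1 - r) `^ (1 + sg))).
  apply: eq_integral => r _; congr EFin.
  have [/andP[r0 r1]|_] := boolP ((0 < r) && (r < 1)); last by rewrite !mul0r.
  have r10 : 0 < 1 - r by rewrite subr_gt0.
  have -> : (sg - 1) / p = - alpha p s by rewrite /alpha -mulNr opprB.
  rewrite /profile /ratio (gtr0_norm r10) -powRN.
  by have -> : - (1 + sg) = - 1 - sg by ring.
rewrite EFinM fineK ?ge0_fin_numE// muleA -EFinM; congr (_%:E * _)%E.
rewrite /kconst /space_kernel_const -mulrA; congr (_ * (_ `^ _ * (Gamma _ / _))).
- by rewrite -[n.+1%:R]natr1 addrK.
- by rewrite -[n.+1%:R]natr1; field.
Qed.

Lemma one_sided_const_fin : one_sided_const p s \is a fin_num.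
Proof.
rewrite one_sided_constE ge0_fin_numE; first exact: integral_profile_unit_lty.
by apply: integral_ge0_real => r; rewrite mulr_ge0// profile_ge0.
Qed.

(** For fixed x the last coordinate of y runs over a single point, a null set of the line. *)
Lemma integral_same_height (f : V * V -> R) : measurable_fun setT f ->
  (forall z, 0 <= f z) ->
  (\int[mu \x mu]_z ((lastc z.2 == lastc z.1)%:R * f z)%:E = 0)%E.
Proof.
move=> mf f0; have ml := @measurable_lastc R n.
rewrite integral_prod_real; try mpos.
apply: integral0_eq => x _ /=.
rewrite (integral_rcons_swap (f := fun y => (lastc y == lastc x)%:R * f (x, y))); try mpos.
transitivity (\int[leb]_t ((t == lastc x)%:R%:E * \int[rV_lebesgue R n]_y (f (x, rV_rcons (y, t)))%:E))%E.
  apply: eq_integral => t _.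
  have e y : lastc (rV_rcons (y, t)) = t by rewrite /lastc rV_rcons_max.
  under eq_integral do rewrite e.
  rewrite integralZl_real//; apply: (measurable_fun_comp mf); msr2.
set G := (fun t => \int[rV_lebesgue R n]_y (f (x, rV_rcons (y, t)))%:E)%E.
rewrite -(integral_set1 G (lastc x)) [RHS]integral_mkcond.
apply: eq_integral => t _; rewrite patchE.
have [->|tx] := eqVneq t (lastc x); first by rewrite mem_set// mul1e.
by rewrite memNset ?mul0e//=; apply/eqP.
Qed.

(** The integrand is symmetric in x and y, and off the equal heights the two orderings of a pair
    fall on different sides. *)
Lemma gagliardo_one_sided (u : V -> R) : measurable_fun setT u ->
  (gagliardo p s u = 2%:E *
   \int[mu \x mu]_z (hs z.1 * hs z.2 * ((side p s (lastc z.2 / lastc z.1))%:R *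
      `|u z.1 - u z.2| `^ p * kern sg z.1 z.2))%:E)%E.
Proof.
move=> mu_.
have mh := @measurable_hs R n; have ml := @measurable_lastc R n.
have mk := @measurable_kern R n sg; have ms := @measurable_side R p s.
have h0 := @hs_ge0 R n; have k0 := @kern_ge0 R n sg.
pose F (z : V * V) := hs z.1 * hs z.2 * (`|u z.1 - u z.2| `^ p * kern sg z.1 z.2).
pose F1 (z : V * V) := hs z.1 * hs z.2 * ((side p s (lastc z.2 / lastc z.1))%:R *
      `|u z.1 - u z.2| `^ p * kern sg z.1 z.2).
have mF : measurable_fun setT F by rewrite /F; msr.
have F0 z : 0 <= F z by rewrite /F; pos.
have mF1 : measurable_fun setT F1 by rewrite /F1; msr.
have F10 z : 0 <= F1 z by rewrite /F1; pos.
have mF2 : measurable_fun setT (fun z : V * V => F1 (z.2, z.1)) by msr.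
have m12 : measurable_fun setT (fun z : V * V => F1 z + F1 (z.2, z.1)) by msr.
have m3 : measurable_fun setT (fun z : V * V => (lastc z.2 == lastc z.1)%:R * F z) by msr.
rewrite gagliardoE.
transitivity (\int[mu \x mu]_z (F1 z + F1 (z.2, z.1) + (lastc z.2 == lastc z.1)%:R * F z)%:E)%E.
  apply: eq_integral => z _; congr EFin; rewrite -/(F z) /F1/= -[kern sg z.2 z.1]kernC distrC.
  have [x0|x0] := ltP 0 (lastc z.1); last by rewrite /F (hs0 x0) !(mul0r, mulr0, addr0).
  have [y0|y0] := ltP 0 (lastc z.2); last by rewrite /F (hs0 y0) !(mul0r, mulr0, addr0).
  rewrite /F (hs1 x0) (hs1 y0) !mul1r.
  have [e|e] := eqVneq (lastc z.2) (lastc z.1).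
    by rewrite e divff ?gt_eqF// side1F !mul0r !add0r mul1r.
  rewrite -invf_div sideV; last 2 first.
  - exact: divr_gt0.
  - by apply: contra_neq e => h; rewrite -(divfK (lt0r_neq0 y0) (lastc z.1)) h mul1r.
  by rewrite [`|u z.2 - _|]distrC; case: (side _ _ _); rewrite ?(mul1r, mul0r, addr0, add0r).
rewrite (integralD_real (mu \x mu)%E m12 m3); last 2 first.
- by move=> z; rewrite addr_ge0.
- by move=> z; rewrite mulr_ge0.
rewrite (integralD_real (mu \x mu)%E mF1 mF2 F10 (fun z => F10 (z.2, z.1))).
rewrite (integral_same_height mF F0) adde0 -(integral_prod_swap mF1 F10).
by rewrite -mule2n mule_natl.
Qed.

Lemma ground_state_representation (u : V -> R) : measurable_fun setT u ->
  (hardy_integral p s u < +oo)%E ->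
  (gagliardo p s u = (hardy_const n.+1 p s)%:E * hardy_integral p s u +
     2%:E * one_sided_deficit p s u)%E.
Proof.
move=> mu_; rewrite hardy_integralE => hfin.
rewrite gagliardo_one_sided// (@ground_state_one_sided R n p s p1 s0 ps1 u mu_ hfin).
rewrite hardy_constE -/(hardy_mass p s u).
have cst0 : (0 <= one_sided_const p s)%E.
  by apply: integral_ge0_real => r; pos.
have c0 := kconst_gt0 n sg0.
rewrite ge0_muleDr; last 2 first.
- apply: integral_ge0_real => z; apply: (mulr_ge0 _ (mulr_ge0 _ (kern_ge0 _ _ _))).
    by rewrite mulr_ge0 ?hs_ge0.
  have [h|h] := boolP (side p s (lastc z.2 / lastc z.1)); last by rewrite mul0r.
  by rewrite mul1r gs_deficit_ge0.
- apply: mule_ge0 => //; apply: mule_ge0; first by pos.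
  by apply: integral_ge0_real => x; pos; exact: hs_ge0.
rewrite addeC -!muleA; congr (_ * (_ * _) + _)%E.
by rewrite muleC.
Qed.

End hardy_constant.

(** * From vanishing integrals to almost everywhere statements *)

Section almost_everywhere_zero.
Context {R : realType}.
Local Open Scope ereal_scope.

Lemma ae_eq0_ge0 {d : measure_display} {T : measurableType d}
    (mu : {measure set T -> \bar R}) (f : T -> \bar R) :
  measurable_fun setT f -> (forall x, 0 <= f x) -> \int[mu]_x f x = 0 ->
  {ae mu, forall x, f x = 0}.
Proof.
move=> mf f0 If0; have /(ae_eq_integral_abs mu measurableT mf) h : \int[mu]_x `|f x| = 0.
  by rewrite -[RHS]If0; apply: eq_integral => x _; rewrite gee0_abs.
by apply: filterS h => x /(_ I).
Qed.

Lemma ae_eq0_real {d : measure_display} {T : measurableType d}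
    (mu : {measure set T -> \bar R}) (f : T -> R) :
  measurable_fun setT f -> (forall x, 0 <= f x)%R -> \int[mu]_x (f x)%:E = 0 ->
  {ae mu, forall x, f x = 0%R}.
Proof.
move=> mf f0 If0; have : {ae mu, forall x, (f x)%:E = 0}.
  apply: ae_eq0_ge0 If0; first by msr.
  by move=> x; rewrite lee_fin.
by apply: filterS => x [].
Qed.

Lemma ae_eq0_prod {d1 d2 : measure_display} {T1 : measurableType d1}
    {T2 : measurableType d2} (m1 : {sigma_finite_measure set T1 -> \bar R})
    (m2 : {sigma_finite_measure set T2 -> \bar R}) (f : T1 * T2 -> R) :
  measurable_fun setT f -> (forall z, 0 <= f z)%R -> \int[m1 \x m2]_z (f z)%:E = 0 ->
  {ae m1, forall x, {ae m2, forall y, f (x, y) = 0%R}}.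
Proof.
move=> mf f0; rewrite integral_prod_real// => If0.
have : {ae m1, forall x, \int[m2]_y (f (x, y))%:E = 0}.
  apply: ae_eq0_ge0 If0; last by move=> x; exact: integral_ge0_real.
  apply: (measurable_integral_real m2 (f := fun x y => f (x, y))) => //.
  by apply: (measurable_fun_comp mf); msr.
apply: filterS => x; apply: ae_eq0_real => //.
by apply: (measurable_fun_comp mf); msr.
Qed.

End almost_everywhere_zero.

(** * Divergence of dt/t, and the mass of the boundary directions *)

Section divergent_integrals.
Context {R : realType}.
Local Notation leb := (@lebesgue_measure R).
Local Notation rvl := (rV_lebesgue R).

(** By scale invariance of dt/t, t -> 2t gives X = X + c, with c > 0 the integral over ]a/2, a];
    hence X is infinite. *)
Lemma integral_harmonic_pinfty (a : R) : 0 < a ->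
  (\int[leb]_t ((a < t)%R%:R * t^-1)%:E = +oo)%E.
Proof.
move=> a0; have gt0 (b t : R) : 0 < b -> 0 <= (b < t)%R%:R * t^-1.
  move=> b0; case: (ltP b t) => h; rewrite ?mul0r// mul1r invr_ge0 ltW//.
  exact: lt_trans h.
have a20 : 0 < a / 2 by rewrite divr_gt0.
set X := (\int[leb]_t _)%E.
have X0 : (0 <= X)%E by apply: integral_ge0_real => t; exact: gt0.
have : (X = X + \int[leb]_t (((a / 2 < t) && (t <= a))%R%:R * t^-1)%:E)%E.
  rewrite -integralD_real; last 4 first.
  - by msr.
  - by msr.
  - by move=> t; exact: gt0.
  - move=> t; case: (boolP (_ && _)) => [/andP[h _]|_]; rewrite ?mul0r// mul1r.
    by rewrite invr_ge0 ltW// (lt_trans _ h).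
  rewrite {1}/X (@ge0_integral_scale _ (fun t => ((a < t)%R%:R * t^-1)%:E) 2)//; last 2 first.
  - by msr.
  - by move=> t; rewrite lee_fin; exact: gt0.
  rewrite -(@integralZl_real _ _ _ leb 2); last 3 first.
  - by [].
  - by msr.
  - move=> t; case: (ltP a (2 * t)) => h; rewrite ?mul0r// mul1r invr_ge0 ltW//.
    exact: lt_trans h.
  apply: eq_integral => t _; congr EFin.
  have -> : (a < 2 * t) = (a / 2 < t) by rewrite ltr_pdivrMr// mulrC.
  rewrite -mulrDl mulrCA -natrD; case: (ltP (a / 2) t) => h.
    have t0 : t != 0 by rewrite gt_eqF// (lt_trans _ h).
    by rewrite /= ltNge; case: (t <= a); rewrite /= !mul1r; field.
  by rewrite ltNge (le_trans h)/= ?mul0r//; lra.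
set c := (\int[leb]_t _)%E => e.
have c0 : (0 < c)%E.
  (* On [2a/3, a], which lies inside ]a/2, a], the integrand is at least 1/a. *)
  apply: (@lt_le_trans _ _ (a^-1 * (a - 2 / 3 * a))%:E).
    by rewrite lte_fin mulr_gt0 ?invr_gt0//; lra.
  rewrite EFinM -integral_boolr_itv; last by lra.
  rewrite -integralZl_real ?invr_ge0 ?(ltW a0)//; last by msr.
  apply: le_integral_real; try mpos.
  move=> t; case: (boolP ((2 / 3 * a <= t) && (t <= a))) => [/andP[h1 h2]|_].
      have t0 : 0 < t by lra.
      have -> : a / 2 < t by lra.
      by rewrite h2 mulr1 mul1r lef_pV2 ?posrE.
    rewrite mulr0; case: (boolP (_ && _)) => [/andP[h _]|_]; rewrite ?mul0r// mul1r.
    by rewrite invr_ge0 ltW// (lt_trans _ h).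
case: X X0 e => [x|//|//] x0 e.
have : (x%:E < x%:E + c)%E by rewrite lteDl.
by rewrite -e ltxx.
Qed.

Lemma integral_harmonic_zero (a : R) : 0 < a ->
  (\int[leb]_t (((0 < t) && (t < a))%R%:R * t^-1)%:E = +oo)%E.
Proof.
move=> a0; have ai : 0 < a^-1 by rewrite invr_gt0.
rewrite -(integral_harmonic_pinfty ai).
transitivity (\int[leb]_t ((0 < t)%R%:R * ((0 < t)%R%:R * ((t < a)%R%:R * t^-1)))%:E)%E.
  apply: eq_integral => t _; congr EFin.
  by case: (0 < t); case: (t < a); rewrite /= ?(mul1r, mul0r).
rewrite (integral_inversion (F := fun t => (0 < t)%R%:R * ((t < a)%R%:R * t^-1))); last 2 first.
- by msr.
- move=> t; case: (ltP 0 t) => t0; rewrite ?mul0r// mul1r mulr_ge0// invr_ge0 ltW//.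
apply: eq_integral => t _; congr EFin.
have [t0|t0] := ltP 0 t; last by rewrite mul0r ltNge (le_trans t0) ?mul0r// ltW.
rewrite invr_gt0 t0 !mul1r invrK -mulrA.
have -> : (t^-1 < a) = (a^-1 < t) by rewrite -[in LHS](invrK a) ltf_pV2 ?posrE.
by congr (_ * _); field; rewrite gt_eqF.
Qed.

(** This dichotomy separates N = 1 from N >= 2 when p = 1: a strip along the boundary has infinite
    measure only in the second case. *)
Lemma rV_lebesgue_setT n : (rvl n setT = if n is 0 then 1 else +oo)%E.
Proof.
elim: n => [|n ih]; first exact: diracT.
have h : (\int[rvl n.+1]_x (1%:E) = rvl n.+1 setT)%E by rewrite integral_cst// mul1e.
rewrite -h integral_rcons_swap//.
transitivity (\int[leb]_t (rvl n setT))%E.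
  by apply: eq_integral => t _; rewrite integral_cst// mul1e.
rewrite integral_cst//= (_ : leb setT = +oo)%E.
  by rewrite ih; case: n {ih h} => [|n]; rewrite ?mul1e// mulyy.
by rewrite -set_itvNyy lebesgue_measure_itv.
Qed.

Lemma rV_lebesgue_setT_gt0 n : (0 < rvl n setT)%E.
Proof. by rewrite rV_lebesgue_setT; case: n. Qed.

Lemma integral_of_lastc n (phi : R -> R) : measurable_fun setT phi ->
  (forall t, 0 <= phi t) ->
  (\int[rvl n.+1]_x (phi (lastc x))%:E = rvl n setT * \int[leb]_t (phi t)%:E)%E.
Proof.
move=> mphi phi0; have ml := @measurable_lastc R n.
rewrite integral_rcons_swap; last 2 first.
- by msr.
- by move=> x.
rewrite muleC -ge0_integralZr_setT; last 3 first.
- by msr.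
- by move=> t; rewrite lee_fin.
- by [].
apply: eq_integral => t _.
have e y : lastc (@rV_rcons R n (y, t)) = t by rewrite /lastc rV_rcons_max.
by under eq_integral do rewrite e; rewrite integral_cst.
Qed.

End divergent_integrals.

(** * Consequences of a vanishing deficit, p > 1 *)

Section vanishing_deficit.
Context {R : realType} (n : nat) (p s : R).
Hypotheses (p1 : 1 <= p) (s0 : 0 < s) (s1 : s < 1) (ps1 : p * s != 1).
Local Notation leb := (@lebesgue_measure R).
Local Notation mu := (rV_lebesgue R n.+1).
Local Notation V := ('rV[R]_n.+1).
Local Notation sg := (p * s).

Lemma kern_gt0 (x y : V) : lastc x != lastc y -> 0 < kern sg x y.
Proof.
move=> xy; rewrite powR_gt0// /sqdist (bigD1 ord_max)//= ltr_pwDl//.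
  by rewrite exprn_even_gt0//= subr_eq0.
by apply: sumr_ge0 => i _; exact: sqr_ge0.
Qed.

Definition deficit_integrand (u : V -> R) (z : V * V) : R :=
  hs z.1 * hs z.2 * ((side p s (lastc z.2 / lastc z.1))%:R *
      gs_deficit p s u z * kern sg z.1 z.2).

Lemma measurable_deficit_integrand u : measurable_fun setT u ->
  measurable_fun setT (deficit_integrand u).
Proof.
move=> mu_; have mh := @measurable_hs R n; have ml := @measurable_lastc R n.
have mk := @measurable_kern R n sg; have ms := @measurable_side R p s.
have mg := @measurable_gs_deficit R n p s u mu_.
by rewrite /deficit_integrand; msr.
Qed.

Lemma deficit_integrand_ge0 u z : 0 <= deficit_integrand u z.
Proof.
apply: (mulr_ge0 _ (mulr_ge0 _ (kern_ge0 _ _ _))); first by rewrite mulr_ge0 ?hs_ge0.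
have [h|h] := boolP (side p s (lastc z.2 / lastc z.1)); last by rewrite mul0r.
by rewrite mul1r gs_deficit_ge0.
Qed.

Lemma deficit_integrand_eq0 u x y : 0 < lastc x -> 0 < lastc y ->
  side p s (lastc y / lastc x) -> deficit_integrand u (x, y) = 0 ->
  deficit p (ratio p s (lastc y / lastc x)) (u x) (u y) = 0.
Proof.
move=> x0 y0 sxy; rewrite /deficit_integrand/= (hs1 x0) (hs1 y0) sxy !mul1r => /eqP.
rewrite mulf_eq0 => /orP[/eqP//|]; rewrite gt_eqF// kern_gt0//.
apply/negP => /eqP e; have := side_neq1 sxy.
by rewrite e divff ?eqxx// gt_eqF.
Qed.

Lemma vanishing_deficit_fst (u : V -> R) : measurable_fun setT u -> one_sided_deficit p s u = 0%E ->
  {ae mu, forall x, 0 < lastc x -> {ae mu, forall y, 0 < lastc y ->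
     side p s (lastc y / lastc x) ->
     deficit p (ratio p s (lastc y / lastc x)) (u x) (u y) = 0}}.
Proof.
move=> mu_ h; have := ae_eq0_prod (measurable_deficit_integrand mu_)
  (deficit_integrand_ge0 u) h.
apply: filterS => x hx x0; apply: filterS hx => y + y0 sxy.
exact: deficit_integrand_eq0.
Qed.

(** The same null set sliced in the other variable; for p = 1 it is the upper point that gets
    fixed. *)
Lemma vanishing_deficit_snd (u : V -> R) : measurable_fun setT u -> one_sided_deficit p s u = 0%E ->
  {ae mu, forall y, 0 < lastc y -> {ae mu, forall x, 0 < lastc x ->
     side p s (lastc y / lastc x) ->
     deficit p (ratio p s (lastc y / lastc x)) (u x) (u y) = 0}}.
Proof.
move=> mu_ h; have md := measurable_deficit_integrand mu_.
have d0 := deficit_integrand_ge0 u.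
have md' : measurable_fun setT (fun z : V * V => deficit_integrand u (z.2, z.1)) by msr.
have h' : (\int[mu \x mu]_z (deficit_integrand u (z.2, z.1))%:E = 0)%E.
  by rewrite -(integral_prod_swap md d0).
have := ae_eq0_prod md' (fun z => d0 (z.2, z.1)) h'.
apply: filterS => y hy y0; apply: filterS hy => x + x0 sxy.
exact: deficit_integrand_eq0.
Qed.

Lemma hardy_mass_pinfty (u : V -> R) (phi : R -> R) : measurable_fun setT u ->
  measurable_fun setT phi -> (forall t, 0 <= phi t) ->
  {ae mu, forall y, 0 < lastc y -> phi (lastc y) <= `|u y| `^ p * lastc y `^ (- sg)} ->
  (rV_lebesgue R n setT * \int[leb]_t ((0 < t)%R%:R * phi t)%:E = +oo)%E ->
  (hardy_mass p s u = +oo)%E.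
Proof.
move=> mu_ mphi phi0 hle hoo; have mh := @measurable_hs R n; have ml := @measurable_lastc R n.
apply/eqP; rewrite -leye_eq -hoo -integral_of_lastc; try mpos.
apply: ae_ge0_le_integral => //.
- by move=> x _; pos.
- by msr.
- by move=> x _; pos; exact: hs_ge0.
- by msr.
apply: filterS hle => x hx _; rewrite lee_fin.
have [x0|x0] := ltP 0 (lastc x); last by rewrite mul0r (hs0 x0) mul0r.
by rewrite (hs1 x0) !mul1r hx.
Qed.

(** If u is nonzero at one generic x, it is a multiple of [omega] almost everywhere on the side of
    x. There |u|^p y_N^(-sg) = [C] / y_N, whose integral diverges at infinity or at 0 according to
    the sign of alpha. *)
Lemma vanishing_deficit_p_gt1 (u : V -> R) : 1 < p -> measurable_fun setT u ->
  (hardy_mass p s u < +oo)%E -> one_sided_deficit p s u = 0%E ->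
  {ae mu, forall x, 0 < lastc x -> u x = 0}.
Proof.
move=> pgt1 mu_ hfin /(vanishing_deficit_fst mu_); apply: filterS => x hx x0.
apply: contrapT => /eqP ux0; move: (hx x0) => {}hx.
suff : hardy_mass p s u = +oo%E by move=> e; rewrite e in hfin.
pose a := lastc x; pose C := `|u x| `^ p * a `^ (1 - sg).
have C0 : 0 < C by rewrite mulr_gt0 ?powR_gt0// normr_gt0.
have ms := @measurable_side R p s.
(* The absolute value keeps the comparison function nonnegative at every real t. *)
apply: (hardy_mass_pinfty (phi := fun t => (side p s (t / a))%:R * (C * `|t^-1|))) => //.
- by msr.
- by move=> t; pos.
- apply: filterS hx => y hy y0; have [sy|sy] := boolP (side p s (lastc y / a)); last first.
    by rewrite mul0r; pos.
  have q0 := side_gt0 sy.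
  have /= := deficit_eq0 pgt1 (ratio_gt0 p s q0) (side_ratio_lt1 p1 ps1 sy) (hy y0 sy).
  move=> ->; rewrite mul1r normrM powRM// (gtr0_norm (ratio_gt0 p s q0)) (gtr0_norm (x := (_)^-1)) ?invr_gt0//.
  rewrite /C /ratio -powRrM mulNr alphap// powRM ?invr_ge0 ?(ltW y0) ?(ltW x0)//.
  rewrite -!(powR_inv1 (ltW y0)) -(powR_inv1 (ltW x0)) -powRrM.
  rewrite (_ : -1 * - (1 - sg) = 1 - sg); last by ring.
  rewrite -/a [leRHS]mulrC !mulrA -powRD ?(gt_eqF y0) ?implybT//.
  rewrite (_ : - sg + - (1 - sg) = -1); last by ring.
  by rewrite le_eqVlt; apply/orP; left; apply/eqP; ring.
- rewrite [X in (_ * X)%E](_ : _ = +oo%E); first by rewrite gt0_muley// rV_lebesgue_setT_gt0.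
  transitivity (\int[leb]_t (C * (((0 < t) && side p s (t / a))%R%:R * `|t^-1|))%:E)%E.
    apply: eq_integral => t _; congr EFin.
    by rewrite -mulnb natrM; ring.
  rewrite integralZl_real ?(ltW C0)//; last by msr.
  suff -> : (\int[leb]_t (((0 < t) && side p s (t / a))%R%:R * `|t^-1|)%:E = +oo)%E.
    by rewrite gt0_muley// lte_fin.
  have a0 : 0 < a by [].
  rewrite /side; case: (0 < alpha p s).
    rewrite -[RHS](integral_harmonic_pinfty a0); apply: eq_integral => t _; congr EFin.
    rewrite ltr_pdivlMr// mul1r; case: (ltP a t) => at_; last by rewrite andbF !mul0r.
    by rewrite (lt_trans a0 at_)/= gtr0_norm// invr_gt0 (lt_trans a0 at_).
  rewrite -[RHS](integral_harmonic_zero a0); apply: eq_integral => t _; congr EFin.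
  have [t0|t0] := ltP 0 t; last by rewrite /= !mul0r.
  by rewrite divr_gt0//= ltr_pdivrMr// mul1r gtr0_norm// invr_gt0.
Qed.

Lemma deficit_p1 (t A B : R) : 0 < t -> t < 1 -> deficit 1 t A B = 0 -> `|A| = `|A - B| + `|B|.
Proof.
move=> t0 t1 /eqP; rewrite /deficit subrr !powRr0 !mul1r !powRr1// subr_eq0 => /eqP.
by move=> ->.
Qed.

End vanishing_deficit.

(** Each equality places a, respectively b, between 0 and c, which is impossible for opposite
    signs. *)
Lemma opposite_sides_absurd {R : realType} (a b c : R) : a < 0 -> 0 < b ->
  `|c| = `|c - a| + `|a| -> `|c| = `|c - b| + `|b| -> False.
Proof.
move=> a0 b0; rewrite (ltr0_norm a0) (gtr0_norm b0).
by case: (ger0P c) => c0; case: (ger0P (c - a)) => ?; case: (ger0P (c - b)) => ?; lra.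
Qed.

(** * Consequences of a vanishing deficit, p = 1 *)

Section vanishing_deficit_p1.
Context {R : realType} (n : nat) (s : R).
Hypotheses (s0 : 0 < s) (s1 : s < 1).
Local Notation leb := (@lebesgue_measure R).
Local Notation mu := (rV_lebesgue R n.+1).
Local Notation V := ('rV[R]_n.+1).
Implicit Types (x y : V) (u : V -> R).

Let ps1 : 1 * s != 1. Proof. by rewrite mul1r lt_eqF. Qed.

Lemma side_p1 r : side 1 s r = (1 < r).
Proof. by rewrite /side /alpha mul1r divr1 subr_gt0 s1. Qed.

Lemma side_p1_quotient x y : 0 < lastc x -> side 1 s (lastc y / lastc x) = (lastc x < lastc y).
Proof. by move=> x0; rewrite side_p1 ltr_pdivlMr// mul1r. Qed.

Lemma vanishing_deficit_p1 u : measurable_fun setT u -> one_sided_deficit 1 s u = 0%E ->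
  {ae mu, forall y, 0 < lastc y -> {ae mu, forall x, 0 < lastc x -> lastc x < lastc y ->
     `|u x| = `|u x - u y| + `|u y|}} /\
  {ae mu, forall x, 0 < lastc x -> {ae mu, forall y, 0 < lastc y -> lastc x < lastc y ->
     `|u x| = `|u x - u y| + `|u y|}}.
Proof.
have aux x y : 0 < lastc x -> lastc x < lastc y ->
    deficit 1 (ratio 1 s (lastc y / lastc x)) (u x) (u y) = 0 ->
    `|u x| = `|u x - u y| + `|u y|.
  move=> x0 xy; have sxy : side 1 s (lastc y / lastc x) by rewrite side_p1_quotient.
  apply: deficit_p1; first exact/ratio_gt0/(side_gt0 sxy).
  exact: side_ratio_lt1 sxy.
move=> mu_ h; split.
- have := vanishing_deficit_snd (lexx 1) ps1 mu_ h.
  apply: filterS => y hy y0; apply: filterS (hy y0) => x hx x0 xy.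
  by apply: aux => //; apply: hx => //; rewrite side_p1_quotient.
- have := vanishing_deficit_fst (lexx 1) ps1 mu_ h.
  apply: filterS => x hx x0; apply: filterS (hx x0) => y hy y0 xy.
  by apply: aux => //; apply: hy => //; rewrite side_p1_quotient.
Qed.

(** A generic y with u(y) nonzero forces |u| >= |u(y)| almost everywhere below y, on a strip of
    infinite measure where the weight is bounded below. *)
Lemma vanishing_deficit_p1_multidim u : (0 < n)%N -> measurable_fun setT u ->
  (hardy_mass 1 s u < +oo)%E -> one_sided_deficit 1 s u = 0%E ->
  {ae mu, forall x, 0 < lastc x -> u x = 0}.
Proof.
move=> n0 mu_ hfin /(vanishing_deficit_p1 mu_)[+ _]; apply: filterS => y hy y0.
apply: contrapT => /eqP uy0; move: (hy y0) => {}hy.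
suff : hardy_mass 1 s u = +oo%E by move=> e; rewrite e in hfin.
pose a := lastc y; pose C := `|u y| * a `^ (- s).
have C0 : 0 < C by rewrite mulr_gt0 ?powR_gt0// normr_gt0.
apply: (hardy_mass_pinfty (phi := fun t => (t < a)%R%:R * C)) => //.
- by msr.
- by move=> t; pos.
- apply: filterS hy => x hx x0; have [xa|xa] := ltP (lastc x) a; last first.
    by rewrite mul0r; pos.
  rewrite !mul1r powRr1//; apply: ler_pM; [exact: normr_ge0|exact: powR_ge0| |].
    by rewrite (hx x0 xa) lerDr.
  by apply: ler_powR_le0; rewrite ?oppr_le0 ?(ltW s0)// ltW.
- rewrite rV_lebesgue_setT; case: n n0 => [//|m _]; rewrite gt0_mulye//.
  have Ipos : (0 < \int[leb]_t ((0 < t)%R%:R * ((t < a)%R%:R * C))%:E)%E.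
    apply: (@lt_le_trans _ _ (C * (a / 2 - a / 3))%:E).
      by rewrite lte_fin mulr_gt0//; rewrite /a; lra.
    rewrite EFinM -integral_boolr_itv; last by rewrite /a; lra.
    rewrite -integralZl_real ?(ltW C0)//; last by msr.
    apply: le_integral_real; try mpos.
    move=> t; case: (boolP ((a / 3 <= t) && (t <= a / 2))) => [/andP[h1 h2]|_]; last first.
      by rewrite mulr0; pos.
    have -> : 0 < t by apply: lt_le_trans h1; rewrite divr_gt0.
    have -> : t < a by apply: le_lt_trans h2 _; rewrite /a; lra.
    by rewrite !mul1r mulr1.
  exact: Ipos.
Qed.

(** A strip has positive measure, so it is not contained in a null set. *)
Lemma exists_in_strip (P : V -> Prop) (a b : R) : a < b -> {ae mu, forall x, P x} ->
  exists z, [/\ a < lastc z, lastc z < b & P z].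
Proof.
move=> ab hP; apply: contrapT => nex.
pose phi (t : R) : R := ((a < t) && (t < b))%R%:R.
have mphi : measurable_fun setT phi by rewrite /phi; msr.
have ml := @measurable_lastc R n.
have h0 : (\int[mu]_x (phi (lastc x))%:E = \int[mu]_x (cst 0 x))%E.
  apply: ae_eq_integral => //; first by msr.
  apply: filterS hP => x Px _; rewrite /phi; case: (boolP (_ && _)) => // /andP[xa xb].
  by exfalso; apply: nex; exists x.
rewrite integral0 in h0.
have /eqP := integral_of_lastc n mphi (fun t => ler0n _ _).
rewrite h0 eq_sym mule_eq0 gt_eqF ?rV_lebesgue_setT_gt0//= => /eqP e.
have : (((b - a) / 3)%:E <= \int[leb]_t (phi t)%:E)%E.
  have -> : (b - a) / 3 = (a + (b - a) / 3 * 2) - (a + (b - a) / 3) by field.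
  rewrite -integral_boolr_itv; last by lra.
  apply: le_integral_real => //; first by msr.
  move=> t; rewrite /phi ler_nat.
  case: (boolP (_ && _)) => // /andP[h1 h2].
  have -> : a < t by lra.
  by have -> : t < b by lra.
by rewrite e lee_fin; lra.
Qed.

(* On a conull set [u] is, up to sign, non-increasing; [g] is its upper envelope. *)
Lemma vanishing_deficit_p1_monotone u : n = 0%N -> measurable_fun setT u ->
  one_sided_deficit 1 s u = 0%E ->
  exists (c : R) (g : R -> R), (forall a b, 0 < a -> a <= b -> g b <= g a) /\
    {ae mu, forall x, 0 < lastc x -> u x = c * g (lastc x)}.
Proof.
move=> n0 mu_ /(vanishing_deficit_p1 mu_)[hbelow habove].
(* In dimension one the last coordinate is the only one. *)
have ext x y : lastc x = lastc y -> x = y.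
  move=> e; apply/rowP => i; have -> : i = ord_max; last exact: e.
  apply/val_inj/eqP; rewrite /= eqn_leq -ltnS ltn_ord/=.
  by apply: leq_trans (leq0n i); rewrite n0.
pose good x := {ae mu, forall z, 0 < lastc z -> lastc z < lastc x ->
     `|u z| = `|u z - u x| + `|u x|} /\
   {ae mu, forall z, 0 < lastc z -> lastc x < lastc z ->
     `|u x| = `|u x - u z| + `|u z|}.
have ae_good : {ae mu, forall x, 0 < lastc x -> good x}.
  by apply: filterS2 hbelow habove => x h1 h2 x0; split; [exact: h1|exact: h2].
(* The pair itself may be exceptional, so both points are compared with a third one between them
   that is generic for each. *)
have mono x y : good x -> good y -> 0 < lastc x -> lastc x <= lastc y -> `|u y| <= `|u x|.
  move=> [_ gx] [gy _] x0; rewrite le_eqVlt => /orP[/eqP/ext -> //|xy].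
  have [z [xz zy [h1 h2]]] := exists_in_strip xy (filterI gx gy).
  have z0 := lt_trans x0 xz.
  rewrite (h1 z0 xz) (h2 z0 zy) addrA lerDr addr_ge0//.
(* [e] is the common sign: a positive and a negative good value would contradict each other at a
   generic point below both. *)
have [e [e1 he]] : exists e : R, e * e = 1 /\ forall x, good x -> 0 < lastc x -> `|u x| = e * u x.
  have [[y [gy y0 uy]]|none] := pselect (exists y, [/\ good y, 0 < lastc y & 0 < u y]).
    exists 1; rewrite mulr1; split => // x gx x0; rewrite mul1r.
    have [/ger0_norm//|ux] := leP 0 (u x).
    have m0 : 0 < Num.min (lastc x) (lastc y) by rewrite lt_min x0.
    have [z [z0 zm [h1 h2]]] := exists_in_strip m0 (filterI gx.1 gy.1).
    move: zm; rewrite lt_min => /andP[zx zy].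
    by exfalso; exact: (opposite_sides_absurd ux uy (h1 z0 zx) (h2 z0 zy)).
  exists (- 1); rewrite mulrNN mulr1; split => // x gx x0; rewrite mulN1r ler0_norm//.
  by rewrite leNgt; apply/negP => ux; apply: none; exists x.
pose S a : set R := [set `|u y| | y in [set y | [/\ good y, 0 < lastc y & a <= lastc y]]].
have exgood a b : 0 <= a -> a < b -> exists z, [/\ a < lastc z, lastc z < b & good z].
  move=> a0 ab; have [z [az zb gz]] := exists_in_strip ab ae_good.
  by exists z; split => //; apply: gz; exact: le_lt_trans az.
have S0 a : 0 < a -> S a !=set0.
  move=> a0; have a1 : a < a + 1 by rewrite ltrDl.
  have [z [az _ gz]] := exgood a (a + 1) (ltW a0) a1.
  by exists `|u z|, z => //; split => //; [exact: lt_trans az|exact: ltW].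
(* A good point strictly between 0 and a exists, and by [mono] its value bounds all those at or
   above a. *)
have Sub a : 0 < a -> has_ubound (S a).
  move=> a0; have [w [w0 wa gw]] := exgood 0 a (lexx 0) a0.
  exists `|u w| => _ [y [gy y0 ay] <-]; apply: mono => //.
  by apply: ltW; exact: lt_le_trans ay.
exists e, (fun a => sup (S a)); split.
  move=> a b a0 ab; apply: sup_le_ub; first exact: S0 (lt_le_trans a0 ab).
  move=> _ [y [gy y0 bly] <-]; apply: ub_le_sup; first exact: Sub.
  by exists y => //; split => //; exact: le_trans bly.
apply: filterS ae_good => x gx x0; have {}gx := gx x0.
have -> : sup (S (lastc x)) = `|u x|.
  apply/eqP; rewrite eq_le; apply/andP; split.
    apply: sup_le_ub; first exact: S0.
    by move=> _ [y [gy y0 xy] <-]; exact: mono.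
  by apply: ub_le_sup; [exact: Sub|exists x].
by rewrite he// mulrA e1 mul1r.
Qed.

End vanishing_deficit_p1.

(** * Continuous functions are measurable for the product sigma-algebra *)

Section borel_row_vectors.
Context {R : realType} (n : nat).

Lemma rV_ballP (x y : 'rV[R]_n) (e : R) : 0 < e ->
  ball x e y <-> forall i, `|x ord0 i - y ord0 i| < e.
Proof.
move=> e0; split => [[_ xy] i|xy]; first exact: (xy ord0 i).
by split => // i j; rewrite ord1; exact: xy.
Qed.

(** An open set is the union of the boxes it contains with rational centre and half-side 1/(k+1), a
    countable family. *)
Lemma open_measurable_rV (U : set 'rV[R]_n) : open U -> measurable U.
Proof.
move=> oU.
pose box (qk : 'rV[rat]_n * nat) : set 'rV[R]_n :=
  [set x | forall i, `|ratr (qk.1 ord0 i) - x ord0 i| < qk.2.+1%:R^-1].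
have mbox qk : measurable (box qk).
  (* Membership in the box is encoded as a product of 0/1 factors being 1, a form whose
     measurability follows from the rules above. *)
  pose b (x : 'rV[R]_n) : bool :=
    \prod_i (`|ratr (qk.1 ord0 i) - x ord0 i| < qk.2.+1%:R^-1)%R%:R == 1 :> R.
  have mb : measurable_fun setT b by rewrite /b; msr.
  have := mb measurableT [set true] I; rewrite setTI; congr measurable.
  apply/seteqP; split => x; rewrite /box /b /=.
    move/eqP => h i; apply: contrapT => /negP hi.
    by move: h; rewrite (bigD1 i)//= (negbTE hi) mul0r => /eqP; rewrite eq_sym oner_eq0.
  by move=> h; apply/eqP; apply: big1 => i _; rewrite h.
pose F (qk : 'rV[rat]_n * nat) := if pselect (box qk `<=` U) then box qk else set0.
rewrite (_ : U = \bigcup_qk F qk); last first.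
  apply/seteqP; split => [x Ux|x [qk _]]; last first.
    by rewrite /F; case: pselect => // h /h.
  have /nbhs_ballP[e /= e0 xeU] : nbhs x U by exact: open_nbhs_nbhs.
  have [k hk] : exists k : nat, k.+1%:R^-1 < e / 2 :> R.
    exists (Num.truncn (e / 2)^-1); rewrite -[ltRHS]invrK ltf_pV2 ?posrE ?invr_gt0 ?divr_gt0//.
    exact: truncnS_gt.
  have hq i : exists q : rat, `|ratr q - x ord0 i| < k.+1%:R^-1.
    have hlt : x ord0 i - k.+1%:R^-1 < x ord0 i + k.+1%:R^-1.
      by rewrite ltrBlDr -addrA ltrDl addr_gt0.
    have [q] := rat_in_itvoo hlt.
    by rewrite in_itv/= => /andP[h1 h2]; exists q; rewrite ltr_distl h1 h2.
  pose q : 'rV[rat]_n := \row_i projT1 (cid (hq i)).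
  exists (q, k); first by [].
  rewrite /F; case: (pselect _) => [bU|[]].
    by move=> i /=; rewrite /q mxE; exact: (projT2 (cid (hq i))).
  move=> y hy; apply: xeU; apply/(rV_ballP _ _ e0) => i.
  have := hy i; rewrite /= /q mxE; case: cid => /= r hr hr2.
  have -> : x ord0 i - y ord0 i = - (ratr r - x ord0 i) + (ratr r - y ord0 i) by ring.
  apply: (le_lt_trans (ler_normD _ _)); rewrite normrN.
  have -> : e = e / 2 + e / 2 by field.
  by apply: ltrD; [exact: lt_trans hr hk|exact: lt_trans hr2 hk].
apply: countable_bigcupT_measurable; first exact: countableP.
move=> qk; rewrite /F; case: (pselect _) => h; [exact: mbox|exact: measurable0].
Qed.

Lemma continuous_measurable_rV (f : 'rV[R]_n -> R) : continuous f -> measurable_fun setT f.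
Proof.
move=> /continuousP cf; apply: (measurability _ (RGenOpens.measurableE R)).
move=> _ [_ [a [b ->]] <-]; rewrite setTI.
by apply: open_measurable_rV; apply: cf; exact: interval_open.
Qed.

End borel_row_vectors.

(** * Finiteness of the Hardy integral on W *)

Section half_space_functions.
Context {R : realType} (n : nat) (p s : R).
Hypotheses (p1 : 1 <= p) (s0 : 0 < s).
Local Notation mu := (rV_lebesgue R n.+1).
Local Notation V := ('rV[R]_n.+1).
Local Notation sg := (p * s).
Implicit Types (u v : V -> R).
Let p0 : 0 < p := p_gt0 p1.

Lemma eq_hardy_integral u v : (forall x, 0 < lastc x -> u x = v x) ->
  hardy_integral p s u = hardy_integral p s v.
Proof.
move=> uv; apply: eq_integral => x; rewrite inE => x0.
by rewrite uv.
Qed.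

Lemma eq_gagliardo u v : (forall x, 0 < lastc x -> u x = v x) ->
  gagliardo p s u = gagliardo p s v.
Proof.
move=> uv; apply: eq_integral => z; rewrite inE => -[x0 y0].
by rewrite !uv.
Qed.

(** [W_space] gives measurability on the half-space only, whereas the integral lemmas ask for it on
    the whole space. *)
Definition zero_ext u : V -> R := fun x => if 0 < lastc x then u x else 0.

Lemma zero_extE u x : 0 < lastc x -> u x = zero_ext u x.
Proof. by rewrite /zero_ext => ->. Qed.

Lemma measurable_zero_ext u : measurable_fun (@half_space R n) u ->
  measurable_fun setT (zero_ext u).
Proof.
have mH := @measurable_half_space R n.
move/(measurable_restrictT _ mH); apply: eq_measurable_fun => x _.
by rewrite patchE /zero_ext mem_setE unfold_in.
Qed.

Lemma hardy_mass_ge0 u : (0 <= hardy_mass p s u)%E.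
Proof. by apply: integral_ge0_real => x; pos; exact: hs_ge0. Qed.

(** The splitting inequality at t = 1/2, that is (a + b)^p <= 2^(p-1) (a^p + b^p). *)
Lemma hardy_integral_le2 u v : measurable_fun setT u -> measurable_fun setT v ->
  (hardy_integral p s (fun x => v x - u x)%R < +oo)%E -> (hardy_integral p s v < +oo)%E ->
  (hardy_integral p s u < +oo)%E.
Proof.
move=> mu_ mv; rewrite !hardy_integralE => h1 h2.
have mh := @measurable_hs R n; have ml := @measurable_lastc R n.
have h0 := @hs_ge0 R n.
pose C : R := (2^-1) `^ (1 - p); have C0 : 0 <= C by exact: powR_ge0.
pose F1 x := hs x * (`|v x - u x| `^ p * lastc x `^ (- sg)).
pose F2 x := hs x * (`|v x| `^ p * lastc x `^ (- sg)).
have mF1 : measurable_fun setT F1 by rewrite /F1; msr.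
have mF2 : measurable_fun setT F2 by rewrite /F2; msr.
have F10 x : 0 <= F1 x by rewrite /F1; pos.
have F20 x : 0 <= F2 x by rewrite /F2; pos.
apply: (@le_lt_trans _ _ (\int[mu]_x (C * (F1 x + F2 x))%:E)%E).
  apply: le_integral_real; try mpos.
  move=> x; rewrite /F1 /F2.
  have -> : C * (hs x * (`|v x - u x| `^ p * lastc x `^ (- sg)) +
      hs x * (`|v x| `^ p * lastc x `^ (- sg))) =
    hs x * ((C * (`|v x - u x| `^ p + `|v x| `^ p)) * lastc x `^ (- sg)) by ring.
  apply: ler_wpM2l; first exact: h0.
  apply: ler_wpM2r; first exact: powR_ge0.
  have half : 1 - 2^-1 = 2^-1 :> R by field.
  have h20 : 0 < 2^-1 :> R by rewrite invr_gt0.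
  have h21 : 2^-1 < 1 :> R by lra.
  have := powR_split_le p1 h20 h21 (normr_ge0 (v x - u x)) (normr_ge0 (v x)).
  rewrite half -mulrDr.
  apply: le_trans; apply: (ge0_ler_powR (ltW p0)); rewrite ?nnegrE ?addr_ge0//.
  by rewrite distrC -{1}(subrK (v x) (u x)) ler_normD.
rewrite (integralZl_real mu C0); try mpos.
rewrite (integralD_real mu mF1 mF2 F10 F20).
apply: lte_mul_pinfty; [by rewrite lee_fin|by []|].
exact: (lte_add_pinfty h1 h2).
Qed.

(** Compactness of the support bounds u, keeps x_N away from 0 and confines the integral to a
    box. *)
Lemma test_function_hardy_lty u : test_function u -> (hardy_integral p s u < +oo)%E.
Proof.
move=> [smu cK KH]; have cu : continuous u by have [] := smu [::].
have mu_ := continuous_measurable_rV cu.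
have mh := @measurable_hs R n; have ml := @measurable_lastc R n.
have h0 := @hs_ge0 R n.
set K := closure _ in cK KH.
have supp x : u x != 0 -> K x by move=> ux; exact: subset_closure.
have clast : continuous (@lastc R n) by exact: coord_continuous.
have [[k Kk]|K0] := pselect (K !=set0); last first.
  rewrite hardy_integralE (_ : (\int[mu]_x _)%E = 0%E)//.
  apply: integral0_eq => x _; have -> : u x = 0.
    by apply: contrapT => /eqP/supp Kx; apply: K0; exists x.
  by rewrite normr0 powR0 ?gt_eqF// mul0r mulr0.
have [a] := EVT_min_rV (ex_intro _ k Kk) cK (continuous_subspaceT clast).
rewrite inE => Ka amin; have a0 : 0 < lastc a := KH _ Ka.
have cnu : continuous (fun x => `|u x|).
  by move=> x; apply: (@continuous_comp _ _ _ u Num.norm); [exact: cu|exact: norm_continuous].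
have [b _ bmax] := EVT_max_rV (ex_intro _ k Kk) cK (continuous_subspaceT cnu).
have [B [B0 HB]] : exists B : R, 0 < B /\ forall x, K x -> forall i, `|x ord0 i| <= B.
  have := compact_bounded cK; rewrite /bounded_near => -[M [_ HM]].
  pose B := Num.max M 0 + 1.
  have B0 : 0 < B by rewrite ltr_wpDl// le_max lexx orbT.
  exists B; split => // x Kx i.
  have /= xB : `|x| <= B.
    by apply: (HM _ _ x Kx); rewrite /B ltr_pwDr// le_max lexx.
  apply/ler_addgt0Pr => e e0; apply: ltW.
  have : ball (0 : V) (B + e) x.
    by rewrite mx_norm_ball /ball_/= sub0r normrN (le_lt_trans xB)// ltrDl.
  by move=> /(rV_ballP _ _ (addr_gt0 B0 e0))/(_ i); rewrite mxE sub0r normrN.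
(* The maximum of |u|^p times the weight at the lowest point of the support, where it is largest. *)
pose C := `|u b| `^ p * lastc a `^ (- sg); have C0 : 0 <= C by rewrite /C; pos.
pose phi (t : R) : R := ((- B <= t) && (t <= B))%R%:R.
have mphi : measurable_fun setT phi by rewrite /phi; msr.
have phi0 t : 0 <= phi t by exact: ler0n.
rewrite hardy_integralE.
apply: (@le_lt_trans _ _ (\int[mu]_x (C * \prod_i phi (x ord0 i))%:E)%E).
  apply: le_integral_real; try mpos.
  move=> x; have [ux|ux] := eqVneq (u x) 0.
    by rewrite ux normr0 powR0 ?gt_eqF// mul0r mulr0; pos.
  have Kx := supp _ ux; have x0 : 0 < lastc x := KH _ Kx.
  rewrite (hs1 x0) mul1r big1 ?mulr1; last first.
    by move=> i _; rewrite /phi -ler_norml HB.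
  apply: ler_pM; [exact: powR_ge0|exact: powR_ge0| |].
    by apply: (ge0_ler_powR (ltW p0)); rewrite ?nnegrE// bmax// inE.
  apply: ler_powR_le0 => //; last by apply: amin; rewrite inE.
  by rewrite oppr_le0 ltW// mulr_gt0.
rewrite (integralZl_real mu C0); try mpos.
rewrite (@integral_prod_coord _ n.+1 phi (B + B) mphi phi0); last first.
  by rewrite integral_boolr_itv ?opprK// ge0_cp// ltW.
by rewrite -EFinM ltry.
Qed.

(** A single approximant at Hardy distance below 1 is enough. *)
Lemma W_space_hardy_lty u : W_space p s u -> (hardy_integral p s u < +oo)%E.
Proof.
move=> [mu_ [phi [tphi _ cphi]]].
have [k hk] : exists k, (hardy_integral p s (fun x => phi k x - u x)%R < 1%:E)%E.
  have /fine_cvgP[] := cphi; move=> hfin hcvg.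
  have hlt := (@cvgrPdist_lt _ _ _ _ _ _ _).1 hcvg 1 ltr01.
  have [k [kf kl]] := filter_ex (filterI hfin (hlt _)); exists k.
  rewrite -(fineK kf) lte_fin; move: kl; rewrite sub0r normrN.
  by apply: le_lt_trans; exact: ler_norm.
rewrite (eq_hardy_integral (zero_extE u)).
have cphik : continuous (phi k) by have [/(_ [::])[]] := tphi k.
apply: (@hardy_integral_le2 (zero_ext u) (phi k)).
- exact: measurable_zero_ext.
- exact: continuous_measurable_rV.
- rewrite -(@eq_hardy_integral (fun x => phi k x - u x)).
    exact: lt_trans hk (ltry _).
  by move=> x x0; rewrite (zero_extE u x0).
- exact: test_function_hardy_lty.
Qed.

End half_space_functions.

(** * The inequality on W, and equality as vanishing deficit *)

Section hardy_inequality.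
Context {R : realType} (n : nat) (p s : R).
Hypotheses (p1 : 1 <= p) (s0 : 0 < s) (s1 : s < 1) (ps1 : p * s != 1).
Local Notation V := ('rV[R]_n.+1).
Local Notation D := (hardy_const n.+1 p s).
Implicit Types (u : V -> R).

Lemma one_sided_deficit_ge0 u : (0 <= one_sided_deficit p s u)%E.
Proof. by apply: integral_ge0_real => z; exact: (deficit_integrand_ge0 p1 ps1). Qed.

Lemma W_space_representation u : W_space p s u ->
  [/\ measurable_fun setT (zero_ext u), (hardy_mass p s (zero_ext u) < +oo)%E,
    (D%:E * hardy_integral p s u)%E \is a fin_num &
    (gagliardo p s u = D%:E * hardy_integral p s u +
       2%:E * one_sided_deficit p s (zero_ext u))%E].
Proof.
move=> Wu; have := W_space_hardy_lty p1 s0 Wu; case: Wu => mu_ _.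
have mz := measurable_zero_ext mu_.
rewrite (eq_hardy_integral p s (zero_extE u)) (eq_gagliardo p s (zero_extE u)) => hlt.
have hE := hardy_integralE p s (zero_ext u); split => //.
- by rewrite /hardy_mass -hE.
- rewrite fin_numM// ge0_fin_numE// hE; exact: hardy_mass_ge0.
- exact: ground_state_representation.
Qed.

Lemma W_space_hardy_le u : W_space p s u ->
  (D%:E * hardy_integral p s u <= gagliardo p s u)%E.
Proof.
move=> /W_space_representation[_ _ _ ->].
by rewrite leeDl// mule_ge0 ?one_sided_deficit_ge0.
Qed.

(** The Hardy term of the representation is finite and can be cancelled. *)
Lemma W_space_hardy_eq u : W_space p s u ->
  gagliardo p s u = (D%:E * hardy_integral p s u)%E <->
  one_sided_deficit p s (zero_ext u) = 0%E.
Proof.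
move=> /W_space_representation[_ _ fin ->]; split => [h|->]; last by rewrite mule0 adde0.
have : (2%:E * one_sided_deficit p s (zero_ext u) = 0)%E.
  by apply: (adde_fin_inj fin); rewrite add0e addeC.
by move/eqP; rewrite mule_eq0 => /orP[|/eqP//]; rewrite eqe pnatr_eq0.
Qed.

End hardy_inequality.

(** * Monotone functions attain equality when p = 1 *)

Section equality_p1.
Context {R : realType} (n : nat) (s : R).
Hypothesis s1 : s < 1.
Local Notation leb := (@lebesgue_measure R).
Local Notation mu := (rV_lebesgue R n.+1).
Local Notation V := ('rV[R]_n.+1).
Implicit Types (u : V -> R).

Let ps1 : 1 * s != 1. Proof. by rewrite mul1r lt_eqF. Qed.

Lemma vanishing_deficit_p1_of_ae u : measurable_fun setT u ->
  {ae mu, forall x, 0 < lastc x -> {ae mu, forall y, 0 < lastc y -> lastc x < lastc y ->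
     `|u x| = `|u x - u y| + `|u y|}} ->
  one_sided_deficit 1 s u = 0%E.
Proof.
move=> mu_ hae; have md := measurable_deficit_integrand 1 s mu_.
have d0 := deficit_integrand_ge0 (lexx 1) ps1 u.
rewrite /one_sided_deficit.
transitivity (\int[mu \x mu]_z (deficit_integrand 1 s u z)%:E)%E; first by [].
rewrite (integral_prod_real mu mu md d0).
transitivity (\int[mu]_x (cst 0%E x : \bar R))%E; last by rewrite integral_cst// mul0e.
apply: ae_eq_integral => //; first exact: measurable_integral_real.
apply: filterS hae => x hx _.
transitivity (\int[mu]_y (cst 0%E y : \bar R))%E; last by rewrite integral_cst// mul0e.
apply: ae_eq_integral => //; first by msr.
have [x0|x0] := ltP 0 (lastc x); last first.
  by apply: aeW => y _; rewrite /deficit_integrand /= (hs0 x0) !mul0r.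
apply: filterS (hx x0) => y hy _; rewrite /deficit_integrand /=.
have [y0|y0] := ltP 0 (lastc y); last by rewrite (hs0 y0) mulr0 !mul0r.
rewrite side_p1_quotient//; case: ltP => xy; last by rewrite !mul0r mulr0.
rewrite /gs_deficit /deficit /= subrr !powRr0 !mul1r !powRr1//.
by rewrite -(hy y0 xy) subrr mul0r mulr0.
Qed.

(** Beyond height 1 the weight x_N^(-s) dominates 1/x_N, since s < 1. *)
Lemma hardy_mass_pinfty_p1 u (K b : R) : 0 < K -> measurable_fun setT u ->
  {ae mu, forall x, 0 < lastc x -> b < lastc x -> K <= `|u x|} ->
  hardy_mass 1 s u = +oo%E.
Proof.
move=> K0 mu_ hae; pose b' := Num.max b 1.
have b'1 : 1 <= b' by rewrite le_max lexx orbT.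
have b'0 : 0 < b' by exact: lt_le_trans b'1.
apply: (hardy_mass_pinfty (phi := fun t => (b' < t)%R%:R * (K * `|t^-1|))) => //.
- by msr.
- by move=> t; have := ltW K0 => ?; pos.
- apply: filterS hae => x hx x0; have [bx|_] := ltP b' (lastc x); last by rewrite mul0r; pos.
  rewrite !mul1r powRr1//; apply: ler_pM; [exact: ltW|exact: normr_ge0| |].
    by apply: hx => //; apply: le_lt_trans bx; rewrite le_max lexx.
  rewrite gtr0_norm ?invr_gt0// powRN lef_pV2 ?posrE ?powR_gt0//.
  rewrite -[leRHS](powRr1 (ltW x0)) ler_powR ?(ltW s1)//.
  by rewrite (le_trans b'1)// ltW.
- rewrite [X in (_ * X)%E](_ : _ = +oo%E); first by rewrite gt0_muley// rV_lebesgue_setT_gt0.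
  transitivity (\int[leb]_t (K * ((b' < t)%R%:R * `|t^-1|))%:E)%E.
    apply: eq_integral => t _; congr EFin; case: (ltP b' t) => bt; last by rewrite !(mul0r, mulr0).
    by rewrite (lt_trans b'0 bt) !mul1r.
  rewrite integralZl_real ?(ltW K0)//; last by msr.
  rewrite [X in (_ * X)%E](_ : _ = +oo%E); first by rewrite gt0_muley// lte_fin.
  rewrite -[RHS](integral_harmonic_pinfty b'0); apply: eq_integral => t _; congr EFin.
  case: (ltP b' t) => bt; last by rewrite !mul0r.
  by rewrite gtr0_norm// invr_gt0 (lt_trans b'0 bt).
Qed.

(** A negative value of g would persist to infinity and make the Hardy integral infinite. With g >=
    0 and non-increasing, |g(a)| = |g(a) - g(b)| + |g(b)| for a < b. *)
Lemma vanishing_deficit_of_monotone u (c : R) (g : R -> R) : measurable_fun setT u ->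
  (hardy_mass 1 s u < +oo)%E ->
  (forall a b : R, 0 < a -> a <= b -> g b <= g a) ->
  {ae mu, forall x, 0 < lastc x -> u x = c * g (lastc x)} ->
  one_sided_deficit 1 s u = 0%E.
Proof.
move=> mu_ hfin gm hae; apply: vanishing_deficit_p1_of_ae => //.
have g0 b : 0 < b -> c != 0 -> 0 <= g b.
  move=> b0 c0; rewrite leNgt; apply/negP => gb.
  suff e : hardy_mass 1 s u = +oo%E by rewrite e in hfin.
  apply: (@hardy_mass_pinfty_p1 _ `|c * g b| b) => //.
    by rewrite normr_gt0 mulf_neq0// lt_eqF.
  apply: filterS hae => x hx x0 bx; rewrite (hx x0) !normrM ler_wpM2l//.
  have gx : g (lastc x) <= g b by apply: gm => //; exact: ltW.
  by rewrite !ltr0_norm ?lerN2// (le_lt_trans gx).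
apply: filterS (hae) => x hx x0; apply: filterS hae => y hy y0 xy.
rewrite (hx x0) (hy y0) -mulrBr !normrM.
have [->|c0] := eqVneq c 0; first by rewrite normr0 !mul0r addr0.
rewrite -mulrDr; congr (_ * _).
have gxy : g (lastc y) <= g (lastc x) by apply: gm => //; exact: ltW.
by rewrite !ger0_norm ?g0// ?subr_ge0// subrK.
Qed.

End equality_p1.

(** * The strict and the equality cases on W *)

Section equality_cases.
Context {R : realType} (n : nat) (p s : R).
Hypotheses (p1 : 1 <= p) (s0 : 0 < s) (s1 : s < 1) (ps1 : p * s != 1).
Local Notation mu := (rV_lebesgue R n.+1).
Local Notation V := ('rV[R]_n.+1).
Local Notation D := (hardy_const n.+1 p s).
Implicit Types (u : V -> R).

Lemma ae_zero_ext u (f : V -> R) :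
  {ae mu, forall x, 0 < lastc x -> zero_ext u x = f x} <->
  {ae mu, forall x, half_space x -> u x = f x}.
Proof.
split; apply: filterS => x h x0; first by rewrite (zero_extE u x0) h.
by rewrite -(zero_extE u x0) h.
Qed.

Lemma W_space_hardy_lt u : 1 < p \/ p = 1 /\ (2 <= n.+1)%N -> W_space p s u ->
  ~ {ae mu, forall x, half_space x -> u x = 0} ->
  (D%:E * hardy_integral p s u < gagliardo p s u)%E.
Proof.
move=> hp Wu nz; rewrite lt_neqAle W_space_hardy_le// andbT.
apply/negP => /eqP/esym/(W_space_hardy_eq p1 s0 s1 ps1 Wu) d0; apply: nz.
have [mz hfin _ _] := W_space_representation p1 s0 s1 ps1 Wu.
apply/(ae_zero_ext u (cst 0)).
case: hp => [pgt1|[pe n0]]; first exact: vanishing_deficit_p_gt1 mz hfin d0.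
rewrite pe in hfin d0.
exact: vanishing_deficit_p1_multidim mz hfin d0.
Qed.

Lemma W_space_hardy_eq_p1 u : p = 1 -> n.+1 = 1%N -> W_space p s u ->
  gagliardo p s u = (D%:E * hardy_integral p s u)%E <->
  exists (c : R) (g : R -> R), (forall a b : R, 0 < a -> a <= b -> g b <= g a) /\
    {ae mu, forall x, half_space x -> u x = c * g (x ord0 ord_max)}.
Proof.
move=> pe [n0] Wu; rewrite W_space_hardy_eq//.
have [mz hfin _ _] := W_space_representation p1 s0 s1 ps1 Wu.
rewrite pe in hfin *; split => [d0|[c [g [gm hae]]]].
  have [c [g [gm hae]]] := vanishing_deficit_p1_monotone s1 n0 mz d0.
  by exists c, g; split => //; apply/ae_zero_ext.
by apply: (vanishing_deficit_of_monotone s1 mz hfin gm); apply/ae_zero_ext; exact: hae.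
Qed.

End equality_cases.

(** * Smooth functions of one variable *)

Section smooth_line.
Context {R : realType}.
Implicit Types (f g : R -> R) (B C : set (R -> R)).

(** A coinductive form of infinite differentiability: f belongs to a class in which every member has
    a derivative. Closure properties then amount to exhibiting a class, with no iterated
    derivatives. *)
Definition smooth1 f : Prop := exists C : set (R -> R), C f /\
  forall g, C g -> exists2 g', C g' & forall x : R, is_derive x 1 g (g' x).

(** Derivatives of generators are combinations of generators, as in the product rule; passing to the
    linear span restores closure under differentiation. *)
Inductive span_fun B : (R -> R) -> Prop :=
| span_fun_base f : B f -> span_fun B f
| span_fun0 : span_fun B (fun=> 0)
| span_fun_comb c f g : span_fun B f -> span_fun B g -> span_fun B (fun x => c * f x + g x).

Lemma smooth1_span B :
  (forall f, B f -> exists2 f', span_fun B f' & forall x : R, is_derive x 1 f (f' x)) ->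
  forall f, span_fun B f -> smooth1 f.
Proof.
move=> hB f Bf; exists (span_fun B); split => // g; elim => {f Bf g}.
- by move=> f /hB.
- exists (fun=> 0); first exact: span_fun0.
  by move=> x; exact: is_derive_cst.
- move=> c f g _ [f' Bf' df] _ [g' Bg' dg].
  exists (fun x => c * f' x + g' x); first exact: span_fun_comb.
  by move=> x; exact: (is_deriveD (is_deriveZ c (df x)) (dg x)).
Qed.

Lemma smooth1_derive f : smooth1 f -> exists2 f', smooth1 f' & forall x : R, is_derive x 1 f (f' x).
Proof. by move=> [C [Cf hC]]; have [f' Cf' df] := hC f Cf; exists f' => //; exists C. Qed.

Lemma smooth1_mul f g : smooth1 f -> smooth1 g -> smooth1 (fun x => f x * g x).
Proof.
move=> [C1 [Cf h1]] [C2 [Cg h2]].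
pose B := [set k : R -> R | exists f g, [/\ C1 f, C2 g & k = fun x => f x * g x]].
apply: (@smooth1_span B); last by apply: span_fun_base; exists f, g.
move=> _ [{Cf}f [{Cg}g [Cf Cg ->]]].
have [f' Cf' df] := h1 f Cf; have [g' Cg' dg] := h2 g Cg.
exists (fun x => 1 * (f x * g' x) + (1 * (f' x * g x) + 0)).
  apply: span_fun_comb; first by apply: span_fun_base; exists f, g'.
  by apply: span_fun_comb; [apply: span_fun_base; exists f', g|exact: span_fun0].
move=> x; apply: (is_derive_eq (is_deriveM (df x) (dg x))).
by rewrite /GRing.scale/=; ring.
Qed.

Lemma is_derive_affine (a b x : R) : is_derive x 1 (fun t : R => a * t + b) a.
Proof.
have := is_deriveD (is_deriveZ a (is_derive_id x 1)) (is_derive_cst b x 1).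
by rewrite addr0 /GRing.scale/= mulr1.
Qed.

Lemma smooth1_affine a b f : smooth1 f -> smooth1 (fun x => f (a * x + b)).
Proof.
move=> [C [Cf hC]].
pose B := [set k : R -> R | exists2 g, C g & k = fun x => g (a * x + b)].
apply: (@smooth1_span B); last by apply: span_fun_base; exists f.
move=> _ [g Cg ->]; have [g' Cg' dg] := hC g Cg.
exists (fun x => a * g' (a * x + b) + 0).
  by apply: span_fun_comb; [apply: span_fun_base; exists g'|exact: span_fun0].
move=> x; rewrite addr0 mulrC.
exact: (is_derive1_comp (f := g) (g := fun t => a * t + b) (dg _) (is_derive_affine a b x)).
Qed.

Lemma is_derive_unique f (x a b : R) : is_derive x 1 f a -> is_derive x 1 f b -> a = b.
Proof. by move=> [_ <-] [_ <-]. Qed.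

Lemma is_derive_near0 f (x : R) : (\forall t \near x, f t = 0) -> is_derive x 1 f 0.
Proof.
move=> h; apply: near_eq_is_derive (is_derive_cst (0 : R) x 1).
by apply: filterS h => t ->.
Qed.

Lemma smooth1_continuous f : smooth1 f -> continuous f.
Proof.
move=> [C [Cf hC]] x; have [f' _ /(_ x) [df _]] := hC f Cf.
exact/differentiable_continuous/derivable1_diffP.
Qed.

Lemma derive_support (f f' : R -> R) (M : R) : (forall x : R, is_derive x 1 f (f' x)) ->
  (forall x, M < `|x| -> f x = 0) -> forall x, M < `|x| -> f' x = 0.
Proof.
move=> df fM x xM; apply: (is_derive_unique (df x)); apply: is_derive_near0.
have : \forall t \near x, M < `|t|.
  have hn : (fun t : R => `|t|) @ x --> `|x| by exact: norm_continuous.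
  exact: (cvgr_gt _ hn _ xM).
by apply: filterS => t; exact: fM.
Qed.

(** The derivative is continuous and vanishes outside a segment, hence bounded; the mean value
    theorem concludes. *)
Lemma smooth1_lipschitz f (M : R) : smooth1 f -> (forall x, M < `|x| -> f x = 0) ->
  exists2 L : R, 0 < L & forall x y, `|f x - f y| <= L * `|x - y|.
Proof.
move=> sf fM; have [f' sf' df] := smooth1_derive sf.
have f'M := derive_support df fM.
have cf' := smooth1_continuous sf'.
have cn : continuous (fun x => `|f' x|).
  by move=> x; apply: (@continuous_comp _ _ _ f' Num.norm); [exact: cf'|exact: norm_continuous].
have M0 : - `|M| <= `|M| by rewrite ge0_cp.
have [c _ cmax] := EVT_max M0 (continuous_subspaceT cn).
pose L := `|f' c| + 1; have L0 : 0 < L by rewrite ltr_wpDl.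
have f'L x : `|f' x| <= L.
  have [xM|xM] := leP `|x| `|M|.
    apply: (@le_trans _ _ `|f' c|); last by rewrite lerDl.
    by apply: cmax; rewrite in_itv/= -ler_norml.
  by rewrite f'M ?normr0 ?(ltW L0)//; apply: le_lt_trans xM; exact: ler_norm.
have main x y : x <= y -> `|f y - f x| <= L * `|y - x|.
  move=> xy; have [z _ ->] := MVT_segment xy (fun t _ => df t)
    (continuous_subspaceT (smooth1_continuous sf)).
  by rewrite normrM ler_wpM2r.
exists L => // x y; have [xy|/ltW xy] := leP x y; last exact: main.
by rewrite distrC [`|x - y|]distrC; exact: main.
Qed.

Lemma is_derive_quadratic f (C : R) : (\forall t \near (0 : R), `|f t| <= C * t ^+ 2) -> f 0 = 0 ->
  is_derive (0 : R) 1 f 0.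
Proof.
move=> fC f0.
have key : (fun h : R => h^-1 *: (f (h *: 1 + 0) - f 0)) @ 0^' --> (0 : R).
  apply/cvgrPdist_lt => /= e e0; near=> h.
  have h0 : h != 0 by near: h; exact: nbhs_dnbhs_neq.
  rewrite sub0r normrN f0 subr0 addr0 /GRing.scale/= mulr1 normrM normfV.
  have n0 : 0 < `|h| by rewrite normr_gt0.
  have hC : `|f h| <= C * h ^+ 2 by near: h; exact: nbhs_dnbhs.
  have he : `|h| < e / (`|C| + 1).
    near: h; apply: dnbhs0_lt.
    by rewrite divr_gt0// ltr_wpDl.
  rewrite mulrC ltr_pdivrMr//; apply: (le_lt_trans hC).
  rewrite -(real_normK (num_real h)) expr2 mulrA ltr_pM2r//.
  apply: (@le_lt_trans _ _ ((`|C| + 1) * `|h|)).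
    by rewrite ler_wpM2r// (le_trans (ler_norm C))// lerDl.
  by rewrite mulrC -ltr_pdivlMr// ltr_wpDl.
apply: DeriveDef; last exact: cvg_lim key.
by apply/cvg_ex; exists 0.
Unshelve. all: by end_near. Qed.

Lemma powR_subr1 (b t : R) : 0 < t -> t `^ (b - 1) = t `^ b * t^-1.
Proof. by move=> t0; rewrite powRD ?(gt_eqF t0) ?implybT// powR_inv1// ltW. Qed.

Lemma powR_le_exp (a b t : R) : 0 < t -> t <= 1 -> a <= b -> t `^ b <= t `^ a.
Proof.
move=> t0 t1 ab; rewrite -(subrK a b) powRD ?(gt_eqF t0) ?implybT//.
rewrite -[leRHS]mul1r ler_wpM2r ?powR_ge0//.
by rewrite -(powR1r (b - a)) ge0_ler_powR ?nnegrE ?subr_ge0// ltW.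
Qed.

(** The classical flat function with a free power of t, which makes the span of the family stable
    under differentiation. *)
Definition flat_exp (b t : R) : R := if 0 < t then t `^ b * expR (- t^-1) else 0.

Lemma flat_exp_le0 b t : t <= 0 -> flat_exp b t = 0.
Proof. by rewrite /flat_exp ltNge => ->. Qed.

Lemma is_derive_flat_exp (b x : R) :
  is_derive x 1 (flat_exp b) (b * flat_exp (b - 1) x + flat_exp (b - 2) x).
Proof.
have [x0|] := ltP 0 x.
  apply: (@near_eq_is_derive _ _ _ (fun t => t `^ b * expR (- t^-1))).
    have : \forall t \near x, 0 < t by exact: lt_nbhsr.
    by apply: filterS => t t0; rewrite /flat_exp t0.
  have dinv : is_derive x 1 (fun t : R => - t^-1) (x ^- 2).
    have := is_deriveN (is_deriveV (lt0r_neq0 x0) (is_derive_id x 1)).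
    by rewrite /GRing.scale/= mulr1 opprK.
  have de := is_derive1_comp (g := fun t : R => - t^-1) (is_derive_expR (- x^-1)) dinv.
  apply: (is_derive_eq (is_deriveM (is_derive_powR b x0) de)).
  rewrite /flat_exp x0 /GRing.scale/= (_ : b - 2 = b - 1 - 1); last by ring.
  by rewrite !powR_subr1//; field; rewrite gt_eqF.
rewrite le_eqVlt => /orP[/eqP->|x0].
  rewrite !flat_exp_le0// mulr0 addr0.
  (* With e^(-1/t) <= m^m t^m, the exponent b + m is at least 2, so the function is O(t^2) at 0 and
     its derivative there is 0. *)
  pose m := `|b| + 2.
  have m0 : 0 < m by rewrite ltr_wpDl.
  apply: (@is_derive_quadratic _ (m `^ m)); last by rewrite flat_exp_le0.
  near=> t; have [t0|t0] := ltP 0 t; last first.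
    by rewrite flat_exp_le0// normr0 mulr_ge0// ?powR_ge0// sqr_ge0.
  rewrite /flat_exp t0 ger0_norm ?mulr_ge0 ?powR_ge0 ?expR_ge0//.
  have tV : 0 < t^-1 by rewrite invr_gt0.
  apply: (@le_trans _ _ (t `^ b * (m `^ m * t^-1 `^ (- m)))).
    by rewrite ler_wpM2l ?powR_ge0// expRN_le_powR.
  rewrite mulrCA ler_wpM2l ?powR_ge0//.
  rewrite -(powR_inv1 (ltW t0)) -powRrM mulN1r opprK -powRD ?(gt_eqF t0) ?implybT//.
  rewrite -powR_mulrn ?(ltW t0)//; apply: powR_le_exp => //.
  - by apply: ltW; near: t; exact: lt_nbhsl.
  - by rewrite /m; have := ler_norm (- b); rewrite normrN; lra.
rewrite !flat_exp_le0 ?(ltW x0)// mulr0 addr0; apply: is_derive_near0.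
have : \forall t \near x, t < 0 by exact: lt_nbhsl.
by apply: filterS => t /ltW; exact: flat_exp_le0.
Unshelve. all: by end_near. Qed.

Lemma smooth1_flat_exp b : smooth1 (flat_exp b).
Proof.
apply: (@smooth1_span (range flat_exp)); last by apply: span_fun_base; exists b.
move=> _ [c _ <-].
exists (fun x => c * flat_exp (c - 1) x + (1 * flat_exp (c - 2) x + 0)).
  apply: span_fun_comb; first by apply: span_fun_base; exists (c - 1).
  by apply: span_fun_comb; [apply: span_fun_base; exists (c - 2)|exact: span_fun0].
by move=> x; apply: (is_derive_eq (is_derive_flat_exp c x)); rewrite mul1r addr0.
Qed.

Definition bump (t : R) : R := flat_exp 0 (1 + t) * flat_exp 0 (1 - t).

Lemma smooth1_bump : smooth1 bump.
Proof.
have := smooth1_mul (smooth1_affine 1 1 (smooth1_flat_exp 0))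
  (smooth1_affine (-1) 1 (smooth1_flat_exp 0)).
by congr smooth1; apply/funext => t; rewrite /bump mul1r mulN1r addrC [- t + 1]addrC.
Qed.

Lemma flat_exp0_ge0 t : 0 <= flat_exp 0 t.
Proof. by rewrite /flat_exp; case: ifP => // _; rewrite mulr_ge0 ?powR_ge0 ?expR_ge0. Qed.

Lemma flat_exp0_le1 t : flat_exp 0 t <= 1.
Proof.
rewrite /flat_exp; case: ifP => // t0; rewrite powRr0 mul1r -expR0 ler_expR.
by rewrite oppr_le0 invr_ge0 ltW.
Qed.

Lemma bump_ge0 t : 0 <= bump t.
Proof. by rewrite mulr_ge0 ?flat_exp0_ge0. Qed.

Lemma bump_le1 t : bump t <= 1.
Proof. by rewrite mulr_ile1 ?flat_exp0_ge0 ?flat_exp0_le1. Qed.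

Lemma bump_support t : 1 <= `|t| -> bump t = 0.
Proof.
rewrite /bump ler_normr => /orP[h|h].
  by rewrite [flat_exp 0 (1 - t)]flat_exp_le0 ?mulr0// subr_le0.
by rewrite flat_exp_le0 ?mul0r//; lra.
Qed.

(** Both 1 + t and 1 - t are at least 1/2, where the flat factor is at least e^(-2). *)
Lemma bump_half t : `|t| <= 2^-1 -> expR (- 4) <= bump t.
Proof.
rewrite ler_norml => /andP[h1 h2].
have half x : 2^-1 <= x -> expR (- 2) <= flat_exp 0 x.
  move=> hx; have x0 : 0 < x by lra.
  rewrite /flat_exp x0 powRr0 mul1r ler_expR lerN2 -[leRHS]invrK.
  by rewrite lef_pV2// posrE invr_gt0.
rewrite (_ : - 4 = - 2 + - 2); last by ring.
by rewrite expRD; apply: ler_pM; rewrite ?expR_ge0//; apply: half; lra.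
Qed.

(** A derivative lowers b by one and keeps G or replaces it by its derivative, so the family
    generates a stable span. *)
Definition power_log (b : R) (G : R -> R) (t : R) : R :=
  if 0 < t then t `^ b * G (ln t) else 0.

Lemma is_derive_power_log b (G G' : R -> R) (M : R) :
  (forall x : R, is_derive x 1 G (G' x)) -> (forall x, M < `|x| -> G x = 0) ->
  forall x : R, is_derive x 1 (power_log b G)
    (b * power_log (b - 1) G x + power_log (b - 1) G' x).
Proof.
move=> dG GM x; have [x0|x0] := ltP 0 x.
  apply: (@near_eq_is_derive _ _ _ (fun t => t `^ b * G (ln t))).
    have : \forall t \near x, 0 < t by exact: lt_nbhsr.
    by apply: filterS => t t0; rewrite /power_log t0.
  have de := is_derive1_comp (dG (ln x)) (is_derive1_ln x0).
  apply: (is_derive_eq (is_deriveM (is_derive_powR b x0) de)).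
  rewrite /power_log x0 /GRing.scale/= powR_subr1//.
  by field; rewrite gt_eqF.
rewrite (_ : _ + _ = 0); last first.
  by rewrite /power_log ltNge x0 mulr0 addr0.
apply: is_derive_near0.
(* Below e^(-|M|) the logarithm leaves the support of G, so the function vanishes near every x <= 0
   whatever b is. *)
have : \forall t \near x, t < expR (- `|M|).
  by apply: lt_nbhsl; rewrite (le_lt_trans x0)// expR_gt0.
apply: filterS => t tM; rewrite /power_log; case: ifP => // t0; rewrite GM ?mulr0//.
have : ln t < - `|M| by rewrite -(expRK (- `|M|)) ltr_ln ?posrE ?expR_gt0.
by have := ler_norm M; have := ler_norm (- ln t); rewrite normrN; lra.
Qed.

Lemma smooth1_power_log b (G : R -> R) (M : R) : smooth1 G -> (forall x, M < `|x| -> G x = 0) ->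
  smooth1 (power_log b G).
Proof.
move=> [C [CG hC]] GM.
pose B := [set k : R -> R | exists c H, [/\ C H, (forall x, M < `|x| -> H x = 0) &
  k = power_log c H]].
apply: (@smooth1_span B); last by apply: span_fun_base; exists b, G.
move=> _ [c [H [CH HM ->]]]; have [H' CH' dH] := hC H CH.
exists (fun x => c * power_log (c - 1) H x + (1 * power_log (c - 1) H' x + 0)).
  apply: span_fun_comb; first by apply: span_fun_base; exists (c - 1), H.
  apply: span_fun_comb; last exact: span_fun0.
  by apply: span_fun_base; exists (c - 1), H'; split => //; exact: derive_support HM.
by move=> x; apply: (is_derive_eq (is_derive_power_log c dH HM x)); rewrite mul1r addr0.
Qed.

End smooth_line.

(** * Products of one-variable functions as test functions *)

Section product_functions.
Context {R : realType} (n : nat).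
Local Notation V := ('rV[R]_n.+1).
Implicit Types (F : 'I_n.+1 -> R -> R) (x : V).

Definition prod_fun F x : R := \prod_i F i (x ord0 i).

Lemma continuous_prod_fun F : (forall i, smooth1 (F i)) -> continuous (prod_fun F).
Proof.
move=> sF x; rewrite /prod_fun.
apply: (@cvg_big _ _ _ _ xpredT _ _ (nbhs x) _ (fun i y => F i (y ord0 i))).
  exact: mul_continuous.
move=> i _; apply: (@continuous_comp _ _ _ (fun y : V => y ord0 i) (F i)).
  exact: coord_continuous.
exact: smooth1_continuous.
Qed.

(** Only factor i varies along the i-th axis; the others come out of the difference quotient as the
    constant [c]. *)
Lemma is_derive_prod_fun F i (g : R -> R) x : is_derive (x ord0 i) 1 (F i) (g (x ord0 i)) ->
  is_derive x (delta_mx ord0 i) (prod_fun F)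
    (prod_fun (fun j => if j == i then g else F j) x).
Proof.
move=> [dF eF].
pose c := \prod_(j | j != i) F j (x ord0 j).
have quot h : h^-1 *: (prod_fun F (h *: delta_mx ord0 i + x) - prod_fun F x) =
    c *: (h^-1 *: (F i (h *: 1 + x ord0 i) - F i (x ord0 i))).
  rewrite /prod_fun (bigD1 i)//= [in X in _ - X](bigD1 i)//= !mxE !eqxx mulr1.
  rewrite (eq_bigr (fun j => F j (x ord0 j))) => [|j ji]; last first.
    by rewrite !mxE (negbTE ji) andbF mulr0 add0r.
  rewrite -/c /GRing.scale/= mulr1; ring.
have quot_cvg : (fun h => h^-1 *: (prod_fun F (h *: delta_mx ord0 i + x) - prod_fun F x)) @ 0^' -->
    c *: 'D_1 (F i) (x ord0 i).
  rewrite (_ : (fun h => _) = (fun h => c *: (h^-1 *: (F i (h *: 1 + x ord0 i) - F i (x ord0 i))))).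
    exact: (cvgM (cvg_cst c) dF).
  by apply/funext => h; exact: quot.
apply: DeriveDef; first by apply/cvg_ex; exists (c *: 'D_1 (F i) (x ord0 i)).
rewrite /derive (cvg_lim _ quot_cvg)// eF /prod_fun (bigD1 i)//= eqxx /GRing.scale/= mulrC.
by congr (_ * _); apply: eq_bigr => j /negbTE ->.
Qed.

Lemma partial_derive_prod_fun F i : (forall j, smooth1 (F j)) ->
  exists2 G, (forall j, smooth1 (G j)) & partial_derive i (prod_fun F) = prod_fun G.
Proof.
move=> sF; have [g sg dg] := smooth1_derive (sF i).
exists (fun j => if j == i then g else F j); first by move=> j; case: ifP.
by apply/funext => x; have [_] := is_derive_prod_fun (dg (x ord0 i)).
Qed.

Lemma smooth_prod_fun F : (forall i, smooth1 (F i)) -> smooth (prod_fun F).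
Proof.
move=> sF l /=; have [G sG ->] : exists2 G, (forall j, smooth1 (G j)) &
    foldr (@partial_derive R n) (prod_fun F) l = prod_fun G.
  elim: l => [|i l [G sG ih]]; first by exists F.
  by have [G' sG' e] := partial_derive_prod_fun i sG; exists G' => //=; rewrite ih.
split; first exact: continuous_prod_fun.
move=> i x; have [g _ dg] := smooth1_derive (sG i).
by have [] := is_derive_prod_fun (dg (x ord0 i)).
Qed.

Lemma test_function_prod_fun F (a b : R) : 0 < a -> (forall i, smooth1 (F i)) ->
  (forall i t, b < `|t| -> F i t = 0) -> (forall t, t < a -> F ord_max t = 0) ->
  test_function (prod_fun F).
Proof.
move=> a0 sF Fb Fa; pose A (i : 'I_n.+1) : set R := `[if i == ord_max then a else - b, b]%classic.
have cA : compact [set x : V | forall i, A i (x ord0 i)].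
  by apply: rV_compact => i; exact: segment_compact.
have clA : closed [set x : V | forall i, A i (x ord0 i)].
  by apply: compact_closed => //; exact: norm_hausdorff.
have sub : closure [set x | prod_fun F x != 0] `<=` [set x : V | forall i, A i (x ord0 i)].
  rewrite [X in _ `<=` X]((closure_id _).1 clA); apply: closure_subset => x /=.
  move=> ux i; rewrite /A /= in_itv/=.
  have Fi j : F j (x ord0 j) != 0.
    by apply: contra_neq ux => h; rewrite /prod_fun (bigD1 j)//= h mul0r.
  have : `|x ord0 i| <= b by rewrite leNgt; apply: contra_neqN (Fi i); exact: Fb.
  rewrite ler_norml => /andP[h1 h2]; rewrite h2 andbT; case: eqP => // e.
  by rewrite e leNgt; apply: contra_neqN (Fi ord_max); exact: Fa.
split; first exact: smooth_prod_fun.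
- by apply: subclosed_compact cA sub; exact: closed_closure.
- move=> x /sub/(_ ord_max); rewrite /A /half_space /= eqxx in_itv/= => /andP[h _].
  exact: lt_le_trans h.
Qed.

(** The constant sequence approximates u. *)
Lemma test_function_W_space (p s : R) (u : V -> R) : 0 < p -> test_function u -> W_space p s u.
Proof.
move=> p0 tu; have cu : continuous u by have [/(_ [::])[]] := tu.
have pn0 := gt_eqF p0.
split; first by apply: measurable_funTS; exact: continuous_measurable_rV.
exists (fun=> u); split => [//|e e0|].
  exists 0%N => k l _ _; rewrite /gagliardo_norm /gagliardo.
  rewrite integral0_eq ?poweR0r ?invr_eq0 ?pn0 ?lte_fin//.
  by move=> z _; rewrite !subrr normr0 powR0 ?pn0// mul0r.
rewrite (_ : (fun k => _) = cst 0%E); first exact: cvg_cst.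
apply/funext => k; apply: integral0_eq => x _.
by rewrite subrr normr0 powR0 ?pn0// mul0r.
Qed.

End product_functions.

(** * One-dimensional integrals governing the cutoff errors *)

Section log_scale.
Context {R : realType}.
Local Notation leb := (@lebesgue_measure R).

Definition log_window (K t : R) : bool := (expR (- K) <= t) && (t <= expR K).

Lemma measurable_log_window K : measurable_fun setT (log_window K).
Proof. by rewrite /log_window; msr. Qed.

Lemma log_window_gt0 K t : log_window K t -> 0 < t.
Proof. by case/andP => + _; apply: lt_le_trans; exact: expR_gt0. Qed.

Lemma log_windowE K t : 0 < t -> log_window K t = (`|ln t| <= K).
Proof.
move=> t0; rewrite ler_norml /log_window.
by rewrite -{1 2}(lnK (x := t)) ?posrE// !ler_expR.
Qed.

Lemma integral_log_window K : 0 <= K ->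
  (\int[leb]_t ((log_window K t)%:R * `|t^-1|)%:E = (2 * K)%:E)%E.
Proof.
move=> K0; rewrite -(integral_boolr leb (log_window K)).
rewrite (_ : [set t | log_window K t] = `[expR (- K), expR K]%classic); last first.
  by apply/seteqP; split => t /=; rewrite in_itv.
have [->|Kn0] := eqVneq K 0; first by rewrite oppr0 mulr0 expR0 set_itv1 integral_set1.
have gt0 t : expR (- K) <= t -> 0 < t by apply: lt_le_trans; exact: expR_gt0.
have cln (t : R) : 0 < t -> {for t, continuous (@ln R)}.
  by move=> t0; exact: continuous_ln.
rewrite (@continuous_FTC2 _ _ (@ln R)).
- by rewrite -EFinB !expRK; congr EFin; ring.
- by rewrite ltr_expR gt0_cp// lt0r Kn0.
- apply: continuous_in_subspaceT => t; rewrite inE/= in_itv/= => /andP[/gt0 t0 _].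
  apply: (@continuous_comp _ _ _ (fun t : R => t^-1) Num.norm); last exact: norm_continuous.
  by apply: inv_continuous; rewrite gt_eqF.
- split.
  + move=> t; rewrite in_itv/= => /andP[/ltW/gt0 t0 _].
    by have [] := is_derive1_ln t0.
  + by apply: cvg_at_right_filter; apply: cln; exact: expR_gt0.
  + by apply: cvg_at_left_filter; apply: cln; exact: expR_gt0.
- move=> t; rewrite in_itv/= => /andP[/ltW/gt0 t0 _].
  by have [_] := is_derive1_ln t0; rewrite derive1E => ->; rewrite gtr0_norm// invr_gt0.
Qed.

Lemma integral_log_window_powR_lty K a : 0 <= K -> 0 <= a ->
  (\int[leb]_t ((log_window K t)%:R * t `^ (a - 1))%:E <= (expR (K * a) * (2 * K))%:E)%E.
Proof.
move=> K0 a0; rewrite EFinM -(integral_log_window K0).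
have mw := measurable_log_window K.
rewrite -integralZl_real ?expR_ge0//; last by msr.
apply: le_integral_real; try mpos.
move=> t; have [wt|_] := boolP (log_window K t); last by rewrite !mul0r mulr0.
have t0 := log_window_gt0 wt.
rewrite !mul1r gtr0_norm ?invr_gt0// powR_subr1// ler_wpM2r ?invr_ge0 ?(ltW t0)//.
rewrite /powR gt_eqF// ler_expR mulrC ler_wpM2r//.
by move: wt; rewrite log_windowE// => /(le_trans (ler_norm _)).
Qed.

(** The tangent inequality at r^(-e) gives e |ln r| <= r^(-e) - 1, and r <= r^e does the rest: the
    logarithm costs an arbitrarily small power at 0 and still vanishes linearly at 1. *)
Lemma ln_norm_le (e r : R) : 0 < e -> e <= 1 -> 0 < r -> r < 1 ->
  `|ln r| <= e^-1 * (r `^ (- e) * (1 - r)).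
Proof.
move=> e0 e1 r0 r1; have ln0 : ln r <= 0 by apply: ln_le0; exact: ltW.
rewrite ler0_norm// -ler_pdivrMl ?invr_gt0// invrK.
have h := ln_tangent_le (powR_gt0 (- e) r0); rewrite ln_powR in h.
apply: (@le_trans _ _ (r `^ (- e) - 1)); first by lra.
rewrite mulrBr mulr1 lerD2l lerN2 powRN.
rewrite ler_pdivrMl ?powR_gt0// mulr1 -[leLHS](powRr1 (ltW r0)).
by apply: powR_le_exp => //; exact: ltW.
Qed.

(** It bounds increments of a Lipschitz function with values in [0, 1]. *)
Definition trunc1 (t : R) : R := if 1 <= t then 1 else t.

Lemma measurable_trunc1 : measurable_fun setT trunc1.
Proof. by rewrite /trunc1; msr. Qed.

Lemma trunc1_ge0 t : 0 <= t -> 0 <= trunc1 t.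
Proof. by rewrite /trunc1; case: ifP. Qed.

Lemma le_trunc1 d t : d <= 1 -> d <= t -> d <= trunc1 t.
Proof. by rewrite /trunc1; case: ifP. Qed.

Section kernel_integrals.
Variables p s : R.
Hypotheses (p1 : 1 <= p) (s0 : 0 < s) (s1 : s < 1).
Local Notation sg := (p * s).
Let p0 : 0 < p := p_gt0 p1.
Let sg0 : 0 < sg := ps_gt0 p1 s0.
Let sgp : sg < p. Proof. by rewrite gtr_pMr. Qed.

Definition log_kernel (r : R) : R := `|ln r| `^ p * r `^ (sg - 1) * `|1 - r| `^ (- 1 - sg).

Lemma measurable_log_kernel : measurable_fun setT log_kernel.
Proof. by rewrite /log_kernel; msr. Qed.

Lemma log_kernel_ge0 r : 0 <= log_kernel r.
Proof. by rewrite /log_kernel; pos. Qed.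

(** The exponent e = s/(2p) in [ln_norm_le] costs r^(-s/2) after the p-th power, which is affordable
    at both ends. *)
Let C : R := (s / (2 * p))^-1 `^ p.

Let ln_powR_le (r : R) : 0 < r -> r < 1 ->
  `|ln r| `^ p * `|1 - r| `^ (- 1 - sg) <= C * (r `^ (1 - s / 2 - 1) * `|1 - r| `^ (p - sg - 1)).
Proof.
move=> r0 r1; have r10 : 0 < 1 - r by rewrite subr_gt0.
have e0 : 0 < s / (2 * p) by rewrite divr_gt0// mulr_gt0.
have e1 : s / (2 * p) <= 1 by rewrite ler_pdivrMr ?mulr_gt0// mul1r; have := p1; have := s1; lra.
have h := ln_norm_le e0 e1 r0 r1.
rewrite (_ : p - sg - 1 = p + (- 1 - sg)); last by ring.
rewrite powRD; last by rewrite normr_eq0 (gt_eqF r10) implybT.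
rewrite !mulrA ler_wpM2r ?powR_ge0// (gtr0_norm r10).
apply: (@le_trans _ _ (((s / (2 * p))^-1 * (r `^ (- (s / (2 * p))) * (1 - r))) `^ p)).
  apply: (ge0_ler_powR (ltW p0)); rewrite ?nnegrE ?mulr_ge0 ?powR_ge0 ?(ltW r10)//.
  by rewrite invr_ge0 ltW.
rewrite powRM ?mulr_ge0 ?powR_ge0 ?(ltW r10) ?invr_ge0 ?(ltW e0)//.
rewrite powRM ?powR_ge0 ?(ltW r10)// -powRrM -/C mulrA le_eqVlt; apply/orP; left; apply/eqP.
by congr (_ * _ `^ _ * _); field; rewrite gt_eqF.
Qed.

(** Below 1 the beta exponents are sg - s/2 and p - sg; above 1, after inversion, 1 - s/2 and p -
    sg. All are positive since s <= sg < p and s < 1. *)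
Lemma integral_log_kernel_lty :
  (\int[leb]_r ((0 < r)%R%:R * log_kernel r)%:E < +oo)%E.
Proof.
have mk := measurable_log_kernel; have k0 := log_kernel_ge0.
have C0 : 0 <= C by exact: powR_ge0.
pose beta (a b r : R) := ((0 < r) && (r < 1))%R%:R * (r `^ (a - 1) * `|1 - r| `^ (b - 1)).
have mbeta a b : measurable_fun setT (beta a b) by rewrite /beta; msr.
have beta0 a b r : 0 <= beta a b r by rewrite /beta; pos.
have b0 : 0 < p - sg by rewrite subr_gt0.
have sgs : s <= sg by rewrite ler_peMl// ltW.
have fin a : 0 < a -> (\int[leb]_r (C * beta a (p - sg) r)%:E < +oo)%E.
  move=> a0; have mb := mbeta a (p - sg); have hb0 := beta0 a (p - sg).
  rewrite (integralZl_real leb C0 mb hb0).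
  apply: lte_mul_pinfty => //; exact: integral_beta_lty.
have below : (\int[leb]_r (((0 < r) && (r < 1))%R%:R * log_kernel r)%:E < +oo)%E.
  apply: le_lt_trans (fin (sg - s / 2) _); last by have := s0; lra.
  have mb := mbeta (sg - s / 2) (p - sg); apply: le_integral_real; try mpos.
  move=> r; rewrite /beta; case: (boolP ((0 < r) && (r < 1))) => [/andP[r0 r1]|_]; last first.
    by rewrite !mul0r mulr0.
  rewrite !mul1r /log_kernel mulrAC.
  apply: (le_trans (ler_wpM2r (powR_ge0 _ _) (ln_powR_le r0 r1))).
  rewrite -[leLHS]mulrA ler_wpM2l// mulrAC -powRD ?(gt_eqF r0) ?implybT//.
  by rewrite (_ : 1 - s / 2 - 1 + (sg - 1) = sg - s / 2 - 1)//; ring.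
have above : (\int[leb]_r ((1 < r)%R%:R * log_kernel r)%:E < +oo)%E.
  rewrite (_ : (\int[leb]_r _)%E =
    (\int[leb]_r ((0 < r)%R%:R * ((1 < r)%R%:R * log_kernel r))%:E)%E); last first.
    apply: eq_integral => r _; congr EFin; rewrite mulrA -natrM mulnb.
    by case: (ltP 1 r) => h; rewrite ?andbF// (lt_trans _ h).
  rewrite (integral_inversion (F := fun r => (1 < r)%R%:R * log_kernel r)); try mpos.
  apply: le_lt_trans (fin (1 - s / 2) _); last by have := s1; lra.
  have mb := mbeta (1 - s / 2) (p - sg); apply: le_integral_real; try mpos.
  move=> r; rewrite /beta; case: (ltP 0 r) => r0; last by rewrite !mul0r mulr0.
  rewrite mul1r invf_gt1//; case: (ltP r 1) => r1; last by rewrite !mul0r mulr0.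
  rewrite !mul1r; apply: le_trans (ln_powR_le r0 r1).
  rewrite /log_kernel lnV ?posrE// normrN.
  have -> : 1 - r^-1 = - ((1 - r) / r) by field; rewrite gt_eqF.
  rewrite normrN normrM (gtr0_norm (x := r^-1)) ?invr_gt0//.
  rewrite powRM ?invr_ge0 ?(ltW r0)// -(powR_inv1 (ltW r0)) -!powRrM.
  rewrite -powR_mulrn ?(ltW r0)// -powRN -!mulrA ler_wpM2l ?powR_ge0//.
  rewrite mulrCA ler_piMr ?powR_ge0// -!powRD ?(gt_eqF r0) ?implybT//.
  by rewrite (_ : _ + _ = 0) ?powRr0//; ring.
have m01 : measurable_fun setT (fun r : R => ((0 < r) && (r < 1))%R%:R * log_kernel r) by msr.
have m1y : measurable_fun setT (fun r : R => (1 < r)%R%:R * log_kernel r) by msr.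
rewrite (_ : (\int[leb]_r _)%E = (\int[leb]_r (((0 < r) && (r < 1))%R%:R * log_kernel r +
    (1 < r)%R%:R * log_kernel r)%:E)%E); last first.
  apply: eq_integral => r _; congr EFin.
  have [r1|r1|->] := ltrgtP r 1.
  - by rewrite andbT mul0r addr0.
  - by rewrite (lt_trans ltr01 r1) andbF mul0r add0r.
  - by rewrite /log_kernel ln1 normr0 powR0 ?gt_eqF// !mul0r !mulr0 addr0.
rewrite (integralD_real leb m01 m1y); [exact: (lte_add_pinfty below above)| |].
- by move=> r; pos.
- by move=> r; pos.
Qed.

Definition trunc_kernel (c t : R) : R := trunc1 (c * `|t|) `^ p * `|t| `^ (- 1 - sg).

Lemma measurable_trunc_kernel c : measurable_fun setT (trunc_kernel c).
Proof. by have mt := measurable_trunc1; rewrite /trunc_kernel; msr. Qed.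

Lemma trunc_kernel_ge0 c t : 0 <= trunc_kernel c t.
Proof. by rewrite /trunc_kernel; pos. Qed.

Lemma integral_trunc_kernel1_lty : (\int[leb]_t (trunc_kernel 1 t)%:E < +oo)%E.
Proof.
have mk := measurable_trunc_kernel 1; have k0 := trunc_kernel_ge0 1.
pose A (t : R) := ((0 < t) && (t <= 1))%R%:R * t `^ (p - sg - 1).
pose B (t : R) := (1 <= t)%R%:R * t `^ (- sg - 1).
have mA : measurable_fun setT A by rewrite /A; msr.
have mB : measurable_fun setT B by rewrite /B; msr.
have A0 t : 0 <= A t by rewrite /A; pos.
have B0 t : 0 <= B t by rewrite /B; pos.
have pos_part : (\int[leb]_t ((0 < t)%R%:R * trunc_kernel 1 t)%:E < +oo)%E.
  apply: (@le_lt_trans _ _ (\int[leb]_t (A t + B t)%:E)%E).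
    apply: le_integral_real; try mpos.
    move=> t; case: (ltP 0 t) => t0; last by rewrite mul0r; pos.
    rewrite mul1r /trunc_kernel mul1r (gtr0_norm t0) /trunc1 /A /B t0 /=.
    have e : - 1 - sg = - sg - 1 by ring.
    have [t1|t1] := leP 1 t.
      by rewrite powR1r !mul1r e; apply: ler_wpDl => //; pos.
    rewrite (ltW t1) mul0r addr0 mul1r -powRD ?(gt_eqF t0) ?implybT//.
    by rewrite (_ : p + (-1 - sg) = p - sg - 1)//; ring.
  rewrite (integralD_real leb mA mB A0 B0) /A /B integral_powR_pinfty//.
  by rewrite integral_powR_unit ?subr_gt0// -EFinD ltry.
have mpos : measurable_fun setT (fun t : R => (0 < t)%R%:R * trunc_kernel 1 t) by msr.
have mneg : measurable_fun setT (fun t : R => (0 < - t)%R%:R * trunc_kernel 1 t) by msr.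
rewrite (_ : (\int[leb]_t _)%E = (\int[leb]_t ((0 < t)%R%:R * trunc_kernel 1 t +
    (0 < - t)%R%:R * trunc_kernel 1 t)%:E)%E); last first.
  apply: eq_integral => t _; congr EFin; rewrite oppr_gt0.
  have [t0|t0|<-] := ltrgtP 0 t; rewrite ?mul1r ?mul0r ?add0r ?addr0//.
  by rewrite /trunc_kernel normr0 mulr0 /trunc1 ler10 powR0 ?mul0r// gt_eqF.
rewrite (integralD_real leb mpos mneg); try mpos.
apply: (lte_add_pinfty pos_part); apply: le_lt_trans pos_part; rewrite le_eqVlt.
apply/orP; left; apply/eqP.
rewrite -(@ge0_integral_opp _ (fun t => ((0 < t)%R%:R * trunc_kernel 1 t)%:E)).
- by apply: eq_integral => t _; rewrite /trunc_kernel normrN.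
- by msr.
- by move=> t; pos.
Qed.

(** Substitution of c t; at c = [L] / [r] the factor c^sg makes the error of the parallel cutoff
    small for large [r]. *)
Lemma integral_trunc_kernel c : 0 < c ->
  (\int[leb]_t (trunc_kernel c t)%:E =
   (c `^ sg)%:E * \int[leb]_t (trunc_kernel 1 t)%:E)%E.
Proof.
move=> c0; have mk a := measurable_trunc_kernel a; have k0 a := trunc_kernel_ge0 a.
rewrite (@ge0_integral_scale _ (fun t => (trunc_kernel 1 t)%:E) c c0); last 2 first.
- by have := mk 1 => ?; msr.
- by move=> t; rewrite lee_fin.
rewrite muleA -EFinM -integralZl_real ?mulr_ge0 ?powR_ge0 ?(ltW c0)//; last first.
  by have := mk 1 => ?; msr.
apply: eq_integral => t _; congr EFin; rewrite /trunc_kernel mul1r normrM (gtr0_norm c0).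
have e : c `^ sg * c * c `^ (- 1 - sg) = 1.
  rewrite -{2}(powRr1 (ltW c0)) -!powRD ?(gt_eqF c0) ?implybT//.
  by rewrite (_ : sg + 1 + (- 1 - sg) = 0) ?powRr0//; ring.
by rewrite powRM ?(ltW c0)// -[LHS]mul1r -[X in X * _ = _]e; ring.
Qed.

End kernel_integrals.
End log_scale.

(** * Integrals over cylinders *)

Section cylinders.
Context {R : realType} (n : nat).
Local Notation leb := (@lebesgue_measure R).
Local Notation mu := (rV_lebesgue R n.+1).

Definition par (i : 'I_n) : 'I_n.+1 := widen_ord (leqnSn n) i.

Lemma integral_cylinder (phi g : R -> R) (I : R) : measurable_fun setT phi ->
  (forall t, 0 <= phi t) -> (\int[leb]_t (phi t)%:E = I%:E)%E ->
  measurable_fun setT g -> (forall t, 0 <= g t) ->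
  (\int[mu]_x ((\prod_(i < n) phi (x ord0 (par i))) * g (lastc x))%:E =
   (I ^+ n)%:E * \int[leb]_t (g t)%:E)%E.
Proof.
move=> mphi phi0 hI mg g0; have ml := @measurable_lastc R n.
rewrite integral_rcons_swap; try mpos.
have I0 : 0 <= I ^+ n.
  by rewrite exprn_ge0// -lee_fin -hI; exact: integral_ge0_real.
rewrite -integralZl_real//; apply: eq_integral => t _.
transitivity (\int[rV_lebesgue R n]_x (g t * \prod_i phi (x ord0 i))%:E)%E.
  apply: eq_integral => x _; congr EFin; rewrite mulrC /lastc rV_rcons_max; congr (_ * _).
  by apply: eq_bigr => i _; rewrite rV_rcons_widen.
rewrite integralZl_real//; try mpos.
by rewrite (integral_prod_coord _ mphi phi0 hI) -EFinM mulrC.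
Qed.

End cylinders.

(** * Pointwise inequalities for the trial functions *)

Section elementary_inequalities.
Context {R : realType}.

(** Telescoping: one factor is exchanged at a time, and the others lie in [0, 1]. *)
Lemma normB_prod_le (I : Type) (r : seq I) (F G : I -> R) :
  (forall i, 0 <= F i <= 1) -> (forall i, 0 <= G i <= 1) ->
  `|\prod_(i <- r) F i - \prod_(i <- r) G i| <= \sum_(i <- r) `|F i - G i|.
Proof.
move=> F01 G01; have prod01 (H : I -> R) s : (forall i, 0 <= H i <= 1) ->
    0 <= \prod_(i <- s) H i <= 1.
  move=> H01; rewrite prodr_ge0 => [|i _]; last by case/andP: (H01 i).
  by apply: prodr_ile1 => i _; exact: H01.
elim: r => [|i r ih]; first by rewrite !big_nil subrr normr0.
rewrite !big_cons; have /andP[P0 P1] := prod01 F r F01; have /andP[G0 G1] := G01 i.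
set P := \prod_(j <- r) F j in P0 P1 ih *; set Q := \prod_(j <- r) G j in ih *.
have -> : F i * P - G i * Q = (F i - G i) * P + G i * (P - Q) by ring.
apply: (le_trans (ler_normD _ _)); rewrite !normrM (ger0_norm P0) (ger0_norm G0).
apply: lerD; first by rewrite ler_piMr.
by apply: le_trans ih; rewrite ler_piMl.
Qed.

(** Each term is at most m, the p-th root of the sum of p-th powers, so the sum is at most n m. *)
Lemma powR_sum_le (n : nat) (d : 'I_n -> R) (p : R) : 0 < p -> (forall i, 0 <= d i) ->
  (\sum_i d i) `^ p <= n%:R `^ p * \sum_i d i `^ p.
Proof.
move=> p0 d0; pose m := (\sum_i d i `^ p) `^ p^-1.
have S0 : 0 <= \sum_i d i `^ p by apply: sumr_ge0 => i _; exact: powR_ge0.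
have mp : m `^ p = \sum_i d i `^ p by rewrite -powRrM mulVf ?gt_eqF// powRr1.
have dm i : d i <= m.
  rewrite -(powRr1 (d0 i)) -(mulfV (lt0r_neq0 p0)) powRrM.
  apply: ge0_ler_powR; rewrite ?nnegrE ?powR_ge0 ?invr_ge0 ?(ltW p0)//.
  by rewrite (bigD1 i)//= lerDl; apply: sumr_ge0 => j _; exact: powR_ge0.
rewrite -mp -powRM ?powR_ge0//; apply: ge0_ler_powR; rewrite ?nnegrE ?(ltW p0)//.
- exact: sumr_ge0.
- by rewrite mulr_ge0 ?powR_ge0.
- rewrite mulr_natl -[n in leRHS]card_ord -sumr_const.
  by apply: ler_sum => i _; exact: dm.
Qed.

(* Where [X'] vanishes, and where [v] vanishes, the left-hand side is controlled
   by the last two kinds of terms alone; elsewhere split the difference as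
   [v X (w - w') + X w' (v - v') + v' w' (X - X')]. *)
Lemma trial_split_le (p t : R) (X X' v v' w w' : R) (b b' k k' : bool) :
  1 <= p -> 0 < t -> t < 1 -> 0 <= X <= 1 -> 0 <= X' <= 1 -> 0 <= v <= 1 -> 0 <= v' <= 1 ->
  0 <= w -> 0 <= w' -> (~~ b -> X = 0) -> (~~ b' -> X' = 0) ->
  (~~ k -> v = 0) -> (~~ k' -> v' = 0) ->
  `|X * (w * v) - X' * (w' * v')| `^ p <=
  (1 - t) `^ (1 - p) * `|X * (w - w') * v| `^ p +
  t `^ (1 - p) * 2^-1 `^ (1 - p) *
   ((b && k)%:R * (w' `^ p * `|v - v'| `^ p) + (b' && k')%:R * (w' `^ p * `|v - v'| `^ p) +
    ((b' && k')%:R * (w' `^ p * `|X - X'| `^ p) + (b && k)%:R * (w `^ p * `|X - X'| `^ p))).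
Proof.
move=> p1 t0 t1 /andP[X0 X1] /andP[X'0 X'1] /andP[v0 v1] /andP[v'0 v'1] w0 w'0 hb hb' hk hk'.
have p0 : 0 < p := p_gt0 p1.
have mono x y : 0 <= x -> x <= y -> x `^ p <= y `^ p.
  by move=> x0 xy; rewrite ge0_ler_powR ?nnegrE ?(ltW p0)// (le_trans x0).
have ge1 x : 0 < x -> x <= 1 -> 1 <= x `^ (1 - p).
  by move=> x0 x1; rewrite -[leLHS](powRr0 x) powR_le_exp// subr_le0.
have h2 : 0 < 2^-1 :> R by rewrite invr_gt0.
have h21 : 2^-1 < 1 :> R by lra.
have K1 : 1 <= t `^ (1 - p) * 2^-1 `^ (1 - p).
  by rewrite -[leLHS]mulr1 ler_pM ?ge1// ltW.
have k10 := powR_ge0 (1 - t) (1 - p).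
set K := t `^ (1 - p) * _ in K1 *; set k1 := (1 - t) `^ _ in k10 *.
set T1 := `|X * (w - w') * v| `^ p; set T2 := w' `^ p * `|v - v'| `^ p.
set T3 := w' `^ p * `|X - X'| `^ p; set T4 := w `^ p * `|X - X'| `^ p.
have T10 : 0 <= T1 by exact: powR_ge0.
have T20 : 0 <= T2 by rewrite mulr_ge0 ?powR_ge0.
have T30 : 0 <= T3 by rewrite mulr_ge0 ?powR_ge0.
have T40 : 0 <= T4 by rewrite mulr_ge0 ?powR_ge0.
have zero : (0 : R) `^ p = 0 by rewrite powR0// gt_eqF.
have bnd S (c d : bool) : 0 <= S -> S <= (c%:R * T2 + d%:R * T2 + (d%:R * T3 + c%:R * T4)) ->
    S <= k1 * T1 + K * (c%:R * T2 + d%:R * T2 + (d%:R * T3 + c%:R * T4)).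
  move=> S0 hS; apply: ler_wpDl; first exact: mulr_ge0.
  by apply: (le_trans hS); rewrite ler_peMl// (le_trans S0).
have T4le : X' = 0 -> `|X * (w * v) - X' * (w' * v')| `^ p <= T4.
  rewrite /T4 => ->; rewrite mul0r !subr0 -powRM ?normr_ge0//.
  apply: mono => //; rewrite !normrM (ger0_norm v0) (ger0_norm w0) [leRHS]mulrC.
  by rewrite ler_wpM2l// ler_piMr.
have T3le : X = 0 -> `|X * (w * v) - X' * (w' * v')| `^ p <= T3.
  rewrite /T3 => ->; rewrite mul0r !sub0r !normrN -powRM ?normr_ge0//.
  apply: mono => //; rewrite !normrM (ger0_norm v'0) (ger0_norm w'0) [leRHS]mulrC.
  by rewrite ler_wpM2l// ler_piMr.
have T2le : v = 0 -> `|X * (w * v) - X' * (w' * v')| `^ p <= T2.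
  rewrite /T2 => ->; rewrite mulr0 mulr0 !sub0r !normrN -powRM ?normr_ge0//.
  apply: mono => //; rewrite !normrM (ger0_norm X'0) (ger0_norm w'0) (ger0_norm v'0).
  by rewrite ler_piMl// mulr_ge0.
have [/andP[bT kT]|nbk] := boolP (b && k); last first.
  have Xv0 : X = 0 \/ v = 0.
    by move: nbk; rewrite negb_and => /orP[/hb|/hk]; [left|right].
  have [/andP[bT' kT']|nbk'] := boolP (b' && k'); last first.
    have -> : X' * (w' * v') = 0.
      by move: nbk'; rewrite negb_and => /orP[/hb' ->|/hk' ->]; rewrite ?mul0r ?mulr0.
    have -> : X * (w * v) = 0 by case: Xv0 => ->; rewrite ?mul0r ?mulr0.
    by rewrite subrr normr0 zero !mul0r !addr0 mulr0 addr0 mulr_ge0.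
  apply: (bnd _ false true) => //; rewrite mul0r !mul1r mul0r add0r addr0.
  by case: Xv0 => [/T3le|/T2le] h; apply: (le_trans h); rewrite ?lerDl ?lerDr.
have [bT'|/hb' X'_0] := boolP b'; last first.
  apply: (bnd _ true false) => //; rewrite !mul1r !mul0r addr0 add0r.
  by apply: (le_trans (T4le X'_0)); rewrite lerDr.
apply: (@le_trans _ _ (k1 * T1 + K * (T2 + k'%:R * T3))); last first.
  rewrite lerD2l ler_wpM2l ?(le_trans ler01 K1)//= !mul1r -addrA lerD2l.
  by case: k' {hk'} => /=; rewrite ?(mul1r, mul0r); lra.
have -> : X * (w * v) - X' * (w' * v') =
  X * (w - w') * v + (X * (w' * (v - v')) + w' * v' * (X - X')) by ring.
apply: (le_trans (mono _ _ (normr_ge0 _) (ler_normD _ _))).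
(* Splitting with t keeps the factor of the main term close to 1 for small t; the later split
   separates two errors, and 1/2 will do. *)
apply: (le_trans (powR_split_le p1 t0 t1 (normr_ge0 _) (normr_ge0 _))).
rewrite -/k1 -/T1 lerD2l /K -[leRHS]mulrA; apply: ler_wpM2l; first exact: powR_ge0.
apply: (le_trans (mono _ _ (normr_ge0 _) (ler_normD _ _))).
apply: (le_trans (powR_split_le p1 h2 h21 (normr_ge0 _) (normr_ge0 _))).
have -> : 1 - 2^-1 = 2^-1 :> R by field.
rewrite -mulrDr ler_wpM2l ?powR_ge0//; apply: lerD.
  rewrite /T2 -powRM ?normr_ge0//; apply: mono => //.
  by rewrite !normrM (ger0_norm X0) (ger0_norm w'0) ler_piMl// mulr_ge0.
have [k'T|/hk' ->] := boolP k'; last by rewrite mulr0 mul0r normr0 zero mul0r.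
rewrite mul1r /T3 -powRM ?normr_ge0//; apply: mono => //.
by rewrite !normrM (ger0_norm w'0) (ger0_norm v'0) ler_wpM2r// ler_piMr.
Qed.

End elementary_inequalities.

(** * The trial functions and their Hardy integral *)

Section trial_functions.
Context {R : realType} (n : nat) (p s : R).
Hypotheses (p1 : 1 <= p).
Local Notation leb := (@lebesgue_measure R).
Local Notation mu := (rV_lebesgue R n.+1).
Local Notation V := ('rV[R]_n.+1).
Local Notation sg := (p * s).
Let p0 : 0 < p := p_gt0 p1.

Variables M r : R.
Hypotheses (M1 : 1 <= M) (r1 : 1 <= r).
Let M0 : 0 < M. Proof. exact: lt_le_trans M1. Qed.
Let r0 : 0 < r. Proof. exact: lt_le_trans r1. Qed.

(* [trial] is a logarithmic cutoff of the ground state [x_N ^ (- alpha)] at scale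
   [e ^ M], spread out to scale [r] in the directions parallel to the boundary. *)
Definition trial_factor (i : 'I_n.+1) : R -> R :=
  if i == ord_max then power_log (- alpha p s) (fun y => bump (y / M))
  else fun t => bump (t / r).
Definition trial : V -> R := prod_fun trial_factor.

Definition par_cut (x : V) : R := \prod_(i < n) bump (x ord0 (par i) / r).
Definition log_cut (a : R) : R := bump (ln a / M).
Definition par_box (x : V) : bool := [forall i : 'I_n, `|x ord0 (par i)| <= r].
Definition trial_box (x : V) : bool := par_box x && log_window M (lastc x).

Lemma par_neq_max (i : 'I_n) : par i == ord_max = false.
Proof. by apply/negbTE; rewrite -val_eqE /= ltn_eqF. Qed.

Lemma trialE x : 0 < lastc x ->
  trial x = par_cut x * (lastc x `^ (- alpha p s) * log_cut (lastc x)).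
Proof.
move=> x0; rewrite /trial /prod_fun big_ord_recr/=; congr (_ * _).
  by apply: eq_bigr => i _; rewrite /trial_factor -/(par i) par_neq_max.
by rewrite /trial_factor eqxx /power_log -/(lastc x) x0.
Qed.

Lemma bump_scaled_support (c t : R) : 0 < c -> c < `|t| -> bump (t / c) = 0.
Proof.
by move=> c0 ct; rewrite bump_support// normrM normfV (gtr0_norm c0) ler_pdivlMr// mul1r ltW.
Qed.

Lemma smooth1_bump_scaled (c : R) : smooth1 (fun t : R => bump (t / c)).
Proof.
have := smooth1_affine c^-1 0 (@smooth1_bump R).
by congr smooth1; apply/funext => t; rewrite addr0 mulrC.
Qed.

Lemma test_function_trial : test_function trial.
Proof.
have sp := smooth1_power_log (- alpha p s) (smooth1_bump_scaled M)
  (fun t => @bump_scaled_support M t M0).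
have out t : 0 < t -> M < `|ln t| -> power_log (- alpha p s) (fun y => bump (y / M)) t = 0.
  by move=> t0 ht; rewrite /power_log t0 bump_scaled_support ?mulr0.
apply: (@test_function_prod_fun _ _ _ (expR (- M)) (Num.max r (expR M))).
- exact: expR_gt0.
- by move=> i; rewrite /trial_factor; case: ifP => _ //; exact: smooth1_bump_scaled.
- move=> i t; rewrite gt_max => /andP[rt Mt]; rewrite /trial_factor; case: ifP => _.
    have [t0|t0] := ltP 0 t; last by rewrite /power_log ltNge t0.
    apply: out => //; apply: lt_le_trans (ler_norm _).
    by rewrite -(expRK M) ltr_ln ?posrE ?expR_gt0// -(gtr0_norm t0).
  exact: bump_scaled_support.
- move=> t tM; rewrite /trial_factor eqxx.
  have [t0|t0] := ltP 0 t; last by rewrite /power_log ltNge t0.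
  apply: out => //; rewrite -normrN; apply: lt_le_trans (ler_norm _).
  by rewrite ltrNr -(expRK (- M)) ltr_ln ?posrE ?expR_gt0.
Qed.

Lemma measurable_trial : measurable_fun setT trial.
Proof.
by apply: continuous_measurable_rV; have [/(_ [::])[]] := test_function_trial.
Qed.

Lemma bump01 (t : R) : 0 <= bump t <= 1.
Proof. by rewrite bump_ge0 bump_le1. Qed.

Lemma par_cut01 x : 0 <= par_cut x <= 1.
Proof.
rewrite /par_cut prodr_ge0 => [|i _]; last exact: bump_ge0.
by apply: prodr_ile1 => i _; exact: bump01.
Qed.

Lemma par_cut_out x : ~~ par_box x -> par_cut x = 0.
Proof.
rewrite negb_forall => /existsP[i]; rewrite -ltNge => hi.
by rewrite /par_cut (bigD1 i)//= bump_scaled_support ?mul0r.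
Qed.

Lemma log_cut_out a : 0 < a -> ~~ log_window M a -> log_cut a = 0.
Proof. by move=> a0; rewrite log_windowE// -ltNge; exact: bump_scaled_support. Qed.

Lemma par_boxE x : (par_box x)%:R = \prod_(i < n) ((- r <= x ord0 (par i)) && (x ord0 (par i) <= r))%R%:R :> R.
Proof.
have [/forallP h|] := boolP (par_box x).
  by rewrite big1// => i _; rewrite -ler_norml h.
rewrite negb_forall => /existsP[i hi].
by rewrite (bigD1 i)//= -ler_norml (negbTE hi) mul0r.
Qed.

Lemma measurable_trial_box : measurable_fun setT (fun x => (trial_box x)%:R : R).
Proof.
have mw := measurable_log_window M; have ml := @measurable_lastc R n.
rewrite (_ : (fun x => _) = (fun x : V => (\prod_(i < n) ((- r <= x ord0 (par i)) &&
  (x ord0 (par i) <= r))%R%:R) * (log_window M (lastc x))%:R)); first by msr.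
by apply/funext => x; rewrite /trial_box -mulnb natrM par_boxE.
Qed.

Lemma integral_trial_box (g : R -> R) : measurable_fun setT g -> (forall t, 0 <= g t) ->
  (\int[mu]_x ((trial_box x)%:R * g (lastc x))%:E =
   ((2 * r) ^+ n)%:E * \int[leb]_t ((log_window M t)%:R * g t)%:E)%E.
Proof.
move=> mg g0; have mw := measurable_log_window M.
rewrite -(@integral_cylinder R n (fun t => ((- r <= t) && (t <= r))%R%:R)
  (fun t => (log_window M t)%:R * g t)).
- apply: eq_integral => x _; congr EFin.
  by rewrite mulrA; congr (_ * _); rewrite /trial_box -mulnb natrM par_boxE.
- by msr.
- by move=> t; pos.
- by rewrite integral_boolr_itv ?ge0_cp ?(ltW r0)//; congr EFin; ring.
- by msr.
- by move=> t; pos.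
Qed.

(** On the box of half the size all n + 1 bumps are at least e^(-4). There [omega]^p x_N^(-sg) =
    1/x_N, which integrates to r^n times the length M of the logarithmic window. *)
Lemma trial_hardy_ge :
  (((expR (- 4) ^+ n.+1) `^ p * (r ^+ n * M))%:E <= hardy_integral p s trial)%E.
Proof.
have mw := measurable_log_window (M / 2); have ml := @measurable_lastc R n.
have mh := @measurable_hs R n; have mt := measurable_trial.
set c := _ `^ p; have c0 : 0 <= c by exact: powR_ge0.
pose phi (t : R) : R := ((- (r / 2) <= t) && (t <= r / 2))%R%:R.
have mphi : measurable_fun setT phi by rewrite /phi; msr.
have phi0 t : 0 <= phi t by exact: ler0n.
pose g (t : R) : R := (log_window (M / 2) t)%:R * `|t^-1|.
have mg : measurable_fun setT g by rewrite /g; msr.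
have g0 t : 0 <= g t by rewrite /g; pos.
have r20 : 0 <= r / 2 by rewrite divr_ge0// ltW.
have M20 : 0 <= M / 2 by rewrite divr_ge0// ltW.
apply: (@le_trans _ _ (\int[mu]_x (c * ((\prod_(i < n) phi (x ord0 (par i))) * g (lastc x)))%:E)%E).
  rewrite integralZl_real//; try mpos.
  rewrite (@integral_cylinder R n phi g r mphi phi0)//; last first.
    by rewrite integral_boolr_itv ?ge0_cp//; congr EFin; field.
  rewrite integral_log_window// -!EFinM lee_fin.
  by rewrite (_ : 2 * (M / 2) = M)//; field.
rewrite hardy_integralE; apply: le_integral_real; try mpos.
move=> x; rewrite /g.
have [wx|_] := boolP (log_window (M / 2) (lastc x)); last by rewrite mul0r !mulr0; pos.
have x0 := log_window_gt0 wx; rewrite (hs1 x0) !mul1r.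
have [/forallP px|] := boolP [forall i : 'I_n, (- (r / 2) <= x ord0 (par i)) &&
    (x ord0 (par i) <= r / 2)]; last first.
  rewrite negb_forall => /existsP[i hi].
  by rewrite (bigD1 i)//= {1}/phi (negbTE hi) !mul0r mulr0; pos.
rewrite big1 ?mul1r => [|i _]; last by rewrite /phi px.
have e : lastc x `^ (- (alpha p s * p)) * lastc x `^ (- sg) = (lastc x)^-1.
  rewrite (alphap _ p1) -powRD ?(gt_eqF x0) ?implybT// -(powR_inv1 (ltW x0)).
  by congr (_ `^ _); ring.
rewrite trialE// mulrCA normrM (gtr0_norm (powR_gt0 _ x0)).
rewrite powRM ?powR_ge0// -powRrM mulNr mulrAC e mulrC (gtr0_norm (x := (lastc x)^-1)) ?invr_gt0//.
rewrite ler_wpM2l ?invr_ge0 ?(ltW x0)//.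
apply: ge0_ler_powR; rewrite ?nnegrE ?exprn_ge0 ?expR_ge0 ?(ltW p0)//.
rewrite ger0_norm; last by have /andP[h _] := par_cut01 x; rewrite mulr_ge0// bump_ge0.
have half t c' : 0 < c' -> `|t| <= c' / 2 -> expR (- 4) <= bump (t / c').
  move=> c'0 h; apply: bump_half.
  by rewrite normrM normfV (gtr0_norm c'0) ler_pdivrMr// mulrC.
rewrite exprSr; apply: ler_pM; rewrite ?exprn_ge0 ?expR_ge0//.
  rewrite -[n in leLHS]card_ord -prodr_const /par_cut; apply: ler_prod => i _.
  by rewrite expR_ge0 half// ler_norml px.
by rewrite half// -log_windowE.
Qed.

End trial_functions.

(** * Energy of the main term and of the two cutoff errors *)

Section trial_energy.
Context {R : realType} (n : nat) (p s : R).
Hypotheses (p1 : 1 <= p) (s0 : 0 < s) (s1 : s < 1).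
Local Notation leb := (@lebesgue_measure R).
Local Notation mu := (rV_lebesgue R n.+1).
Local Notation V := ('rV[R]_n.+1).
Local Notation sg := (p * s).
Let p0 : 0 < p := p_gt0 p1.
Let sg0 : 0 < sg := ps_gt0 p1 s0.

Definition par_modulus (c : R) (z : V * V) : R :=
  \sum_(i < n) trunc1 (c * `|z.1 ord0 (par i) - z.2 ord0 (par i)|) `^ p.

Lemma measurable_par_modulus c : measurable_fun setT (par_modulus c).
Proof. by have mt := @measurable_trunc1 R; rewrite /par_modulus; msr. Qed.

Lemma par_modulus_ge0 c z : 0 <= par_modulus c z.
Proof. by rewrite /par_modulus; pos. Qed.

Lemma par_modulusC c x y : par_modulus c (x, y) = par_modulus c (y, x).
Proof. by apply: eq_bigr => i _; rewrite distrC. Qed.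

Lemma integral_par_modulus : exists2 C : R, 0 <= C & forall c x,
  (\int[mu]_y (par_modulus c (x, y) * kern sg x y)%:E =
   C%:E * \int[leb]_t (trunc_kernel p s c t)%:E)%E.
Proof.
have nb : n.+1%:R / 2 < (n.+1%:R + sg) / 2 by rewrite ltr_pM2r// ltrDl.
have mt := @measurable_trunc1 R.
pose C i := projT1 (cid2 (integral_any_coord (par i) nb)).
have [C0 hC] : (forall i, 0 <= C i) /\ forall i (G : R -> R) (y : V), measurable_fun setT G ->
    (forall t, 0 <= G t) -> G 0 = 0 ->
    (\int[mu]_x (G (x ord0 (par i) - y ord0 (par i)) * sqdist x y `^ (- ((n.+1%:R + sg) / 2)))%:E =
     (C i)%:E * \int[leb]_t (G t * `|t| `^ (n%:R - 2 * ((n.+1%:R + sg) / 2)))%:E)%E.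
  by split => i; rewrite /C; case: cid2.
have k0 := @kern_ge0 R n sg.
exists (\sum_i C i) => [|c x]; first by apply: sumr_ge0.
pose G (t : R) : R := trunc1 (c * `|t|) `^ p.
have mG : measurable_fun setT G by rewrite /G; msr.
have G0 t : 0 <= G t by rewrite /G; pos.
have mF i : measurable_fun setT (fun y : V => G (x ord0 (par i) - y ord0 (par i)) * kern sg x y).
  have mkx : measurable_fun setT (fun y => kern sg x y).
    by rewrite /kern /sqdist; msr.
  by msr.
transitivity (\int[mu]_y \sum_(i < n) (G (x ord0 (par i) - y ord0 (par i)) * kern sg x y)%:E)%E.
  by apply: eq_integral => y _; rewrite sumEFin /par_modulus mulr_suml.
rewrite ge0_integral_sum//; last 2 first.
- by move=> i; apply: measurable_fun_EFin; exact: (mF i).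
- by move=> i y _; rewrite lee_fin mulr_ge0.
rewrite -sumEFin ge0_sume_distrl; last by move=> i _; rewrite lee_fin.
apply: eq_bigr => i _.
rewrite -(_ : (\int[leb]_t (G t * `|t| `^ (n%:R - 2 * ((n.+1%:R + sg) / 2)))%:E)%E =
  (\int[leb]_t (trunc_kernel p s c t)%:E)%E); last first.
  apply: eq_integral => t _; congr (_ * _ `^ _)%:E.
  by rewrite -[n.+1%:R]natr1; field.
rewrite -(hC i G x mG G0); last by rewrite /G normr0 mulr0 /trunc1 ler10 powR0// gt_eqF.
by apply: eq_integral => y _; rewrite kernC /kern /G distrC.
Qed.

Lemma integral_profile : (\int[leb]_r ((0 < r)%R%:R * profile p s r)%:E =
  2%:E * one_sided_const p s)%E.
Proof.
have mp := @measurable_profile R p s; have pp0 := @profile_ge0 R p s.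
have m01 : measurable_fun setT (fun r : R => ((0 < r) && (r < 1))%R%:R * profile p s r) by msr.
have m1y : measurable_fun setT (fun r : R => (1 < r)%R%:R * profile p s r) by msr.
transitivity (\int[leb]_r (((0 < r) && (r < 1))%R%:R * profile p s r +
    (1 < r)%R%:R * profile p s r)%:E)%E.
  apply: eq_integral => r _; congr EFin.
  have [r1|r1|->] := ltrgtP r 1.
  - by rewrite andbT mul0r addr0.
  - by rewrite (lt_trans ltr01 r1) andbF mul0r add0r.
  - by rewrite /profile /ratio powR1r subrr normr0 powR0 ?gt_eqF// !(mul0r, mulr0) addr0.
rewrite (integralD_real leb m01 m1y); try mpos.
rewrite (integral_profile_out s p1) -one_sided_constE//.
have /fineK <- := one_sided_const_fin p1 s0 s1.
by rewrite -EFinD -EFinM; congr EFin; ring.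
Qed.

(** The main term of the energy reproduces exactly the sharp constant: [omega](x) - [omega](y) is
    [omega](x) times one minus the ratio. *)
Lemma integral_ratio_kern (u : V -> R) : measurable_fun setT u ->
  (\int[mu \x mu]_z (hs z.1 * hs z.2 *
     (`|u z.1| `^ p * `|1 - ratio p s (lastc z.2 / lastc z.1)| `^ p * kern sg z.1 z.2))%:E =
   (hardy_const n.+1 p s)%:E * hardy_integral p s u)%E.
Proof.
move=> mu_; have mr := @measurable_ratio R p s.
rewrite (@integral_kern_quotient R n sg (fun x => `|u x| `^ p)
  (fun r => `|1 - ratio p s r| `^ p) sg0); last 5 first.
- by msr.
- by move=> x; pos.
- by msr.
- by move=> t; pos.
- by rewrite /ratio powR1r subrr normr0 powR0// gt_eqF.
rewrite -/(profile p s _) integral_profile hardy_integralE hardy_constE//.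
by rewrite muleAC muleCA.
Qed.

Section fixed_scales.
Variables M r : R.
Hypotheses (M1 : 1 <= M) (r1 : 1 <= r).
Let M0 : 0 < M. Proof. exact: lt_le_trans M1. Qed.
Let r0 : 0 < r. Proof. exact: lt_le_trans r1. Qed.

(** This is [omega]^p on the box containing the support of the trial function, as alpha p = 1 -
    sg. *)
Definition box_weight (x : V) : R := (trial_box M r x)%:R * lastc x `^ (sg - 1).

Lemma measurable_box_weight : measurable_fun setT box_weight.
Proof.
have mb := @measurable_trial_box R n M r; have ml := @measurable_lastc R n.
by rewrite /box_weight; apply: measurable_fun_mul; [exact: mb|msr].
Qed.

Lemma box_weight_ge0 x : 0 <= box_weight x.
Proof. by rewrite /box_weight; pos. Qed.

Lemma hs_box_weight x : hs x * box_weight x = box_weight x.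
Proof.
rewrite /box_weight /trial_box; have [x0|x0] := ltP 0 (lastc x).
  by rewrite hs1 ?mul1r.
rewrite (_ : log_window M (lastc x) = false) ?andbF ?mul0r ?mulr0//.
by apply/negbTE; apply: contraL x0 => /log_window_gt0; rewrite ltNge.
Qed.

Lemma integral_box_weight_le :
  (\int[mu]_x (box_weight x)%:E <= ((2 * r) ^+ n * (expR (M * sg) * (2 * M)))%:E)%E.
Proof.
rewrite (integral_trial_box n M r1 (g := fun t => t `^ (sg - 1))); try mpos.
rewrite EFinM lee_pmul2l//; first exact: (integral_log_window_powR_lty (ltW M0) (ltW sg0)).
by rewrite lte_fin exprn_gt0// mulr_gt0.
Qed.

Lemma integral_box_weight_hardy :
  (\int[mu]_x (hs x * (box_weight x * lastc x `^ (- sg)))%:E = ((2 * r) ^+ n * (2 * M))%:E)%E.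
Proof.
rewrite EFinM -(integral_log_window (ltW M0)).
rewrite -(integral_trial_box n M r1 (g := fun t => `|t^-1|)); try mpos.
apply: eq_integral => x _; congr EFin; rewrite mulrA hs_box_weight /box_weight -mulrA.
have [bx|_] := boolP (trial_box M r x); last by rewrite !mul0r.
have x0 := log_window_gt0 (andP bx).2.
rewrite -powRD ?(gt_eqF x0) ?implybT// gtr0_norm ?invr_gt0// -(powR_inv1 (ltW x0)).
by congr (_ * _ `^ _); ring.
Qed.

(** The factor (y_N / x_N)^(sg-1) in the first integral converts [omega](x)^p to [omega](y)^p; in
    the second it arises from the exchange of x and y, so both give the same value. *)
Lemma integral_box_log_kern q1 :
  (\int[leb]_a ((0 < a)%R%:R * log_kernel p s a)%:E = q1%:E)%E ->
  (\int[mu \x mu]_z (hs z.1 * hs z.2 * (box_weight z.1 *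
     (`|ln (lastc z.2 / lastc z.1)| `^ p * (lastc z.2 / lastc z.1) `^ (sg - 1)) *
     kern sg z.1 z.2))%:E =
   (kconst n sg * ((2 * r) ^+ n * (2 * M)) * q1)%:E)%E /\
  (\int[mu \x mu]_z (hs z.1 * hs z.2 * (box_weight z.2 *
     `|ln (lastc z.2 / lastc z.1)| `^ p * kern sg z.1 z.2))%:E =
   (kconst n sg * ((2 * r) ^+ n * (2 * M)) * q1)%:E)%E.
Proof.
move=> hq; have mw := measurable_box_weight; have w0 := box_weight_ge0.
have ln1p : `|ln 1| `^ p = 0 :> R by rewrite ln1 normr0 powR0// gt_eqF.
rewrite (@integral_kern_quotient R n sg box_weight
  (fun a => `|ln a| `^ p * a `^ (sg - 1)) sg0 mw w0); last 3 first.
- by msr.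
- by move=> t; pos.
- by rewrite ln1p mul0r.
rewrite (@integral_kern_quotient_swap R n sg box_weight (fun a => `|ln a| `^ p) sg0 mw w0); last 3 first.
- by msr.
- by move=> t; pos.
- exact: ln1p.
by rewrite integral_box_weight_hardy -/(log_kernel p s _) hq !EFinM.
Qed.

(** The factor e^(M sg), the largest x_N^sg on the window, is harmless because c^sg tends to 0 as r
    grows with M fixed. *)
Lemma integral_box_modulus_le C q2 c : 0 < c ->
  (forall c x, (\int[mu]_y (par_modulus c (x, y) * kern sg x y)%:E =
   C%:E * \int[leb]_t (trunc_kernel p s c t)%:E)%E) -> 0 <= C ->
  (\int[leb]_t (trunc_kernel p s 1 t)%:E = q2%:E)%E ->
  (\int[mu \x mu]_z (hs z.1 * hs z.2 *
     (box_weight z.1 * par_modulus c z * kern sg z.1 z.2))%:E <=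
   ((2 * r) ^+ n * (expR (M * sg) * (2 * M)) * (C * (c `^ sg * q2)))%:E)%E.
Proof.
move=> c0 hC C0 hq2; have mw := measurable_box_weight; have w0 := box_weight_ge0.
have mh := @measurable_hs R n.
have mk := @measurable_kern R n sg; have k0 := @kern_ge0 R n sg.
have mm := measurable_par_modulus c; have m0 := par_modulus_ge0 c.
have q20 : 0 <= q2 by rewrite -lee_fin -hq2; apply: integral_ge0_real => t; exact: trunc_kernel_ge0.
have mf : measurable_fun setT (fun z : V * V => hs z.1 * hs z.2 *
  (box_weight z.1 * par_modulus c z * kern sg z.1 z.2)) by msr.
have f0 z : 0 <= hs z.1 * hs z.2 * (box_weight z.1 * par_modulus c z * kern sg z.1 z.2) by pos.
have mg : measurable_fun setT (fun z : V * V => par_modulus c z * kern sg z.1 z.2) by msr.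
have msec (f : V * V -> R) x : measurable_fun setT f -> measurable_fun setT (fun y => f (x, y)).
  by move=> mf'; apply: (measurable_fun_comp mf'); msr.
rewrite (integral_prod_real mu mu mf f0).
apply: (@le_trans _ _ (\int[mu]_x ((C * (c `^ sg * q2)) * box_weight x)%:E)%E).
  apply: ge0_le_integral => //.
  - by move=> x _; apply: integral_ge0_real => y; exact: (f0 (x, y)).
  - apply: (measurable_integral_real mu (f := fun x y => hs x * hs y *
      (box_weight x * par_modulus c (x, y) * kern sg x y))); last by move=> x y; exact: (f0 (x, y)).
    by apply: eq_measurable_fun mf => -[].
  - by msr.
  move=> x _; have -> : ((C * (c `^ sg * q2)) * box_weight x)%:E =
      (\int[mu]_y (box_weight x * (par_modulus c (x, y) * kern sg x y))%:E)%E.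
    rewrite integralZl_real//; last 2 first.
    - exact: (msec _ x mg).
    - by move=> y; pos.
    by rewrite hC (integral_trunc_kernel p s c0) hq2 -!EFinM mulrC.
  apply: le_integral_real.
  - exact: (msec _ x mf).
  - by apply: measurable_fun_mul; [exact: measurable_cst|exact: (msec _ x mg)].
  - by move=> y; exact: (f0 (x, y)).
  move=> y /=; have -> : hs x * hs y * (box_weight x * par_modulus c (x, y) * kern sg x y) =
      hs y * ((hs x * box_weight x) * (par_modulus c (x, y) * kern sg x y)) by ring.
  rewrite hs_box_weight; apply: ler_piMl; first by pos.
  by rewrite /hs lern1; case: (_ < _).
rewrite integralZl_real//; last by rewrite !mulr_ge0 ?powR_ge0.
rewrite [X in (_ <= X)%E]EFinM [X in (_ <= X)%E]muleC lee_wpmul2l//.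
  by rewrite lee_fin !mulr_ge0 ?powR_ge0.
exact: integral_box_weight_le.
Qed.

End fixed_scales.
End trial_energy.

(** * The energy of the trial functions from above *)

Section trial_energy_bound.
Context {R : realType} (n : nat) (p s : R).
Hypotheses (p1 : 1 <= p) (s0 : 0 < s) (s1 : s < 1) (ps1 : p * s != 1).
Local Notation leb := (@lebesgue_measure R).
Local Notation mu := (rV_lebesgue R n.+1).
Local Notation V := ('rV[R]_n.+1).
Local Notation sg := (p * s).
Let p0 : 0 < p := p_gt0 p1.
Let sg0 : 0 < sg := ps_gt0 p1 s0.

Variables M r L t : R.
Hypotheses (M1 : 1 <= M) (r1 : 1 <= r) (L0 : 0 < L) (t0 : 0 < t) (t1 : t < 1).
Hypothesis bumpL : forall x y : R, `|bump x - bump y| <= L * `|x - y|.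
Let M0 : 0 < M. Proof. exact: lt_le_trans M1. Qed.
Let r0 : 0 < r. Proof. exact: lt_le_trans r1. Qed.

Local Notation u := (@trial R n p s M r).
Local Notation bw := (@box_weight R n p s M r).
Local Notation pm := (@par_modulus R n p (L / r)).
Local Notation k1 := ((1 - t) `^ (1 - p)).
Local Notation K := (t `^ (1 - p) * 2^-1 `^ (1 - p)).

Lemma par_cut_modulus (x y : V) : `|par_cut r x - par_cut r y| `^ p <= n%:R `^ p * pm (x, y).
Proof.
have d0 (i : 'I_n) : 0 <= `|bump (x ord0 (par i) / r) - bump (y ord0 (par i) / r)| by [].
apply: (@le_trans _ _ ((\sum_(i < n) `|bump (x ord0 (par i) / r) - bump (y ord0 (par i) / r)|) `^ p)).
  apply: ge0_ler_powR; rewrite ?nnegrE ?(ltW p0)// ?sumr_ge0//.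
  by apply: normB_prod_le => i; exact: bump01.
apply: (le_trans (powR_sum_le p0 d0)); rewrite ler_wpM2l ?powR_ge0//.
apply: ler_sum => i _; apply: ge0_ler_powR; rewrite ?nnegrE ?(ltW p0)//.
  by apply: trunc1_ge0; rewrite mulr_ge0 ?divr_ge0// ltW.
apply: le_trunc1.
  by rewrite ler_norml; have /andP[? ?] := bump01 (x ord0 (par i) / r);
    have /andP[? ?] := bump01 (y ord0 (par i) / r); apply/andP; split; lra.
apply: (le_trans (bumpL _ _)); rewrite -mulrBl normrM normfV (gtr0_norm r0).
by rewrite mulrA mulrAC.
Qed.

Lemma log_cut_modulus (a b : R) : 0 < a -> 0 < b ->
  `|log_cut M a - log_cut M b| `^ p <= (L / M) `^ p * `|ln (b / a)| `^ p.
Proof.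
move=> a0 b0; rewrite -powRM ?divr_ge0 ?(ltW L0) ?(ltW M0)//.
apply: ge0_ler_powR; rewrite ?nnegrE ?mulr_ge0 ?divr_ge0 ?(ltW L0) ?(ltW p0) ?(ltW M0)//.
  by rewrite invr_ge0 ltW.
apply: (le_trans (bumpL _ _)); rewrite -mulrBl normrM normfV (gtr0_norm M0).
by rewrite ln_div ?posrE// distrC mulrA mulrAC.
Qed.

Lemma trial_difference_le (x y : V) : 0 < lastc x -> 0 < lastc y ->
  `|u x - u y| `^ p <=
  k1 * (`|u x| `^ p * `|1 - ratio p s (lastc y / lastc x)| `^ p) +
  (K * (L / M) `^ p) * (bw x * (`|ln (lastc y / lastc x)| `^ p * (lastc y / lastc x) `^ (sg - 1)) +
     bw y * `|ln (lastc y / lastc x)| `^ p) +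
  (K * n%:R `^ p) * (bw y * pm (x, y) + bw x * pm (x, y)).
Proof.
move=> x0 y0; set a := lastc x in x0 *; set b := lastc y in y0 *; set q := b / a.
have q0 : 0 < q by rewrite divr_gt0.
have K0 : 0 <= K by rewrite mulr_ge0 ?powR_ge0.
have wp c : 0 < c -> (c `^ (- alpha p s)) `^ p = c `^ (sg - 1).
  by move=> c0; rewrite -powRrM mulNr (alphap _ p1) opprB.
have bq' c : b `^ c = a `^ c * q `^ c.
  by rewrite -powRM ?(ltW q0) ?(ltW x0)// mulrC divfK// gt_eqF.
have := @trial_split_le R p t (par_cut r x) (par_cut r y) (log_cut M a) (log_cut M b)
  (a `^ (- alpha p s)) (b `^ (- alpha p s)) (par_box r x) (par_box r y)
  (log_window M a) (log_window M b) p1 t0 t1 (par_cut01 _ _) (par_cut01 _ _)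
  (bump01 _) (bump01 _) (powR_ge0 _ _) (powR_ge0 _ _) (@par_cut_out _ _ _ r1 x)
  (@par_cut_out _ _ _ r1 y) (log_cut_out M1 x0) (log_cut_out M1 y0).
rewrite -!trialE// !wp//; move=> h; apply: (le_trans h).
(* The difference of the ground state at the two points is factored through its value at x. *)
have -> : par_cut r x * (a `^ (- alpha p s) - b `^ (- alpha p s)) * log_cut M a =
    u x * (1 - ratio p s q) by rewrite trialE// -/a /ratio (bq' (- alpha p s)); ring.
have hl := log_cut_modulus x0 y0; rewrite -/q in hl.
have hp := par_cut_modulus x y.
have B0 (c : bool) (d : R) : 0 <= c%:R * d `^ (sg - 1) by pos.
have e1 := ler_wpM2l (B0 (trial_box M r x) b) hl.
have e2 := ler_wpM2l (B0 (trial_box M r y) b) hl.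
have e3 := ler_wpM2l (B0 (trial_box M r y) b) hp.
have e4 := ler_wpM2l (B0 (trial_box M r x) a) hp.
have e := ler_wpM2l K0 (lerD (lerD e1 e2) (lerD e3 e4)).
have -> : `|u x * (1 - ratio p s q)| `^ p = `|u x| `^ p * `|1 - ratio p s q| `^ p.
  by rewrite normrM powRM ?normr_ge0.
rewrite -[leRHS]addrA lerD2l; move: e; rewrite -!mulrA => e; apply: (le_trans e).
rewrite le_eqVlt; apply/orP; left; apply/eqP.
by rewrite /box_weight -/a -/b (bq' (sg - 1)); ring.
Qed.

Lemma trial_energy_le (C q1 q2 : R) : 0 <= C ->
  (forall c x, (\int[mu]_y (par_modulus p c (x, y) * kern sg x y)%:E =
   C%:E * \int[leb]_t (trunc_kernel p s c t)%:E)%E) ->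
  (\int[leb]_a ((0 < a)%R%:R * log_kernel p s a)%:E = q1%:E)%E ->
  (\int[leb]_t (trunc_kernel p s 1 t)%:E = q2%:E)%E ->
  (gagliardo p s u <= (k1 * hardy_const n.+1 p s)%:E * hardy_integral p s u +
   (K * (L / M) `^ p * (2 * (kconst n sg * ((2 * r) ^+ n * (2 * M)) * q1)) +
    K * n%:R `^ p * (2 * ((2 * r) ^+ n * (expR (M * sg) * (2 * M)) *
       (C * ((L / r) `^ sg * q2)))))%:E)%E.
Proof.
move=> C0 hC hq1 hq2.
have mu_ := @measurable_trial R n p s M r M1 r1.
have mw := @measurable_box_weight R n p s M r; have w0 := @box_weight_ge0 R n p s M r.
have mm := @measurable_par_modulus R n p (L / r); have m0 := @par_modulus_ge0 R n p (L / r).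
have mh := @measurable_hs R n; have ml := @measurable_lastc R n.
have mk := @measurable_kern R n sg; have k0 := @kern_ge0 R n sg.
have mr := @measurable_ratio R p s.
have c0 : 0 < L / r by rewrite divr_gt0.
pose q (z : V * V) := lastc z.2 / lastc z.1.
have mq : measurable_fun setT q by rewrite /q; msr.
pose G1 z := hs z.1 * hs z.2 * (`|u z.1| `^ p * `|1 - ratio p s (q z)| `^ p * kern sg z.1 z.2).
pose G2 z := hs z.1 * hs z.2 * (bw z.1 * (`|ln (q z)| `^ p * q z `^ (sg - 1)) * kern sg z.1 z.2).
pose G2' z := hs z.1 * hs z.2 * (bw z.2 * `|ln (q z)| `^ p * kern sg z.1 z.2).
pose G3 z := hs z.1 * hs z.2 * (bw z.1 * pm z * kern sg z.1 z.2).
pose G3' z := hs z.1 * hs z.2 * (bw z.2 * pm z * kern sg z.1 z.2).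
have mG1 : measurable_fun setT G1 by rewrite /G1; msr.
have mG2 : measurable_fun setT G2 by rewrite /G2; msr.
have mG2' : measurable_fun setT G2' by rewrite /G2'; msr.
have mG3 : measurable_fun setT G3 by rewrite /G3; msr.
have mG3' : measurable_fun setT G3' by rewrite /G3'; msr.
have G10 z : 0 <= G1 z by rewrite /G1; pos.
have G20 z : 0 <= G2 z by rewrite /G2; pos.
have G2'0 z : 0 <= G2' z by rewrite /G2'; pos.
have G30 z : 0 <= G3 z by rewrite /G3; pos.
have G3'0 z : 0 <= G3' z by rewrite /G3'; pos.
have I1 : (\int[mu \x mu]_z (G1 z)%:E = (hardy_const n.+1 p s)%:E * hardy_integral p s u)%E.
  exact: integral_ratio_kern.
have [I2 I2'] := integral_box_log_kern n p1 s0 M1 r1 hq1.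
have I3 : (\int[mu \x mu]_z (G3 z)%:E <= ((2 * r) ^+ n * (expR (M * sg) * (2 * M)) *
       (C * ((L / r) `^ sg * q2)))%:E)%E.
  exact: (integral_box_modulus_le p1 s0 M1 r1 c0 hC C0 hq2).
have I3' : (\int[mu \x mu]_z (G3' z)%:E = \int[mu \x mu]_z (G3 z)%:E)%E.
  rewrite (integral_prod_swap mG3' G3'0); apply: eq_integral => -[x y] _; congr EFin.
  by rewrite /G3' /G3 /= kernC par_modulusC; ring.
set B2 := kconst n sg * _ * q1 in I2 I2' *; set B3 := (2 * r) ^+ n * _ * _ in I3 *.
set A2 := K * (L / M) `^ p; set A3 := K * n%:R `^ p.
have A20 : 0 <= A2 by rewrite /A2; pos.
have A30 : 0 <= A3 by rewrite /A3; pos.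
pose P z := hs z.1 * hs z.2 * (`|u z.1 - u z.2| `^ p * kern sg z.1 z.2).
pose Q2 z := A2 * (G2 z + G2' z); pose Q3 z := A3 * (G3' z + G3 z).
have mP : measurable_fun setT P by rewrite /P; msr.
have P0 z : 0 <= P z by rewrite /P; pos.
have mQ2 : measurable_fun setT Q2 by rewrite /Q2; msr.
have mQ3 : measurable_fun setT Q3 by rewrite /Q3; msr.
have Q20 z : 0 <= Q2 z by rewrite /Q2; pos.
have Q30 z : 0 <= Q3 z by rewrite /Q3; pos.
have mS1 : measurable_fun setT (fun z => k1 * G1 z) by msr.
have mS2 : measurable_fun setT (fun z => k1 * G1 z + Q2 z) by msr.
have S10 z : 0 <= k1 * G1 z by pos.
have S20 z : 0 <= k1 * G1 z + Q2 z by pos.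
have m22 : measurable_fun setT (fun z => G2 z + G2' z) by msr.
have m33 : measurable_fun setT (fun z => G3' z + G3 z) by msr.
have g22 z : 0 <= G2 z + G2' z by pos.
have g33 z : 0 <= G3' z + G3 z by pos.
rewrite gagliardoE -/P.
apply: (@le_trans _ _ (\int[mu \x mu]_z (k1 * G1 z + Q2 z + Q3 z)%:E)%E).
  apply: (le_integral_real _ mP _ P0); first by msr.
  move=> [x y]; rewrite /P /Q2 /Q3 /G1 /G2 /G2' /G3 /G3' /q /=.
  have [x0|x0] := ltP 0 (lastc x); last by rewrite (hs0 x0) !mul0r !(mulr0, addr0).
  have [y0|y0] := ltP 0 (lastc y); last by rewrite (hs0 y0) !mulr0 !mul0r !(mulr0, addr0).
  rewrite (hs1 x0) (hs1 y0) !mul1r.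
  apply: (le_trans (ler_wpM2r (k0 x y) (trial_difference_le x0 y0))).
  by rewrite le_eqVlt; apply/orP; left; apply/eqP; rewrite /A2 /A3; ring.
rewrite (integralD_real _ mS2 mQ3 S20 Q30) (integralD_real _ mS1 mQ2 S10 Q20).
rewrite (integralZl_real _ (powR_ge0 _ _) mG1 G10) I1.
rewrite (integralZl_real _ A20 m22 g22) (integralD_real _ mG2 mG2' G20 G2'0).
rewrite (integralZl_real _ A30 m33 g33) (integralD_real _ mG3' mG3 G3'0 G30) I3'.
have J2 : (\int[mu \x mu]_z (G2 z)%:E = B2%:E)%E by exact: I2.
have J2' : (\int[mu \x mu]_z (G2' z)%:E = B2%:E)%E by exact: I2'.
rewrite J2 J2' muleA -EFinM -addeA EFinD.
apply: leeD; first exact: lexx.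
apply: leeD; first by rewrite -EFinD -EFinM lee_fin; lra.
have -> : (A3 * (2 * B3))%:E = (A3%:E * (B3%:E + B3%:E))%E.
  by rewrite -EFinD -EFinM; congr EFin; ring.
apply: lee_wpmul2l; first by rewrite lee_fin.
exact: (leeD I3 I3).
Qed.

End trial_energy_bound.

(** * Optimality of the constant *)

Section optimality.
Context {R : realType} (n : nat) (p s : R).
Hypotheses (p1 : 1 <= p) (s0 : 0 < s) (s1 : s < 1).
Local Notation leb := (@lebesgue_measure R).
Local Notation V := ('rV[R]_n.+1).
Local Notation sg := (p * s).
Let p0 : 0 < p := p_gt0 p1.
Let sg0 : 0 < sg := ps_gt0 p1 s0.

Lemma exists_split_param (D C : R) : D < C ->
  exists t : R, [/\ 0 < t, t < 1 & (1 - t) `^ (1 - p) * D < C].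
Proof.
move=> DC; have cf : (fun t : R => (1 - t) `^ (1 - p) * D) @ (0 : R)^'+ --> D.
  have {2}-> : D = (1 - 0) `^ (1 - p) * D by rewrite subr0 powR1r mul1r.
  apply: cvg_at_right_filter; apply: cvgM; last exact: cvg_cst.
  apply: (@continuous_comp _ _ _ (fun t : R => 1 - t) (fun x : R => x `^ (1 - p))).
    by apply: cvgB; [exact: cvg_cst|exact: cvg_id].
  by apply: continuous_powR_gt0; rewrite subr0.
have h1 : \forall t \near (0 : R)^'+, (1 - t) `^ (1 - p) * D < C.
  exact: (cvgr_lt _ cf _ DC).
have h2 : \forall t \near (0 : R)^'+, 0 < t by exact: nbhs_right_gt.
have h3 : \forall t \near (0 : R)^'+, t < 1 by exact: nbhs_right_lt.
by have [t [? [? ?]]] := filter_ex (filterI h1 (filterI h2 h3)); exists t.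
Qed.

(** The choices are ordered: t leaves a gap [d] = C - k1 D > 0, then [M] makes [d] [c1] [M] exceed
    the logarithmic error [B1] by more than 1, then [r] brings the parallel error below 1. All
    bounds are relative to r^n. *)
Lemma hardy_const_optimal (C : R) : hardy_const n.+1 p s < C ->
  ~ (forall u : V -> R, W_space p s u -> (C%:E * hardy_integral p s u <= gagliardo p s u)%E).
Proof.
set D := hardy_const _ _ _ => DC hall.
have [t [t0 t1 tC]] := exists_split_param DC.
have [L L0 bumpL] := smooth1_lipschitz (@smooth1_bump R)
  (fun x h => bump_support (ltW h)).
have [C0 C00 hC0] := integral_par_modulus n p1 s0.
have [q1 q10 hq1] : exists2 q1 : R, 0 <= q1 &
    (\int[leb]_a ((0 < a)%R%:R * log_kernel p s a)%:E = q1%:E)%E.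
  have I0 : (0 <= \int[leb]_a ((0 < a)%R%:R * log_kernel p s a)%:E)%E.
    by apply: integral_ge0_real => a; rewrite mulr_ge0// log_kernel_ge0.
  exists (fine (\int[leb]_a ((0 < a)%R%:R * log_kernel p s a)%:E)%E); first exact: fine_ge0.
  by rewrite fineK// ge0_fin_numE//; exact: integral_log_kernel_lty.
have [q2 q20 hq2] : exists2 q2 : R, 0 <= q2 &
    (\int[leb]_a (trunc_kernel p s 1 a)%:E = q2%:E)%E.
  have I0 : (0 <= \int[leb]_a (trunc_kernel p s 1 a)%:E)%E.
    by apply: integral_ge0_real => a; exact: trunc_kernel_ge0.
  exists (fine (\int[leb]_a (trunc_kernel p s 1 a)%:E)%E); first exact: fine_ge0.
  by rewrite fineK// ge0_fin_numE//; exact: integral_trunc_kernel1_lty.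
have kc0 := ltW (kconst_gt0 n sg0); set kc := kconst n sg in kc0.
pose K := t `^ (1 - p) * 2^-1 `^ (1 - p).
have K0 : 0 <= K by rewrite /K; pos.
pose k1 := (1 - t) `^ (1 - p); rewrite -/k1 in tC.
pose c1 := (expR (- 4) ^+ n.+1) `^ p : R.
have c10 : 0 < c1 by rewrite powR_gt0// exprn_gt0// expR_gt0.
pose d := C - k1 * D; have d0 : 0 < d by rewrite subr_gt0.
(* The logarithmic error divided by r^n, with (L/M)^p M already replaced by its bound L^p. *)
pose B1 := K * L `^ p * (4 * kc * 2 ^+ n * q1).
have B10 : 0 <= B1 by rewrite /B1; pos.
pose M := 1 + (B1 + 1) / (d * c1).
have M1 : 1 <= M by rewrite lerDl divr_ge0 ?addr_ge0// mulr_ge0 ?ltW.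
have M0 : 0 < M by exact: lt_le_trans M1.
have dM : B1 + 1 < d * c1 * M.
  have dc0 : 0 < d * c1 by exact: mulr_gt0.
  by rewrite /M mulrDr mulr1 mulrCA divff ?gt_eqF// mulr1 ltrDr.
(* The parallel error divided by r^n is [B2] / r^sg; choosing r^sg = 1 + [B2] makes it less than
   1. *)
pose B2 := K * n%:R `^ p * (2 * (2 ^+ n * (expR (M * sg) * (2 * M)) * (C0 * (L `^ sg * q2)))).
have B20 : 0 <= B2 by rewrite /B2; pos.
pose r := (1 + B2) `^ sg^-1.
have r1 : 1 <= r.
  rewrite -(powR1r sg^-1) ge0_ler_powR ?nnegrE ?invr_ge0 ?(ltW sg0)//.
  - by rewrite addr_ge0.
  - by rewrite lerDl.
have r0 : 0 < r by exact: lt_le_trans r1.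
have rsg : r `^ sg = 1 + B2.
  by rewrite -powRrM mulVf ?gt_eqF// powRr1// addr_ge0.
have tu := test_function_trial n p s M1 r1.
have := hall _ (test_function_W_space s p0 tu).
have := trial_energy_le p1 s0 s1 M1 r1 L0 t0 t1 bumpL C00 hC0 hq1 hq2.
have := trial_hardy_ge n s p1 M1 r1.
have := test_function_hardy_lty p1 s0 tu.
set H := hardy_integral _ _ _; set E := gagliardo _ _ _.
rewrite -/c1 -/K -/k1 -/D -/kc => Hlt Hge Ele CE.
have Hfin : H \is a fin_num.
  by rewrite ge0_fin_numE// (le_trans _ Hge)// lee_fin mulr_ge0 ?(ltW c10)// mulr_ge0 ?exprn_ge0 ?ltW.
move: (le_trans CE Ele) Hge; rewrite -(fineK Hfin); set h := fine H.
rewrite -!EFinM -EFinD !lee_fin => hup hlow.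
(* Here M^(1-p) <= 1, because M >= 1 and p >= 1. *)
have e1 : (L / M) `^ p * M <= L `^ p.
  rewrite powRM ?(ltW L0) ?invr_ge0 ?(ltW M0)// -mulrA ler_piMr ?powR_ge0//.
  rewrite -(powR_inv1 (ltW M0)) -powRrM mulN1r -{2}(powRr1 (ltW M0)) -powRD ?(gt_eqF M0) ?implybT//.
  have np : - p + 1 <= 0 by rewrite addrC subr_le0.
  by have := ler_powR M1 np; rewrite powRr0.
have e2 : (L / r) `^ sg = L `^ sg * (1 + B2)^-1.
  rewrite powRM ?(ltW L0) ?invr_ge0 ?(ltW r0)//; congr (_ * _).
  by rewrite -(powR_inv1 (ltW r0)) -powRrM mulN1r powRN rsg.
have rn0 : 0 < r ^+ n by rewrite exprn_gt0.
have up : d * h <= r ^+ n * (B1 + B2 / (1 + B2)).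
  have -> : d * h = C * h - k1 * D * h by rewrite /d; ring.
  rewrite lerBlDl; apply: (le_trans hup); rewrite lerD2l e2 exprMn.
  have -> : r ^+ n * (B1 + B2 / (1 + B2)) = r ^+ n * B1 + r ^+ n * (B2 / (1 + B2)) by ring.
  apply: lerD; last by rewrite le_eqVlt /B2; apply/orP; left; apply/eqP; ring.
  have -> : K * (L / M) `^ p * (2 * (kc * (2 ^+ n * r ^+ n * (2 * M)) * q1)) =
     ((L / M) `^ p * M) * (K * (4 * kc * 2 ^+ n * q1) * r ^+ n) by ring.
  have -> : r ^+ n * B1 = L `^ p * (K * (4 * kc * 2 ^+ n * q1) * r ^+ n) by rewrite /B1; ring.
  by apply: (ler_wpM2r _ e1); pos.
have low : r ^+ n * (d * c1 * M) <= d * h.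
  have -> : r ^+ n * (d * c1 * M) = d * (c1 * (r ^+ n * M)) by ring.
  by rewrite ler_pM2l.
have := le_trans low up; rewrite ler_pM2l// => dM_le.
have : B2 / (1 + B2) <= 1 by rewrite ler_pdivrMr ?mul1r ?lerDr// ltr_wpDr.
by lra.
Qed.

End optimality.

Theorem theorem1p1 (R : realType) (n : nat) (p s : R)
    (hp : 1 <= p) (hs0 : 0 < s) (hs1 : s < 1) (hps : p * s != 1) :
  let D := hardy_const n.+1 p s in
  [/\ forall u : 'rV[R]_n.+1 -> R, W_space p s u ->
        (D%:E * hardy_integral p s u <= gagliardo p s u)%E,
      forall C : R, D < C ->
        ~ (forall u : 'rV[R]_n.+1 -> R, W_space p s u ->
             (C%:E * hardy_integral p s u <= gagliardo p s u)%E),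
      p = 1 -> n.+1 = 1%N -> forall u : 'rV[R]_n.+1 -> R, W_space p s u ->
        (gagliardo p s u = (D%:E * hardy_integral p s u)%E <->
         exists (c : R) (g : R -> R),
           (forall a b : R, 0 < a -> a <= b -> g b <= g a) /\
           {ae rV_lebesgue R n.+1, forall x, half_space x ->
              u x = c * g (x ord0 ord_max)})
    & (1 < p \/ p = 1 /\ (2 <= n.+1)%N) ->
        forall u : 'rV[R]_n.+1 -> R, W_space p s u ->
        ~ {ae rV_lebesgue R n.+1, forall x, half_space x -> u x = 0} ->
        (D%:E * hardy_integral p s u < gagliardo p s u)%E].
Proof.
split.
- by move=> u; exact: W_space_hardy_le.
- by move=> C; exact: hardy_const_optimal.
- by move=> pe ne u; exact: W_space_hardy_eq_p1.
- by move=> hpn u; exact: W_space_hardy_lt.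
Qed.
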